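(* Consider the following eleven rows of lattices (each row indexed by $\rho-d$, with $\rho$ the rank and $d$ the rank of the 2-primary discriminant, lattices in a row ordered by increasing $t$): $\rho-d=0$: $-A_1+\langle6\rangle+tA_1$, $d=t+2$, $0\le t\le9$; $\rho-d=2$: $-A_1+A_2+tA_1$, $d=t+1$, $0\le t\le9$; $\rho-d=4$: $U+A_2+tA_1$, $d=t$, $1\le t\le9$; $\rho-d=6$: $U+A_2+D_4+tA_1$, $d=t+2$, $1\le t\le6$; $\rho-d=8$: $-A_1+\langle6\rangle+E_8+tA_1$, $d=t+2$, $0\le t\le5$; $\rho-d=10$: $-A_1+A_2+E_8+tA_1$, $d=t+1$, $0\le t\le5$; $\rho-d=12$: $U+A_2+E_8+tA_1$, $d=t$, $1\le t\le5$; $\rho-d=14$: $U+A_2+D_4+E_8+tA_1$, $d=t+2$, $1\le t\le2$; $\rho-d=16$: $-A_1+\langle6\rangle+2E_8+tA_1$, $d=t+2$, $0\le t\le1$; $\rho-d=18$: $-A_1+A_2+2E_8+tA_1$, $d=t+2$, $0\le t\le1$; $\rho-d=20$: $U+A_2+2E_8+tA_1$, $d=t$, $t=1$. In this table the first achiral lattice in the first row $\rho=d$ is defined by $t=2$, in the rows $\rho=d+2k$, $k=1,\dots,6$, it is defined by $\rho+d=14$, and in the last four rows all lattices are achiral.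
   Context: These are the lattices $\mathbb M_+^0$ (invariant part of $H^4$ of a real non-singular cubic fourfold, orthogonal to the polarization) for the coarse deformation classes with odd 2-primary discriminant form. $U$ hyperbolic plane, $A_n,D_n,E_n$ positive definite root lattices, $-A_1=\langle-2\rangle$, $\langle6\rangle$ rank one lattice with generator of square 6, $+$ orthogonal sum. Within each row, achirality of a lattice implies achirality of all lattices with larger $t$ (adding $A_1$ preserves achirality), so ''first achiral lattice'' means all earlier ones are chiral and all later ones achiral. For an even hyperbolic lattice $\mathbb L$ with $\operatorname{discr}_3\mathbb L=\mathbb Z/3$ and $\operatorname{discr}_2$ of period 2: $W$ is generated by reflections in 2-roots ($v^2=2$) and 6-roots ($v^2=6$, $v\cdot\mathbb L\subset3\mathbb Z$); cells $P$ are fundamental chambers of $W$ in the hyperbolic space, lifting to $\pm P^\#$ in the double cover. An automorphism is $P$-direct if it preserves $P^\#$, $\mathbb Z/3$-reversing if it acts as $-\operatorname{id}$ on $\operatorname{discr}_3\mathbb L$. $\mathbb L$ is achiral if it admits an automorphism that is $\mathbb Z/3$-reversing and $P$-direct for some cell $P$, chiral otherwise. *)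

(* Defs.v *)
From HB Require Import structures.
From mathcomp Require Import all_boot all_order all_algebra.
Set Implicit Arguments. Unset Strict Implicit. Unset Printing Implicit Defensive.
Import Order.TTheory GRing.Theory Num.Theory.
Local Open Scope ring_scope.

Record lat := Lat { ldim : nat; gram : 'M[int]_ldim }.

Definition osum (L1 L2 : lat) : lat :=
  @Lat (ldim L1 + ldim L2) (block_mx (gram L1) 0 0 (gram L2)).

Definition dynkin (n : nat) (e : rel nat) : 'M[int]_n :=
  \matrix_(i, j) (if i == j then 2 else if e i j || e j i then -1 else 0).

Definition latU : lat := @Lat 2 (\matrix_(i, j) (if i == j then 0 else 1)).
Definition latA2 : lat := @Lat 2 (dynkin 2 (fun i j => (i == 0)%N && (j == 1)%N)).
Definition latD4 : lat := @Lat 4 (dynkin 4 (fun i j => (i == 0)%N && (0 < j)%N)).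
Definition latE8 : lat := @Lat 8 (dynkin 8
  (fun i j => ((j == i.+1) && (i < 6))%N || ((i == 4) && (j == 7))%N)).
Definition rk1 (c : int) : lat := @Lat 1 (c%:M).
Definition latA1 : lat := rk1 2.
Definition latmA1 : lat := rk1 (-2).
Definition lat6 : lat := rk1 6.
Definition tA1 (t : nat) : lat := @Lat t ((2 : int)%:M).

Section Lattice.
Variable L : lat.
Let n := ldim L.
Let G := gram L.

Definition vQ (v : 'rV[int]_n) : 'rV[rat]_n := map_mx (fun z : int => z%:~R) v.
Definition GQ : 'M[rat]_n := map_mx (fun z : int => z%:~R) G.

Definition bilZ (v w : 'rV[int]_n) : int := (v *m G *m w^T) 0 0.
Definition bilQ (x y : 'rV[rat]_n) : rat := (x *m GQ *m y^T) 0 0.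

Definition intvecQ (x : 'rV[rat]_n) : Prop := exists v : 'rV[int]_n, x = vQ v.
Definition isIntQ (q : rat) : Prop := exists z : int, q = z%:~R.

Definition root2 (v : 'rV[int]_n) : Prop := bilZ v v = 2.
Definition root6 (v : 'rV[int]_n) : Prop :=
  bilZ v v = 6 /\ forall w : 'rV[int]_n, (3 %| bilZ v w)%Z.
Definition isroot (v : 'rV[int]_n) : Prop := root2 v \/ root6 v.

(* automorphisms (isometries) of L, acting on row vectors by x |-> x *m g *)
Definition isAut (g : 'M[int]_n) : Prop := g *m G *m g^T = G.
Definition gQ (g : 'M[int]_n) : 'M[rat]_n := map_mx (fun z : int => z%:~R) g.

Definition in_dual (x : 'rV[rat]_n) : Prop :=
  forall w : 'rV[int]_n, isIntQ (bilQ x (vQ w)).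

(* g acts as -id on discr_3 L (the 3-primary part of L^*/L) *)
Definition Z3_reversing (g : 'M[int]_n) : Prop :=
  forall x : 'rV[rat]_n, in_dual x ->
    (exists k : nat, intvecQ ((3 ^+ k : rat) *: x)) ->
    intvecQ (x *m gQ g + x).

(* the cone of negative vectors (double cover of the hyperbolic space) *)
Definition cone (x : 'rV[rat]_n) : Prop := bilQ x x < 0.
Definition generic (x : 'rV[rat]_n) : Prop :=
  forall v, isroot v -> bilQ x (vQ v) != 0.
(* x and y lie in the same (open) lifted cell P^# : same half of the cone and
   not separated by any mirror of W *)
Definition same_cell (x y : 'rV[rat]_n) : Prop :=
  [/\ cone x, cone y, bilQ x y < 0, generic x & generic y] /\
      forall v, isroot v -> (0 < bilQ x (vQ v)) = (0 < bilQ y (vQ v)).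

(* achirality: some automorphism is Z/3-reversing and maps some lifted cell
   P^# = {y | same_cell x0 y} onto itself *)
Definition achiral : Prop :=
  exists g : 'M[int]_n, [/\ isAut g, Z3_reversing g &
    exists x0 : 'rV[rat]_n, cone x0 /\ generic x0 /\
      forall y : 'rV[rat]_n, same_cell x0 y <-> same_cell x0 (y *m gQ g)].

End Lattice.

Definition chiral (L : lat) : Prop := ~ achiral L.

Definition Lrow0 t := osum (osum latmA1 lat6) (tA1 t).
Definition Lrow1 t := osum (osum latmA1 latA2) (tA1 t).
Definition Lrow2 t := osum (osum latU latA2) (tA1 t).
Definition Lrow3 t := osum (osum (osum latU latA2) latD4) (tA1 t).
Definition Lrow4 t := osum (osum (osum latmA1 lat6) latE8) (tA1 t).
Definition Lrow5 t := osum (osum (osum latmA1 latA2) latE8) (tA1 t).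
Definition Lrow6 t := osum (osum (osum latU latA2) latE8) (tA1 t).
Definition Lrow7 t := osum (osum (osum (osum latU latA2) latD4) latE8) (tA1 t).
Definition Lrow8 t := osum (osum (osum (osum latmA1 lat6) latE8) latE8) (tA1 t).
Definition Lrow9 t := osum (osum (osum (osum latmA1 latA2) latE8) latE8) (tA1 t).
Definition Lrow10 t := osum (osum (osum (osum latU latA2) latE8) latE8) (tA1 t).

(* Main.v *)
Require Import Defs.
From Stdlib Require Import ZArith Lia Classical.
From mathcomp Require Import all_boot all_order all_algebra.
From mathcomp Require Import ssrZ zify.
Set Implicit Arguments. Unset Strict Implicit. Unset Printing Implicit Defensive.
Import Order.TTheory GRing.Theory Num.Theory.

(** Chirality.  Each of the fourteen chiral lattices is reflective: Vinberg's algorithm gives a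
    finite set R of simple roots whose chamber {x | (x, r) >= 0 for r in R} lies in the light cone.
    For a suitable integral interior point p the roots of small height (p, u) are listed by
    Fincke-Pohst enumeration, and a descent on the height, driven by reflections in R, shows that
    every positive root is a sum of elements of R.  Hence an isometry preserving a cell can be
    conjugated to one that permutes R.  There is a 6-root r0 in R such that every 6-root of R with
    the same products with R, up to order, is congruent to r0 modulo 3; so the class of r0 / 3 in
    the 3-part of the discriminant group is fixed, and the isometry is not reversing.

    Achirality.  In the first achiral lattice of a row with rho + d = 14 there is a primitive
    sublattice E6(2), orthogonal to a 2-elementary hyperbolic lattice M, such that the involution g
    equal to -1 on E6(2) and to 1 on M extends to the lattice.  It is reversing because the 3-part
    of the discriminant group comes from E6(2), and E6(2) contains no 2- or 6-roots, so that some
    x in M lies on no mirror: g fixes the cell of x.  The same involution serves in the last four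
    rows; in the first row a symmetry of the Coxeter graph is used.  Adding copies of A1 preserves
    such a pair (g, x), after replacing x by a large multiple of x plus the sum of the generators
    of the A1's. *)

Local Open Scope Z_scope.
(* The key %Z stands for MathComp's int_scope. *)
Delimit Scope Z_scope with BZ.
Arguments Z.mul : simpl never.
Arguments Z.add : simpl never.
Arguments Z.eqb : simpl never.
Arguments Z.leb : simpl never.
Arguments Z.ltb : simpl never.

(** * Quadratic forms over Z and enumeration of short vectors *)

(** Hyperbolicity is obtained by computation: for an integral p with N = -(p, p) > 0 the form N (u,
    u) + lam (p, u)^2 is certified positive definite by the pivots of the enumeration, and this
    yields the reversed Cauchy-Schwarz inequality with respect to p. The obstacle is that there are
    infinitely many roots, of which only those of height below two thresholds T2 and T6 can be
    inspected. Above the thresholds, a simple root r whose reflection made a positive root u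
    nonpositive would contradict the sign of the Gram determinant of p, u and r; the inequalities
    between T2, T6 and the heights of R are chosen for this argument. The position of the chamber in
    the light cone enters as nonpositivity of the form on the chamber, proved by writing the form as
    a combination of products of linear forms. E6(2) has no 2- or 6-roots because its norms are
    divisible by 4. All certificates are lists of binary integers, evaluated by [vm_compute]. The
    way they were found is not trusted: [chiral_check] and [achiral_check] verify every property
    that the proofs use. *)

Fixpoint dot (a b : seq Z) : Z :=
  match a, b with
  | x :: a', y :: b' => x * y + dot a' b'
  | _, _ => 0
  end.

Definition vscale (c : Z) (a : seq Z) : seq Z := [seq c * x | x <- a].

(** The shorter list counts as padded with zeros, so that [dot_add] and [qeval_add] hold without
    hypotheses on lengths. *)
Fixpoint vadd (a b : seq Z) : seq Z :=
  match a, b with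
  | x :: a', y :: b' => (x + y) :: vadd a' b'
  | [::], _ => b
  | _, [::] => a
  end.

Lemma dot_scale c a y : dot (vscale c a) y = c * dot a y.
Proof. elim: a y => [|x a IH] [|z y] /=; try lia. rewrite IH; lia. Qed.

Lemma dot_add a b y : dot (vadd a b) y = dot a y + dot b y.
Proof. elim: a b y => [|x a IH] [|z b] [|w y] //=; try lia. rewrite IH; lia. Qed.

(* A quadratic form is stored by its upper triangle: a block (a, r) stands for
   a x^2 + 2 x (r . y), where x is the first coordinate and y the others. *)
Definition qform := seq (Z * seq Z).

Fixpoint qeval (q : qform) (v : seq Z) : Z :=
  match q, v with
  | (a, r) :: q', x :: y => a * x * x + 2 * x * dot r y + qeval q' y
  | _, _ => 0
  end.

Definition qscale (c : Z) (q : qform) : qform := [seq (c * b.1, vscale c b.2) | b <- q].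

Fixpoint qadd (q1 q2 : qform) : qform :=
  match q1, q2 with
  | (a, r) :: q1', (b, s) :: q2' => (a + b, vadd r s) :: qadd q1' q2'
  | [::], _ => q2
  | _, [::] => q1
  end.

(** Twice the product of two linear forms: the stored off-diagonal entries are halves of the
    coefficients, and the factor 2 keeps them integral. *)
Fixpoint qprod (f g : seq Z) : qform :=
  match f, g with
  | x :: f', y :: g' =>
      (2 * x * y, vadd (vscale x g') (vscale y f')) :: qprod f' g'
  | _, _ => [::]
  end.

Lemma qeval_scale c q v : qeval (qscale c q) v = c * qeval q v.
Proof.
elim: q v => [|[a r] q IH] [|x y] //=; try lia.
by rewrite IH dot_scale; lia.
Qed.

Lemma qeval_add q1 q2 v : qeval (qadd q1 q2) v = qeval q1 v + qeval q2 v.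
Proof.
elim: q1 q2 v => [|[a r] q1 IH] [|[b s] q2] [|x y] //=; try lia.
by rewrite IH dot_add; lia.
Qed.

Lemma qeval_prod f g v : size f = size g -> qeval (qprod f g) v = 2 * dot f v * dot g v.
Proof.
elim: f g v => [|x f IH] [|y g] [|z v] //= [sfg]; try lia.
by rewrite IH // dot_add !dot_scale; lia.
Qed.

Fixpoint qsquare (f : seq Z) : qform :=
  if f is x :: f' then (x * x, vscale x f') :: qsquare f' else [::].

Lemma qeval_square f v : qeval (qsquare f) v = dot f v * dot f v.
Proof.
elim: f v => [|x f IH] [|z v] //=; try lia.
by rewrite IH dot_scale; lia.
Qed.

Definition qcontent (q : qform) : Z :=
  foldr (fun b g => Z.gcd b.1 (foldr Z.gcd g b.2)) 0 q.

(* The primitive form proportional to [a q - (r . y)^2], which is left of the form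
   [a x^2 + 2 x (r . y) + q(y)] once x has been eliminated. *)
Definition qelim (d a : Z) (r : seq Z) (q : qform) : qform :=
  [seq (b.1 / d, [seq x / d | x <- b.2]) |
    b <- qadd (qscale a q) (qscale (-1) (qsquare r))].

Lemma size_qadd q1 q2 : size (qadd q1 q2) = maxn (size q1) (size q2).
Proof. by elim: q1 q2 => [|[? ?] q1 IH] [|[? ?] q2] //=; rewrite IH maxnSS. Qed.

(** The hypothesis, which [enum_le] tests, bounds the size of [r] by that of [q0]; the square of a
    longer [r] would lengthen the eliminated form. *)
Lemma size_qelim d a r q0 :
  qscale a q0 = qadd (qsquare r) (qscale d (qelim d a r q0)) ->
  size (qelim d a r q0) = size q0.
Proof.
move/(congr1 size); rewrite /qelim /qscale !(size_map, size_qadd); lia.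
Qed.

Definition zrange (lo hi : Z) : seq Z :=
  [seq lo + Z.of_nat k | k <- iota 0 (Z.to_nat (hi - lo + 1))].

Lemma mem_zrange lo hi x : lo <= x <= hi -> x \in zrange lo hi.
Proof.
move=> xlh; apply/mapP; exists (Z.to_nat (x - lo)); last by lia.
by rewrite mem_iota; lia.
Qed.

(* Fincke-Pohst enumeration of the v with q(v) <= B, paired with q(v); it is based on the
   identity a q(x :: y) = (a x + r . y)^2 + d q'(y) for the eliminated form q'. *)
Fixpoint enum_le (fuel : nat) (q : qform) (B : Z) : option (seq (seq Z * Z)) :=
  match fuel, q with
  | fuel'.+1, (a, r) :: q0 =>
      let d := Z.max 1 (qcontent (qadd (qscale a q0) (qscale (-1) (qsquare r)))) in
      let q1 := qelim d a r q0 in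
      if (0 <? a) && (qscale a q0 == qadd (qsquare r) (qscale d q1)) then
        if enum_le fuel' q1 (a * B / d) is Some ys then
          Some (flatten
            [seq let c := dot r y.1 in
                 let e := d * y.2 in
                 let s := Z.sqrt (a * B - e) in
                 [seq (x :: y.1, ((a * x + c) * (a * x + c) + e) / a) |
                   x <- zrange ((- s - c) / a) ((s - c) / a)] | y <- ys])
        else None
      else None
  | _, [::] => Some [:: ([::], 0)]
  | _, _ => None
  end.

Lemma elimination (d a x c q0 q1 : Z) : a * q0 = c * c + d * q1 ->
  a * (a * x * x + 2 * x * c + q0) = (a * x + c) * (a * x + c) + d * q1.
Proof. nia. Qed.

Lemma elimination_pos (d a t q q1 : Z) : 0 < a -> 0 < d -> 0 <= q1 ->
  a * q = t * t + d * q1 -> 0 <= q /\ (q = 0 -> t = 0 /\ q1 = 0).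
Proof. by move=> *; split=> [|?]; [nia | split; nia]. Qed.

(** Success of the enumeration, whatever the bound B, means that all pivots were positive and all
    divisions by the content exact, so the form is positive definite. *)
Lemma enum_le_pos fuel q B l v : enum_le fuel q B = Some l ->
  size v = size q -> 0 <= qeval q v /\ (qeval q v = 0 -> all (pred1 0) v).
Proof.
elim: fuel q B l v => [|n IH] [|[a r] q0] B l [|x y] //=.
set d := Z.max _ _; have d0 : 0 < d by rewrite /d; lia.
move: d d0 => d d0.
case: ifP => // /andP[/Z.ltb_lt a0 /eqP E] + [szy].
case E1 : (enum_le _ _ _) => [ys|//] _.
have szb : size y = size (qelim d a r q0) by rewrite szy (size_qelim E).
have [p0 p1] := IH _ _ _ _ E1 szb.
move: (congr1 (qeval ^~ y) E); rewrite /= qeval_add !qeval_scale qeval_square => Ey.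
have [Q0 Q1] := elimination_pos a0 d0 p0 (@elimination d a x _ _ _ Ey).
split=> // /Q1[tx /p1 ay]; rewrite ay andbT.
have d0y : dot r y = 0.
  by elim: (r) (y) ay => [|? ? IHr] [|? ?] //= /andP[/eqP-> /IHr ->]; lia.
move: tx; rewrite d0y => tx; apply/eqP.
by clear - tx a0; nia.
Qed.

(** Floor division is exact at the upper end; at the lower end it may admit one integer too many,
    which is harmless since the enumeration has only to be complete. *)
Lemma sqrt_range (a c x t : Z) : 0 < a -> (a * x + c) * (a * x + c) <= t ->
  (- Z.sqrt t - c) / a <= x <= (Z.sqrt t - c) / a.
Proof.
move=> a0 le; have t0 : 0 <= t by have := Z.square_nonneg (a * x + c); lia.
have [_] := Z.sqrt_spec t t0.
have := Z.sqrt_nonneg t; move: (Z.sqrt t) => s s0 s2.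
split; last by apply: Z.div_le_lower_bound; nia.
suff: (- s - c) / a < x + 1 by lia.
by apply: Z.div_lt_upper_bound; nia.
Qed.

Lemma enum_le_complete fuel q B l v : enum_le fuel q B = Some l ->
  size v = size q -> qeval q v <= B -> (v, qeval q v) \in l.
Proof.
elim: fuel q B l v => [|n IH] [|[a r] q0] B l [|x y] //=; try by move=> [<-].
set d := Z.max _ _; have d0 : 0 < d by rewrite /d; lia.
move: d d0 => d d0.
case: ifP => // /andP[/Z.ltb_lt a0 /eqP E] + [szy].
case E1 : (enum_le _ _ _) => [ys|//] [<-] le.
have szb : size y = size (qelim d a r q0) by rewrite szy (size_qelim E).
move: (congr1 (qeval ^~ y) E); rewrite /= qeval_add !qeval_scale qeval_square => Ey.
have EQ := @elimination d a x _ _ _ Ey.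
have le1 : (a * x + dot r y) * (a * x + dot r y) <= a * B - d * qeval (qelim d a r q0) y.
  by have := Zmult_le_compat_l _ _ a le (Z.lt_le_incl _ _ a0); lia.
apply/flatten_mapP; exists (y, qeval (qelim d a r q0) y).
  apply: IH E1 szb _; apply: Z.div_le_lower_bound => //.
  by have := Z.square_nonneg (a * x + dot r y); lia.
apply/mapP; exists x; first by apply: mem_zrange; apply: sqrt_range le1.
by congr pair; rewrite /= -EQ (Z.mul_comm a (_ + _)) Z.div_mul //; lia.
Qed.

(** * Lattices given by lists *)

Definition combL (a : seq Z) (M : seq (seq Z)) : seq Z :=
  foldr (fun cb v => vadd (vscale cb.1 cb.2) v) [::] (zip a M).
Definition mulL (A B : seq (seq Z)) : seq (seq Z) := [seq combL a B | a <- A].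
Definition trL (n : nat) (A : seq (seq Z)) : seq (seq Z) :=
  [seq [seq nth Z0 r j | r <- A] | j <- iota 0 n].
Definition scalL (n : nat) (c : Z) : seq (seq Z) :=
  [seq [seq (if i == j then c else Z0) | j <- iota 0 n] | i <- iota 0 n].
Definition bilL (G : seq (seq Z)) (a b : seq Z) : Z := dot a [seq dot r b | r <- G].

Section ListMatrices.
Local Open Scope ring_scope.
Variable n : nat.

Definition rv (l : seq Z) : 'rV[int]_n := \row_i int_of_Z (nth Z0 l i).
Definition ls (v : 'rV[int]_n) : seq Z := [seq Z_of_int (v 0 i) | i <- enum 'I_n].
Definition mx (M : seq (seq Z)) : 'M[int]_n :=
  \matrix_(i, j) int_of_Z (nth Z0 (nth [::] M i) j).

Lemma nth_ls v (i : 'I_n) : nth Z0 (ls v) i = Z_of_int (v 0 i).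
Proof. by rewrite (nth_map i) ?size_enum_ord // nth_ord_enum. Qed.

Lemma size_ls v : size (ls v) = n.
Proof. by rewrite size_map size_enum_ord. Qed.

Lemma lsK v : rv (ls v) = v.
Proof. by apply/rowP => i; rewrite mxE nth_ls Z_of_intK. Qed.

Lemma rvK l : size l = n -> ls (rv l) = l.
Proof.
move=> sl; apply: (@eq_from_nth _ Z0); first by rewrite size_ls.
by move=> i; rewrite size_ls => ltin; rewrite (nth_ls _ (Ordinal ltin)) mxE int_of_ZK.
Qed.

Lemma nth_vadd a b i : nth Z0 (vadd a b) i = (nth Z0 a i + nth Z0 b i)%BZ.
Proof.
by elim: a b i => [|x a IH] [|y b] [|i] //=; rewrite ?nth_nil ?IH //; lia.
Qed.

Lemma nth_vscale c a i : nth Z0 (vscale c a) i = (c * nth Z0 a i)%BZ.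
Proof.
have [lt|ge] := ltnP i (size a); first by rewrite (nth_map Z0).
by rewrite !nth_default ?size_map //; lia.
Qed.

Lemma dotE m a b : (size b <= m)%N -> dot a b = \sum_(i < m) nth Z0 a i * nth Z0 b i.
Proof.
elim: m a b => [|m IH] [|x a] [|y b] //= sb; rewrite ?big_ord0 //.
- by rewrite big1 // => i _; rewrite nth_nil mul0r.
- by rewrite big1 // => i _; rewrite nth_nil mul0r.
- by rewrite big1 // => i _; rewrite nth_nil mulr0.
by rewrite big_ord_recl /= -IH.
Qed.

Lemma dotC a b : dot a b = dot b a.
Proof. by elim: a b => [|x a IH] [|y b] //=; rewrite IH; lia. Qed.

Lemma rvD a b : rv (vadd a b) = rv a + rv b.
Proof. by apply/rowP => i; rewrite !mxE nth_vadd -rmorphD. Qed.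

Lemma rvZ c a : rv (vscale c a) = int_of_Z c *: rv a.
Proof. by apply/rowP => i; rewrite !mxE nth_vscale -rmorphM. Qed.

Lemma rv0 : rv [::] = 0.
Proof. by apply/rowP => i; rewrite !mxE nth_nil. Qed.

Lemma row_mx_list M (i : 'I_n) : row i (mx M) = rv (nth [::] M i).
Proof. by apply/rowP => j; rewrite !mxE. Qed.

Lemma rv_combL a M : size M = n -> rv (combL a M) = rv a *m mx M.
Proof.
move=> sM; rewrite mulmx_sum_row.
under eq_bigr do rewrite row_mx_list mxE.
suff E m : size M = m ->
    rv (combL a M) = \sum_(i < m) int_of_Z (nth Z0 a i) *: rv (nth [::] M i) by exact: E.
elim: M a m {sM} => [|b M IH] [|x a] [|m] //= sM; rewrite /combL /= ?rv0 ?big_ord0 //.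
  by rewrite big1 // => i _; rewrite nth_nil scale0r.
by rewrite rvD rvZ big_ord_recl /= -IH //; case: sM.
Qed.

Lemma mx_mulL A B : size A = n -> size B = n -> mx (mulL A B) = mx A *m mx B.
Proof.
move=> sA sB; apply/row_matrixP => i; rewrite row_mul !row_mx_list -rv_combL //.
by rewrite (nth_map [::]) ?sA.
Qed.

Lemma mx_scalL c : mx (scalL n c) = (int_of_Z c)%:M.
Proof.
apply/matrixP => i j; rewrite !mxE (nth_map 0%N) ?size_iota // (nth_map 0%N) ?size_iota //.
by rewrite !nth_iota // !add0n -val_eqE /=; case: eqP.
Qed.

Lemma mx_trL A : size A = n -> mx (trL n A) = (mx A)^T.
Proof.
move=> sA; apply/matrixP => i j; rewrite !mxE (nth_map 0%N) ?size_iota //.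
by rewrite (nth_map [::]) ?sA // nth_iota.
Qed.

End ListMatrices.

Record represents (L : lat) (GL : seq (seq Z)) : Prop := Repr {
  repr_size : size GL = ldim L;
  repr_rows : all (fun r : seq Z => size r == ldim L) GL;
  repr_gram : gram L = mx (ldim L) GL }.

Section Form.
Local Open Scope ring_scope.
Variable L : lat.
Local Notation V := 'rV[int]_(ldim L).

(** Values are taken in [Z] so that they compare directly with the values [bilL] computed on
    lists. *)
Definition Bz (v w : V) : Z := Z_of_int (bilZ v w).

Lemma BzDl u v w : Bz (u + v) w = (Bz u w + Bz v w)%BZ.
Proof. by rewrite /Bz /bilZ !mulmxDl mxE rmorphD. Qed.

Lemma BzDr u v w : Bz u (v + w) = (Bz u v + Bz u w)%BZ.
Proof. by rewrite /Bz /bilZ linearD mulmxDr mxE rmorphD. Qed.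

Lemma BzZl (c : int) v w : Bz (c *: v) w = (Z_of_int c * Bz v w)%BZ.
Proof. by rewrite /Bz /bilZ -!scalemxAl mxE rmorphM. Qed.

Lemma BzZr (c : int) v w : Bz v (c *: w) = (Z_of_int c * Bz v w)%BZ.
Proof. by rewrite /Bz /bilZ linearZ -scalemxAr mxE rmorphM. Qed.

Lemma BzNl v w : Bz (- v) w = (- Bz v w)%BZ.
Proof. by rewrite /Bz /bilZ !mulNmx mxE rmorphN. Qed.

Lemma BzNr v w : Bz v (- w) = (- Bz v w)%BZ.
Proof. by rewrite /Bz /bilZ linearN mulmxN mxE rmorphN. Qed.

Lemma Bz0l w : Bz 0 w = Z0.
Proof. by rewrite /Bz /bilZ !mul0mx mxE. Qed.

Lemma Bz0r w : Bz w 0 = Z0.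
Proof. by rewrite /Bz /bilZ linear0 mulmx0 mxE. Qed.

Definition BzE := (BzDl, BzDr, BzNl, BzNr, BzZl, BzZr, Bz0l, Bz0r).

Lemma BzC : (gram L)^T = gram L -> forall v w, Bz v w = Bz w v.
Proof.
move=> sG v w; rewrite /Bz /bilZ.
have -> : v *m gram L *m w^T = (w *m gram L *m v^T)^T by rewrite !trmx_mul trmxK sG mulmxA.
by rewrite mxE.
Qed.

Lemma Bz_aut g v w : isAut (L := L) g -> Bz (v *m g) (w *m g) = Bz v w.
Proof. by move=> gG; rewrite /Bz /bilZ trmx_mul !mulmxA -(mulmxA v g) -(mulmxA v) gG. Qed.

Variable GL : seq (seq Z).
Hypothesis GLP : represents L GL.

Lemma Bz_list a b : Bz (rv _ a) (rv _ b) = bilL GL a b.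
Proof.
rewrite /bilL (@dotE (ldim L)) ?size_map ?(repr_size GLP) // /Bz /bilZ.
rewrite -mulmxA mxE rmorph_sum; apply: eq_bigr => i _ /=.
rewrite rmorphM mxE /= int_of_ZK; congr (_ * _).
rewrite (nth_map [::]) ?(repr_size GLP) //.
have szr : (size (nth [::] GL i) <= ldim L)%N.
  have /(all_nthP [::])/(_ i) := repr_rows GLP.
  by rewrite (repr_size GLP) ltn_ord => /(_ isT)/eqP->.
rewrite dotC (dotE _ szr) mxE rmorph_sum; apply: eq_bigr => j _ /=.
by rewrite rmorphM /= (repr_gram GLP) !mxE !int_of_ZK mulrC.
Qed.

End Form.

Fixpoint gramq (f : seq Z -> seq Z -> Z) (bs : seq (seq Z)) : qform :=
  if bs is b :: bs' then (f b b, [seq f b b' | b' <- bs']) :: gramq f bs' else [::].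

Lemma size_gramq f bs : size (gramq f bs) = size bs.
Proof. by elim: bs => //= ? ? ->. Qed.

(** With N = -(p, p) this is N times the lattice form on the orthogonal complement of p, and its
    value at p is (lam - 1) N^2. For a hyperbolic form it is therefore positive definite exactly
    when lam > 1. *)
Definition pdform (G : seq (seq Z)) (N lam : Z) (p : seq Z) (a b : seq Z) : Z :=
  N * bilL G a b + lam * (bilL G p a * bilL G p b).

Section Enumeration.
Local Open Scope ring_scope.
Variables (L : lat) (GL : seq (seq Z)).
Hypotheses (GLP : represents L GL) (symG : (gram L)^T = gram L).
Local Notation V := 'rV[int]_(ldim L).
Local Notation rv := (rv (ldim L)).

Definition Fz N lam (p u v : V) : Z := (N * Bz u v + lam * (Bz p u * Bz p v))%BZ.

Lemma qeval_gramq N lam p bs cs : size cs = size bs ->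
  qeval (gramq (pdform GL N lam p) bs) cs =
  Fz N lam (rv p) (rv (combL cs bs)) (rv (combL cs bs)).
Proof.
elim: bs cs => [|b bs IH] [|c cs] //= scs; first by rewrite /combL /= rv0 /Fz !BzE; lia.
case: scs => scs; rewrite IH // {IH} [combL (_ :: _) _]/(vadd (vscale c b) (combL cs bs)) rvD rvZ.
have -> : dot [seq pdform GL N lam p b b' | b' <- bs] cs =
          Fz N lam (rv p) (rv b) (rv (combL cs bs)).
  elim: bs cs scs => [|b' bs IH] [|c' cs] //= scs; first by rewrite /combL /= rv0 /Fz !BzE; lia.
  case: scs => scs; rewrite IH // [combL (_ :: _) _]/(vadd (vscale c' b') (combL cs bs)) rvD rvZ.
  by rewrite /Fz /pdform !BzE !int_of_ZK !(Bz_list GLP); lia.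
rewrite /Fz /pdform -!(Bz_list GLP) !BzE !int_of_ZK (BzC symG (rv (combL _ _)) (rv b)).
by lia.
Qed.

Lemma enum_sound N lam p bs B l (c : V) : size bs = ldim L ->
  enum_le (ldim L) (gramq (pdform GL N lam p) bs) B = Some l ->
  (Fz N lam (rv p) (c *m mx _ bs) (c *m mx _ bs) <= B)%BZ -> ls c \in [seq y.1 | y <- l].
Proof.
move=> sb El; rewrite -{1 2}[c]lsK -rv_combL // -qeval_gramq ?size_ls // => le.
have := enum_le_complete El _ le; rewrite size_gramq size_ls sb => /(_ erefl).
exact: (map_f fst).
Qed.

Lemma enum_pos N lam p bs B l (c : V) : size bs = ldim L ->
  enum_le (ldim L) (gramq (pdform GL N lam p) bs) B = Some l ->
  let u := c *m mx _ bs in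
  (0 <= Fz N lam (rv p) u u)%BZ /\ (Fz N lam (rv p) u u = Z0 -> u = 0).
Proof.
move=> sb El u; have := enum_le_pos (v := ls c) El.
rewrite size_gramq sb size_ls qeval_gramq ?size_ls ?sb // rv_combL // lsK -/u.
case=> // u0 u1; split=> // /u1 /(all_nthP Z0) c0; suff -> : u = 0 by [].
rewrite /u; suff -> : c = 0 by rewrite mul0mx.
apply/rowP => i; apply: (can_inj Z_of_intK); rewrite -nth_ls mxE.
by apply/eqP/c0; rewrite size_ls.
Qed.
End Enumeration.

(** * Roots and reflections *)

Section Roots.
Local Open Scope ring_scope.
Variable L : lat.
Hypothesis symG : (gram L)^T = gram L.
Local Notation V := 'rV[int]_(ldim L).
Local Notation B := (@Bz L).

Definition zroot (v : V) : Prop :=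
  B v v = 2%BZ \/ (B v v = 6%BZ /\ forall w, Z.divide 3 (B v w)).

Lemma dvdz_Z (a : Z) : (3 %| int_of_Z a)%Z <-> Z.divide 3 a.
Proof.
split=> [/dvdzP[q E]|[q ->]].
  by exists (Z_of_int q); rewrite -(int_of_ZK a) E rmorphM.
by rewrite rmorphM dvdz_mull.
Qed.

Lemma isrootP v : isroot v <-> zroot v.
Proof.
rewrite /isroot /root2 /root6 /zroot /Bz; split.
  case=> [->|[-> d3]]; first by left.
  by right; split=> // w; apply/dvdz_Z; rewrite Z_of_intK.
case=> [E|[E d3]]; [left|right; split=> [|w]]; try by apply: (can_inj Z_of_intK); rewrite E.
by rewrite -[bilZ v w]Z_of_intK; apply/dvdz_Z.
Qed.

Definition rcoef (r u : V) : Z := ((2 * B u r) / B r r)%BZ.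
Definition refl (r u : V) : V := u - int_of_Z (rcoef r u) *: r.

(** The division in [rcoef] is exact: by 2 for a 2-root, and by 6 for a 6-root because its products
    with the lattice are divisible by 3. *)
Lemma rcoefE r u : zroot r -> (rcoef r u * B r r = 2 * B u r)%BZ.
Proof.
rewrite /rcoef => -[->|[-> d3]]; first by rewrite (Z.mul_comm 2 (B u r)) Z.div_mul; lia.
have [k E] := d3 u; rewrite (BzC symG u r) E (_ : (2 * (k * 3) = k * 6)%BZ); last by lia.
by rewrite Z.div_mul.
Qed.

Lemma B_refll r u w : B (refl r u) w = (B u w - rcoef r u * B r w)%BZ.
Proof. by rewrite /refl !BzE int_of_ZK; lia. Qed.

Lemma B_reflr r u w : B w (refl r u) = (B w u - rcoef r u * B w r)%BZ.
Proof. by rewrite /refl !BzE int_of_ZK; lia. Qed.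

Lemma B_refl r u w : zroot r -> B (refl r u) (refl r w) = B u w.
Proof.
move=> rr; rewrite B_refll !B_reflr (BzC symG r w).
have := rcoefE u rr; have := rcoefE w rr.
move: (rcoef r u) (rcoef r w) => k l El Ek.
have -> : (k * (B w r - l * B r r) = k * B w r - k * (l * B r r))%BZ by lia.
by rewrite El; lia.
Qed.

(** Surjectivity transports the divisibility condition on 6-roots, which quantifies over the whole
    lattice. *)
Lemma zroot_aut (f : V -> V) v :
  (forall u w, B (f u) (f w) = B u w) -> (forall w, exists w', f w' = w) ->
  zroot v -> zroot (f v).
Proof.
move=> fB fs [E|[E d3]]; [left|right; split=> [|w]]; rewrite ?fB //.
by have [w' <-] := fs w; rewrite fB.
Qed.

Lemma reflK r u : zroot r -> refl r (refl r u) = u.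
Proof.
move=> rr; rewrite {1}/refl -addrA -opprD -scalerDl -rmorphD.
suff -> : rcoef r u + rcoef r (refl r u) = 0 by rewrite scale0r subr0.
have r0 : B r r <> Z0 by case: rr => [->|[-> _]].
have := rcoefE u rr; have := rcoefE (refl r u) rr; rewrite B_refll.
move: (rcoef r u) (rcoef r _) r0 => k l r0 E1 E2.
suff: (k + l)%BZ = Z0 by [].
by apply: (Z.mul_reg_r _ _ (B r r)) => //; lia.
Qed.

Lemma zroot_refl r v : zroot r -> zroot v -> zroot (refl r v).
Proof.
move=> rr; apply: zroot_aut => [u w|w]; first exact: B_refl.
by exists (refl r w); apply: reflK.
Qed.

Lemma zrootN v : zroot v -> zroot (- v).
Proof.
apply: (zroot_aut (f := fun u => - u)) => [u w|w]; first by rewrite !BzE; lia.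
by exists (- w); rewrite opprK.
Qed.

Lemma zroot_neq0 v : zroot v -> B v v <> Z0.
Proof. by case=> [->|[-> _]]. Qed.

Lemma refl_self r : zroot r -> refl r r = - r.
Proof.
move=> rr; have E : rcoef r r = 2%BZ.
  by apply: (Z.mul_reg_r _ _ (B r r)); [exact: zroot_neq0 | rewrite rcoefE].
by rewrite /refl E (_ : int_of_Z 2 = 2) // scaler_nat mulr2n opprD addrA subrr sub0r.
Qed.

Lemma reflN r u : zroot r -> refl r (- u) = - refl r u.
Proof.
move=> rr; have E : rcoef r (- u) = (- rcoef r u)%BZ.
  apply: (Z.mul_reg_r _ _ (B r r)); first exact: zroot_neq0.
  by rewrite Z.mul_opp_l !rcoefE // BzE; lia.
by rewrite /refl E rmorphN scaleNr opprK opprB addrC.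
Qed.

(** Linearity is not visible in the definition, where the coefficient is a floor quotient; it comes
    from the exactness [rcoefE]. *)
Lemma refl_aut r : zroot r -> exists S : 'M_(ldim L), forall u, u *m S = refl r u.
Proof.
move=> rr.
exists (\matrix_i refl r (delta_mx 0 i)) => u.
rewrite mulmx_sum_row [in RHS](row_sum_delta u).
have reflD : forall a b, refl r (a + b) = refl r a + refl r b.
  move=> a b; suff E : rcoef r (a + b) = (rcoef r a + rcoef r b)%BZ.
    by rewrite /refl E rmorphD scalerDl opprD addrACA.
  have r0 : B r r <> Z0 by case: rr => [->|[-> _]].
  have := rcoefE (a + b) rr; have := rcoefE a rr; have := rcoefE b rr; rewrite BzE => E1 E2 E3.
  by apply: (Z.mul_reg_r _ _ (B r r)) => //; lia.
have reflZ : forall c a, refl r (c *: a) = c *: refl r a.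
  move=> c a; suff E : rcoef r (c *: a) = (Z_of_int c * rcoef r a)%BZ.
    by rewrite /refl E rmorphM /= Z_of_intK scalerBr scalerA.
  have r0 : B r r <> Z0 by case: rr => [->|[-> _]].
  by apply: (Z.mul_reg_r _ _ (B r r)) => //; rewrite -Z.mul_assoc !(rcoefE _ rr) BzE; lia.
have refl0 : refl r 0 = 0 by have := reflZ 0 0; rewrite !scale0r.
rewrite (big_morph _ reflD refl0); apply: eq_bigr => i _.
by rewrite reflZ rowK.
Qed.

End Roots.

(** * Simple roots *)

Section Hyperbolic.
Local Open Scope ring_scope.
Variables (L : lat) (p : 'rV[int]_(ldim L)) (lam : Z).
Hypothesis symG : (gram L)^T = gram L.
Local Notation V := 'rV[int]_(ldim L).
Local Notation B := (@Bz L).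
Let N := (- B p p)%BZ.
Hypothesis N0 : (0 < N)%BZ.
Hypothesis posF : forall w, (0 <= Fz N lam p w w)%BZ /\ (Fz N lam p w w = Z0 -> w = 0).

(** Reversed Cauchy-Schwarz inequality with respect to p. The vector N w + (p, w) p is orthogonal to
    p, so there the positive form reduces to N times the lattice form, and the norm of this vector
    is N times the right-hand side. *)
Lemma hyper w : (0 <= N * B w w + B p w * B p w)%BZ.
Proof.
have [+ _] := posF (int_of_Z N *: w + int_of_Z (B p w) *: p).
rewrite /Fz !BzE !int_of_ZK (BzC symG w p) -/N.
have -> : B p p = (- N)%BZ by rewrite /N; lia.
move: N N0 (B w w) (B p w) => M M0 x y H; nia.
Qed.

(** If (x, p) were nonnegative, the combination -(y, p) x + (x, p) y would be orthogonal to p with a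
    positive and a nonnegative coefficient. Its norm would be negative, against [hyper]. *)
Lemma cone_trans x y : (B x x < 0)%BZ -> (B y y < 0)%BZ -> (B x y < 0)%BZ -> (B y p < 0)%BZ ->
  (B x p < 0)%BZ.
Proof.
move=> x0 y0 xy yp; apply: Znot_ge_lt => xp.
have := hyper (w := int_of_Z (- B y p) *: x + int_of_Z (B x p) *: y).
rewrite !BzE !int_of_ZK (BzC symG y x) (BzC symG p x) (BzC symG p y).
move: N N0 (B x x) (B y y) (B x y) (B x p) (B y p) x0 y0 xy yp xp.
by move=> M M0 xx yy xy xp yp *; nia.
Qed.

Lemma cone_neq0 x : (B x x < 0)%BZ -> B x p <> Z0.
Proof. by move=> x0 xp; have := hyper (w := x); rewrite (BzC symG p x) xp; nia. Qed.

(** Up to sign, the right-hand side is the Gram determinant of p, r and d = 2 u - c r, where d is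
    orthogonal to r. The proof applies [hyper] to M times the vector of the line d + Q r at which N
    (w, w) + (p, w)^2 is smallest. *)
Lemma gram_det u r (c : Z) : (0 < B r r)%BZ -> (c * B r r = 2 * B u r)%BZ ->
  let e := (2 * B p u - c * B p r)%BZ in
  (0 <= (4 * B u u - c * c * B r r) * (N * B r r + B p r * B p r) + e * e * B r r)%BZ.
Proof.
move=> r0 cE e; set M := (N * B r r + B p r * B p r)%BZ.
pose d := (2 : int) *: u - int_of_Z c *: r.
have E2 : Z_of_int 2 = 2%BZ by [].
have dr : B d r = Z0 by rewrite /d !BzE int_of_ZK E2; lia.
have pd : B p d = e by rewrite /d !BzE int_of_ZK E2 /e; lia.
have dd : B d d = (4 * B u u - c * c * B r r)%BZ.
  rewrite /d !BzE int_of_ZK E2 (BzC symG r u).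
  have E3 : (c * (c * B r r) = c * (2 * B u r))%BZ by rewrite cE.
  by lia.
move: d dr pd dd => d dr pd dd.
have := hyper (w := int_of_Z M *: d - int_of_Z (e * B p r) *: r).
rewrite !BzE !int_of_ZK (BzC symG r d) dr pd -dd => H.
apply: (Zmult_le_0_reg_r (N * M)); first by rewrite /M; nia.
move: H; rewrite /M; move: (B d d) (B r r) (B p r) (N) => x y z n H; lia.
Qed.

End Hyperbolic.

(** Here u and r have the same norm q, h and a are the heights of r and u, M stands for N, and a' =
    c h - a is the height of w in [reflect_positive]. The determinant inequality reads 4 (h^2 - a
    a') >= M q (c^2 - 4). For c = 1 the sum a + a' = h is too small, for c = 2 the thresholds force
    a = a' = h, and for c >= 3 they give a a' >= h^2, a contradiction. *)
Lemma equal_norm (q c M a h T : Z) : 0 < q -> 0 < M -> 0 < c -> 0 < h -> h <= T ->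
  T <= a -> T <= c * h - a -> (q = q -> c = 2 -> a = h -> False) ->
  0 <= (4 * q - c * c * q) * (M * q + h * h) + (2 * a - c * h) * (2 * a - c * h) * q -> False.
Proof.
move=> q0 M0 c0 h0 hT aT aT' degen.
have -> : (4 * q - c * c * q) * (M * q + h * h) + (2 * a - c * h) * (2 * a - c * h) * q =
  q * (4 * (h * h - a * (c * h - a)) - M * q * (c * c - 4)) by ring.
have [|[c2|c3]] : c = 1 \/ c = 2 \/ 3 <= c by lia.
- by move=> E; subst c; lia.
- subst c; move: (degen erefl erefl) => ah H.
  have : 0 <= h * h - a * (2 * h - a) by nia.
  by move=> H1; apply: ah; nia.
- move=> H; have H1 : 0 <= 4 * (h * h - a * (c * h - a)) - M * q * (c * c - 4) by nia.
  have H2 : 0 < M * q * (c * c - 4) by apply: Z.mul_pos_pos; nia.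
  have H3 : h * h <= a * (c * h - a) by nia.
  by lia.
Qed.

(** Here u is a 6-root and r a 2-root. With a' = c h - a, the product (a - h)(a' - h) >= 0 gives a
    a' >= (c - 1) h^2 >= 5 h^2, while the determinant inequality allows less than 3 h^2. *)
Lemma long_short (c M a h T : Z) : 0 < M -> 6 <= c -> 0 < h -> h <= T ->
  T <= a -> T <= c * h - a ->
  0 <= (4 * 6 - c * c * 2) * (M * 2 + h * h) + (2 * a - c * h) * (2 * a - c * h) * 2 -> False.
Proof.
move=> M0 c6 h0 hT aT aT'.
have -> : (4 * 6 - c * c * 2) * (M * 2 + h * h) + (2 * a - c * h) * (2 * a - c * h) * 2 =
  24 * (h * h) - 8 * (a * (c * h - a)) - 4 * M * (c * c - 12) by ring.
have : 0 <= (a - h) * (c * h - a - h) by apply: Z.mul_nonneg_nonneg; lia.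
have : 0 <= (c - 6) * (h * h) by apply: Z.mul_nonneg_nonneg; nia.
have : 0 < M * (c * c - 12) by apply: Z.mul_pos_pos; nia.
have : 0 < h * h by nia.
by lia.
Qed.

(** Here u is a 2-root and r a 6-root. The bound h < 2 T excludes c = 1, where a + a' = h for a' = c
    h - a. For c >= 2 the product (2 a - h)(2 a' - h) >= 0 gives 4 a a' >= 3 h^2, too large for the
    determinant inequality. *)
Lemma short_long (c M a h T : Z) : 0 < M -> 0 < c -> 0 < h -> h < 2 * T ->
  T <= a -> T <= c * h - a ->
  0 <= (4 * 2 - c * c * 6) * (M * 6 + h * h) + (2 * a - c * h) * (2 * a - c * h) * 6 -> False.
Proof.
move=> M0 c0 h0 hT aT aT'.
have [c1|c2] : c = 1 \/ 2 <= c by lia.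
  by subst c; lia.
have -> : (4 * 2 - c * c * 6) * (M * 6 + h * h) + (2 * a - c * h) * (2 * a - c * h) * 6 =
  8 * (h * h) - 24 * (a * (c * h - a)) - 12 * M * (3 * (c * c) - 4) by ring.
have : 0 <= (2 * a - h) * (2 * (c * h - a) - h) by apply: Z.mul_nonneg_nonneg; lia.
have : 0 <= (c - 2) * (h * h) by apply: Z.mul_nonneg_nonneg; nia.
have : 0 < M * (3 * (c * c) - 4) by apply: Z.mul_pos_pos; nia.
have : 0 < h * h by nia.
by lia.
Qed.

Section Vinberg.
Local Open Scope ring_scope.
Variables (L : lat) (p : 'rV[int]_(ldim L)) (lam T2 T6 : Z).
Hypothesis symG : (gram L)^T = gram L.
Local Notation V := 'rV[int]_(ldim L).
Local Notation B := (@Bz L).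
Local Notation zroot := (@zroot L).
Local Notation refl := (@refl L).
Local Notation rcoef := (@rcoef L).
Let N := (- B p p)%BZ.
Hypothesis N0 : (0 < N)%BZ.
Hypothesis posF : forall w, (0 <= Fz N lam p w w)%BZ /\ (Fz N lam p w w = Z0 -> w = 0).
Variable R : seq V.

(** The conclusion of [reflect_positive] for a single u, to be verified by computation for roots
    below the thresholds. The condition on (p, u) matters at height 0: it says that p lies on no
    mirror. *)
Definition good (u : V) : Prop := B p u <> Z0 /\
  forall r, r \in R -> (0 < B u r)%BZ -> u = r \/ (0 < B p (refl r u))%BZ.

Hypotheses (Rroot : forall r, r \in R -> zroot r)
  (Rneg : forall r s, r \in R -> s \in R -> r <> s -> (B r s <= 0)%BZ)
  (Rpos : forall r, r \in R -> (0 < B p r)%BZ)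
  (Rvol : forall x, (forall r, r \in R -> (0 <= B x r)%BZ) -> (B x x <= 0)%BZ)
  (RT2 : forall r, r \in R -> B r r = 2%BZ -> (B p r <= T2)%BZ /\ (B p r <= T6)%BZ)
  (RT6 : forall r, r \in R -> B r r = 6%BZ -> (B p r < 2 * T2)%BZ /\ (B p r <= T6)%BZ)
  (low2 : forall u, B u u = 2%BZ -> (0 <= B p u < T2)%BZ -> good u)
  (low6 : forall u, zroot u -> B u u = 6%BZ -> (0 <= B p u < T6)%BZ -> good u).

(* If the reflection of u in r were not positive, then w = - refl r u and u would be roots of
   nonnegative heights with u + w = c r; gram_det bounds the product of these heights, which is
   too small unless one of u, w lies below the thresholds T2, T6, where [good] is known. *)
Lemma reflect_positive u r : zroot u -> (0 < B p u)%BZ -> r \in R -> (0 < B u r)%BZ ->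
  u = r \/ (0 < B p (refl r u))%BZ.
Proof.
move=> uu a0 rR ur; apply: NNPP => /not_or_and[neq /Z.nlt_ge a'0].
have rr := Rroot rR; have h0 := Rpos rR.
set c := rcoef r u in a'0 *; have cE := rcoefE symG u rr; rewrite -/c in cE.
have paE : B p (refl r u) = (B p u - c * B p r)%BZ by rewrite B_reflr.
pose w := - refl r u.
have wroot : zroot w by apply/zrootN/zroot_refl.
have ww : B w w = B u u by rewrite /w BzNl BzNr B_refl //; lia.
have wr : B w r = B u r by rewrite /w BzNl B_refll -/c; lia.
have pw : B p w = (c * B p r - B p u)%BZ by rewrite /w BzNr paE; lia.
have ngu : ~ good u by case=> _ /(_ r rR ur)[]; [exact: neq | lia].
have ngw : ~ good w.
  case=> _ /(_ r rR); rewrite wr => /(_ ur)[E|].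
    apply: neq; rewrite -(reflK symG u rr) -[refl r u]opprK -/w E reflN // refl_self //.
    by rewrite opprK.
  by rewrite /w reflN // reflK // BzNr; lia.
have u26 : B u u = 2%BZ \/ B u u = 6%BZ by case: (uu) => [|[]]; [left | right].
have [lu lw] : let T := (if B u u =? 2 then T2 else T6)%BZ in (T <= B p u)%BZ /\ (T <= B p w)%BZ.
  case: u26 => E; rewrite E /=; split; apply: Znot_gt_le => lt.
  - by apply: ngu; apply: low2 => //; lia.
  - by apply: ngw; apply: low2; rewrite ?ww // pw; lia.
  - by apply: ngu; apply: low6 => //; lia.
  - by apply: ngw; apply: low6; rewrite ?ww // pw; lia.
have r0 : (0 < B r r)%BZ by case: (rr) => [->|[-> _]].
have c0 : (0 < c)%BZ by nia.
have := gram_det symG N0 posF r0 cE; rewrite -/N.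
(* In this case u - r has norm 0 and height 0, so definiteness of the positive form gives u = r. *)
have degen : B u u = B r r -> c = 2%BZ -> B p u = B p r -> False.
  move=> E1 E2 E3; apply: neq; apply/eqP; rewrite -subr_eq0; apply/eqP.
  have [_] := posF (u - r); apply; rewrite /Fz !BzE (BzC symG r u) E3.
  have ur2 : B u r = B r r by rewrite E2 in cE; lia.
  by rewrite ur2 E1; lia.
case: (rr) => [rr2|[rr6 r3]]; case: (uu) => [uu2|[uu6 u3]].
- rewrite uu2 /= in lu lw; have [h1 h2] := RT2 rR rr2; rewrite pw in lw.
  rewrite rr2 uu2 in degen * => H.
  by apply: (equal_norm (T := T2) _ _ _ _ _ _ _ degen H) => //; lia.
- rewrite uu6 /= in lu lw; have [h1 h2] := RT2 rR rr2; rewrite pw in lw.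
  have cur : c = B u r by lia.
  have [k ck] := u3 r; rewrite -cur in ck.
  (* Since u is a 6-root, c = (u, r) is a multiple of 3. The determinant inequality cannot exclude c
     = 3, but then z = u - r is a 2-root with (z, r) = 1. If z lies below T2, then [good] makes the
     height of u - 2 r positive, against the bound on w; otherwise the heights force r - z to be a
     2-root orthogonal to p. *)
  have [E|c6] : c = 3%BZ \/ (6 <= c)%BZ by lia.
    move=> _; pose z := u - r.
    have zz : B z z = 2%BZ by rewrite /z !BzE (BzC symG r u); lia.
    have zr : B z r = 1%BZ by rewrite /z !BzE; lia.
    have pz : B p z = (B p u - B p r)%BZ by rewrite /z !BzE; lia.
    have rz : refl r z = u - r - r.
      by rewrite /refl (_ : rcoef r z = 1%BZ) ?scale1r // /rcoef zr rr2.
    have [lt|ge] : (B p z < T2)%BZ \/ (T2 <= B p z)%BZ by lia.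
      have lz : (0 <= B p z < T2)%BZ by lia.
      have [_ /(_ r rR)] := low2 zz lz.
      rewrite zr => /(_ erefl)[zE|].
        by rewrite zE rr2 in zr.
      by rewrite rz !BzE; rewrite E in lw; lia.
    have zz' : B (r - z) (r - z) = 2%BZ by rewrite /z !BzE (BzC symG r u); lia.
    have pz' : B p (r - z) = Z0 by rewrite /z !BzE; rewrite E in lw; lia.
    by have [] := low2 zz' ltac:(lia).
  by rewrite rr2 uu6; apply: (long_short (T := T6)); lia.
- rewrite uu2 /= in lu lw; have [h1 h2] := RT6 rR rr6; rewrite pw in lw.
  by rewrite rr6 uu2; apply: (short_long (T := T2)); lia.
- rewrite uu6 /= in lu lw; have [h1 h2] := RT6 rR rr6; rewrite pw in lw.
  rewrite rr6 uu6 in degen * => H.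
  by apply: (equal_norm (T := T6) _ _ _ _ _ _ _ degen H) => //; lia.
Qed.

(** The number of summands is recorded because [simple_image] compares the lengths of
    decompositions. *)
Inductive rsum : nat -> V -> Prop :=
| rsum0 : rsum 0 0
| rsumS k v r : r \in R -> rsum k v -> rsum k.+1 (r + v).

Lemma rsumD k l u v : rsum k u -> rsum l v -> rsum (k + l) (u + v).
Proof.
move=> ku lv; elim: ku => [|k' w r rR _ IH]; first by rewrite add0r.
by rewrite -addrA; apply: rsumS.
Qed.

Lemma rsumM k r : r \in R -> rsum k (r *+ k).
Proof. by move=> rR; elim: k => [|k IH]; rewrite ?mulrS; constructor. Qed.

Lemma rsum1 v : rsum 1 v -> v \in R.
Proof.
move=> H; inversion H as [|k' v' r rR H' E1 E2]; subst.
by inversion H'; rewrite addr0.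
Qed.

Lemma rsum_height k v : rsum k v -> (Z.of_nat k <= B p v)%BZ.
Proof. by elim=> [|l w r /Rpos h0 _ IH]; rewrite ?BzE //; lia. Qed.

(** Some r in R has (u, r) > 0: otherwise -u would lie in the chamber, where the form is
    nonpositive, although u has positive norm. The reflection in r subtracts a positive multiple of
    r and, unless u = r, leaves a positive root of smaller height. *)
Lemma positive_rsum u : zroot u -> (0 < B p u)%BZ -> exists k, rsum k u.
Proof.
move=> uu u0; have [m] : exists m : nat, (B p u <= Z.of_nat m)%BZ.
  by exists (Z.to_nat (B p u)); lia.
elim: m u uu u0 => [|m IH] u uu u0 um; first by lia.
have [r rR ur] : exists2 r, r \in R & (0 < B u r)%BZ.
  apply: NNPP => H; suff: (B (- u) (- u) <= 0)%BZ.
    by rewrite !BzE; case: uu => [->|[-> _]].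
  apply: Rvol => r rR; rewrite BzE; suff: ~ (0 < B u r)%BZ by lia.
  by move=> ur; apply: H; exists r.
have rr := Rroot rR; have h0 := Rpos rR.
have [->|r0] := reflect_positive uu u0 rR ur; first by exists 1%N; apply: (rsumM 1).
have c0 : (0 < rcoef r u)%BZ.
  by have := rcoefE symG u rr; case: (rr) => [->|[-> _]]; lia.
have um' : (B p (refl r u) <= Z.of_nat m)%BZ by rewrite B_reflr; nia.
have [k ks] := IH _ (zroot_refl symG rr uu) r0 um'.
exists (Z.to_nat (rcoef r u) + k)%N.
have uE : u = r *+ Z.to_nat (rcoef r u) + refl r u.
  have E : int_of_Z (rcoef r u) = (Z.to_nat (rcoef r u))%:R by rewrite natz; lia.
  by rewrite /refl E scaler_nat addrC subrK.
by rewrite [X in rsum _ X]uE; apply: rsumD ks; apply: rsumM.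
Qed.

(** Distinct elements of R have nonpositive products, so (v, r) > 0 forces r to occur among the
    summands. *)
Lemma rsum_split k v r : r \in R -> rsum k v ->
  (B v r <= 0)%BZ \/ exists2 l, k = l.+1 & rsum l (v - r).
Proof.
move=> rR; elim=> [|l w s sR lw [IH|[m -> mw]]]; first by left; rewrite BzE.
  have [->|/eqP sr] := eqVneq s r; last by left; rewrite BzE; have := Rneg sR rR sr; lia.
  by right; exists l; rewrite // addrC addKr.
by right; exists m.+1; rewrite // -addrA; apply: rsumS.
Qed.

(** Since (r, r) > 0, the root r is itself one of the summands; the others add up to 0, and there
    are none because heights in R are positive. *)
Lemma rsum_simple k r : r \in R -> rsum k r -> k = 1%N.
Proof.
move=> rR /(rsum_split rR)[|[l -> /rsum_height]].
  by case: (Rroot rR) => [->|[-> _]].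
by rewrite subrr BzE; lia.
Qed.

(** If r g is a sum of k simple roots, applying g' writes r as a sum of at least k simple roots,
    because each image is a positive root. Simple roots are indecomposable, so k = 1. *)
Lemma simple_image (g g' : 'M[int]_(ldim L)) : g *m g' = 1%:M ->
  (forall u, zroot u -> (0 < B p u)%BZ -> zroot (u *m g) /\ (0 < B p (u *m g))%BZ) ->
  (forall u, zroot u -> (0 < B p u)%BZ -> zroot (u *m g') /\ (0 < B p (u *m g'))%BZ) ->
  forall r, r \in R -> r *m g \in R.
Proof.
move=> gg' gP g'P r rR.
have [rg rg0] := gP _ (Rroot rR) (Rpos rR); have [k ks] := positive_rsum rg rg0.
have img l v : rsum l v -> exists2 m, (l <= m)%N & rsum m (v *m g').
  elim=> [|l' w s sR _ [m lm IH]]; first by exists 0%N => //; rewrite mul0mx; constructor.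
  have [sg sg0] := g'P _ (Rroot sR) (Rpos sR); have [j js] := positive_rsum sg sg0.
  exists (j + m)%N; last by rewrite mulmxDl; apply: rsumD.
  case: j js sg0 => [js|j _ _]; last by lia.
  by inversion js; rewrite BzE.
have [m km] := img _ _ ks; rewrite -mulmxA gg' mulmx1 => /(rsum_simple rR) m1.
case: k ks km => [ks _|[|k] ks km]; [|exact: rsum1 | by lia].
by move: rg0; inversion ks; rewrite BzE.
Qed.

(* Reflecting in the mirrors that separate x from p brings x closer to p. *)
Lemma descent x : (B x x < 0)%BZ -> (B x p < 0)%BZ -> (forall v, zroot v -> B x v <> Z0) ->
  exists h h' : 'M[int]_(ldim L), [/\ h *m h' = 1%:M, h' *m h = 1%:M,
    forall u w, B (u *m h) (w *m h) = B u w &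
    forall v, zroot v -> (0 < B p v)%BZ -> (0 < B (x *m h) v)%BZ].
Proof.
have [m] : exists m : nat, (- B x p <= Z.of_nat m)%BZ by exists (Z.to_nat (- B x p)); lia.
elim: m x => [|m IH] x xm x0 xp xgen; first by lia.
have [H|H] := classic (forall v, zroot v -> (0 < B p v)%BZ -> (0 < B x v)%BZ).
  by exists 1%:M, 1%:M; split=> [||u w|v]; rewrite ?mulmx1 //; apply: H.
have [v vv [pv xv]] : exists2 v, zroot v & (0 < B p v)%BZ /\ (B x v < 0)%BZ.
  apply: NNPP => H'; apply: H => v vv pv; apply: NNPP => xv; apply: H'.
  by exists v => //; have := xgen v vv; lia.
have c0 : (rcoef v x < 0)%BZ.
  by have := rcoefE symG x vv; case: (vv) => [->|[-> _]]; lia.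
have y0 : (B (refl v x) (refl v x) < 0)%BZ by rewrite B_refl.
(* The coefficient and (v, x) are both negative, so reflecting keeps the product with x negative,
   and by [cone_trans] the image stays in the half cone of p. Its integer distance -(x, p) drops
   strictly, which ends the descent. *)
have yx : (B (refl v x) x < 0)%BZ by rewrite B_refll (BzC symG v x); nia.
have yp := cone_trans symG N0 posF y0 x0 yx xp.
have ym : (- B (refl v x) p <= Z.of_nat m)%BZ by rewrite B_refll (BzC symG v p); nia.
have ygen w : zroot w -> B (refl v x) w <> Z0.
  by move=> ww; rewrite -(reflK symG w vv) B_refl //; apply/xgen/zroot_refl.
have [h [h' [hh' h'h hB hP]]] := IH _ ym y0 yp ygen.
have [S SE] := refl_aut symG vv.
have SS : S *m S = 1%:M.
  by apply/row_matrixP => i; rewrite !rowE mulmxA !SE reflK // mulmx1.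
exists (S *m h), (h' *m S); split.
- by rewrite mulmxA -(mulmxA S h) hh' mulmx1.
- by rewrite mulmxA -(mulmxA h') SS mulmx1.
- by move=> u w; rewrite !mulmxA hB !SE B_refl.
- by move=> w; rewrite mulmxA SE; apply: hP.
Qed.

Hypotheses (T20 : (0 < T2)%BZ) (T60 : (0 < T6)%BZ).

(** Height 0 lies below both thresholds, where [good] excludes it. *)
Lemma generic_p v : zroot v -> B p v <> Z0.
Proof.
move=> vv pv; case: (vv) => [v2|[v6 _]]; first by have [] := low2 v2 ltac:(lia).
by have [] := low6 vv v6 ltac:(lia).
Qed.

Lemma zroot_mul (g g' : 'M[int]_(ldim L)) v : g' *m g = 1%:M ->
  (forall u w, B (u *m g) (w *m g) = B u w) -> zroot v -> zroot (v *m g).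
Proof.
move=> g'g gB; apply: (zroot_aut (f := fun u => u *m g)) => // w.
by exists (w *m g'); rewrite -mulmxA g'g mulmx1.
Qed.

(** The points x and p define the same positive roots, and g preserves the signs at x; hence g and
    its inverse preserve the positive roots and [simple_image] applies. *)
Lemma symmetry_permutes (g g' : 'M[int]_(ldim L)) x : g *m g' = 1%:M -> g' *m g = 1%:M ->
  (forall u w, B (u *m g) (w *m g) = B u w) ->
  (forall v, zroot v -> (0 < B p v)%BZ -> (0 < B x v)%BZ) ->
  (forall v, zroot v -> (0 < B x v)%BZ <-> (0 < B (x *m g) v)%BZ) ->
  forall r, r \in R -> r *m g \in R.
Proof.
move=> gg' g'g gB xp xg.
have px v : zroot v -> (0 < B x v)%BZ -> (0 < B p v)%BZ.
  move=> vv xv; apply: NNPP => pv; have := generic_p vv.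
  have := xp _ (zrootN vv); rewrite !BzE; lia.
have g'B u w : B (u *m g') (w *m g') = B u w by rewrite -gB -!mulmxA g'g !mulmx1.
apply: (simple_image gg') => u uu pu.
  have ug := zroot_mul g'g gB uu; split=> //; apply: px => //; apply/(xg _ ug).
  by rewrite gB; apply: xp.
have ug := zroot_mul gg' g'B uu; split=> //; apply: px => //.
rewrite -gB -(mulmxA u) g'g mulmx1; apply/(xg _ uu); exact: xp.
Qed.

End Vinberg.

(** * Cells and automorphisms *)

Section Rational.
Local Open Scope ring_scope.
Variable L : lat.
Local Notation V := 'rV[int]_(ldim L).
Local Notation B := (@Bz L).
Local Notation vQ := (@vQ L).
Local Notation bilQ := (@bilQ L).

Lemma vQD v w : vQ (v + w) = vQ v + vQ w.
Proof. by rewrite /Defs.vQ map_mxD. Qed.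

Lemma vQZ (c : int) v : vQ (c *: v) = c%:~R *: vQ v.
Proof. by rewrite /Defs.vQ map_mxZ. Qed.

Lemma vQM v (g : 'M_(ldim L)) : vQ (v *m g) = vQ v *m gQ g.
Proof. by rewrite /Defs.vQ /gQ map_mxM. Qed.

Lemma vQ_inj : injective vQ.
Proof.
move=> v w /matrixP E; apply/matrixP => i j; have := E i j; rewrite !mxE.
exact: intr_inj.
Qed.

Lemma bilQ_int v w : bilQ (vQ v) (vQ w) = (bilZ v w)%:~R.
Proof. by rewrite /Defs.bilQ /Defs.vQ /GQ map_trmx -!map_mxM mxE. Qed.

Lemma bilQZl (c : rat) x y : bilQ (c *: x) y = c * bilQ x y.
Proof. by rewrite /Defs.bilQ -!scalemxAl mxE. Qed.

Lemma bilQZr (c : rat) x y : bilQ x (c *: y) = c * bilQ x y.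
Proof. by rewrite /Defs.bilQ linearZ -scalemxAr mxE. Qed.

(** Cells are cones, so a rational point may be replaced by an integral one. The scaling factor is
    the product of all denominators. *)
Lemma clear_denominators (x : 'rV[rat]_(ldim L)) :
  exists2 c : rat, 0 < c & exists X : V, x = c *: vQ X.
Proof.
exists (\prod_i (denq (x 0 i))%:~R)^-1.
  by rewrite invr_gt0 prodr_gt0 // => i _; rewrite ltr0z.
exists (\row_i (numq (x 0 i) * \prod_(j | j != i) denq (x 0 j))).
apply/rowP => i; rewrite !mxE rmorphM rmorph_prod (bigD1 i) //= mulrC invfM mulrA.
set P := \prod_(j | _) _; have P0 : P != 0.
  by apply/prodf_neq0 => j _; rewrite intr_eq0 denq_eq0.
rewrite -{1}[x 0 i]divq_num_den -!mulrA; congr (_ * _).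
by rewrite mulrCA divff // mulr1.
Qed.

Lemma bilZ_gt0 v w : (0 < bilZ v w) = (0 <? B v w)%BZ.
Proof. by rewrite /Bz; lia. Qed.

Lemma cone_int c X : 0 < c -> cone (c *: vQ X) <-> (B X X < 0)%BZ.
Proof.
move=> c0; rewrite /cone bilQZl bilQZr bilQ_int !pmulr_rlt0 // ltrz0 /Bz.
by split; lia.
Qed.

Lemma bilQ_sign c X v : 0 < c -> (0 < bilQ (c *: vQ X) (vQ v)) = (0 <? B X v)%BZ.
Proof. by move=> c0; rewrite bilQZl bilQ_int pmulr_rgt0 // ltr0z bilZ_gt0. Qed.

Lemma generic_int c X : 0 < c -> generic (c *: vQ X) <-> forall v, zroot v -> B X v <> Z0.
Proof.
move=> c0; split=> H v /isrootP /H.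
  rewrite bilQZl bilQ_int mulf_eq0 intr_eq0 (gt_eqF c0) /= => /eqP n0 E; apply: n0.
  by apply: (can_inj Z_of_intK); rewrite -/(Bz X v) E.
move=> n0; rewrite bilQZl bilQ_int mulf_eq0 intr_eq0 (gt_eqF c0) /=.
by apply/eqP => E; apply: n0; rewrite /Bz E.
Qed.

(** The preserved cell contains its base point, hence also the image of that point under g. What is
    kept is that no mirror separates the two. *)
Lemma achiral_int : achiral L -> exists (g : 'M[int]_(ldim L)) (X : V),
  [/\ isAut g, Z3_reversing g, (B X X < 0)%BZ, forall v, zroot v -> B X v <> Z0 &
      forall v, zroot v -> (0 < B X v)%BZ <-> (0 < B (X *m g) v)%BZ].
Proof.
case=> g [gG g3 [x0 [cx [gx xg]]]]; have [c c0 [X xE]] := clear_denominators x0.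
move: cx gx xg; rewrite {}xE => cx gx xg; exists g, X.
have [_ sgn] : same_cell (c *: vQ X) (c *: vQ X *m gQ g).
  by apply: (proj1 (xg _)); split=> //; split.
split=> //; [by apply/(cone_int _ c0) | by apply/(generic_int _ c0) |].
move=> v /isrootP vv; have := sgn v vv.
by rewrite -scalemxAl -vQM !bilQ_sign // => /eqP; case: Z.ltb_spec; case: Z.ltb_spec; lia.
Qed.

End Rational.

(** * Chirality from a system of simple roots *)

Section Chirality.
Local Open Scope ring_scope.
Variables (L : lat) (p : 'rV[int]_(ldim L)) (lam T2 T6 : Z).
Hypothesis symG : (gram L)^T = gram L.
Local Notation V := 'rV[int]_(ldim L).
Local Notation B := (@Bz L).
Local Notation zroot := (@zroot L).
Let N := (- B p p)%BZ.
Hypothesis N0 : (0 < N)%BZ.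
Hypothesis posF : forall w, (0 <= Fz N lam p w w)%BZ /\ (Fz N lam p w w = Z0 -> w = 0).
Variable R : seq V.
Hypotheses (Rroot : forall r, r \in R -> zroot r)
  (Rneg : forall r s, r \in R -> s \in R -> r <> s -> (B r s <= 0)%BZ)
  (Rpos : forall r, r \in R -> (0 < B p r)%BZ)
  (Rvol : forall x, (forall r, r \in R -> (0 <= B x r)%BZ) -> (B x x <= 0)%BZ)
  (RT2 : forall r, r \in R -> B r r = 2%BZ -> (B p r <= T2)%BZ /\ (B p r <= T6)%BZ)
  (RT6 : forall r, r \in R -> B r r = 6%BZ -> (B p r < 2 * T2)%BZ /\ (B p r <= T6)%BZ)
  (low2 : forall u, B u u = 2%BZ -> (0 <= B p u < T2)%BZ -> good p R u)
  (low6 : forall u, zroot u -> B u u = 6%BZ -> (0 <= B p u < T6)%BZ -> good p R u)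
  (T20 : (0 < T2)%BZ) (T60 : (0 < T6)%BZ).
Variables (K : 'M[int]_(ldim L)) (r0 : V).
Hypotheses (GK : gram L *m K = 6%:M) (Runiq : uniq R) (r0R : r0 \in R) (r06 : B r0 r0 = 6%BZ)
  (r03 : forall s, s \in R -> B s s = 6%BZ ->
     perm_eq [seq B r0 r | r <- R] [seq B s r | r <- R] -> exists y, s - r0 = 3 *: y).

(** The Gram matrix divides 6, so it is nonsingular, and then det(g)^2 = 1. *)
Lemma aut_unit g : isAut (L := L) g -> g \in unitmx.
Proof.
move=> gG; have /eqP := congr1 determinant GK; rewrite det_mulmx det_scalar => dG.
have dG0 : \det (gram L) != 0.
  by apply: contraTneq dG => ->; rewrite mul0r eq_sym expf_eq0 andbF.
have := congr1 determinant gG; rewrite !det_mulmx det_tr => E.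
rewrite unitmxE; apply/unitrPr; exists (\det g); apply: (mulIf dG0).
by rewrite mul1r -{2}E mulrAC.
Qed.

Theorem simple_roots_chiral : chiral L.
Proof.
case/achiral_int => g [X [gG g3 X0 Xgen Xg]].
have gB u w := Bz_aut u w gG.
have gu := aut_unit gG.
(* All conditions on X are invariant under X -> -X, so X may be taken in the half cone of p. *)
wlog Xp : X X0 Xgen Xg / (B X p < 0)%BZ.
  move=> H; have := cone_neq0 symG N0 posF X0 => Xp0.
  have [Xp|Xp] : (B X p < 0 \/ B X p > 0)%BZ by lia.
    exact: (H X).
  apply: (H (- X)); rewrite ?mulNmx ?BzE; try lia.
    by move=> v /Xgen; rewrite BzE; lia.
  by move=> v vv; have := Xg _ (zrootN vv); rewrite !BzE; tauto.
have [h [h' [hh' h'h hB hP]]] := descent symG N0 posF X0 Xp Xgen.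
have h'B u w : B (u *m h') (w *m h') = B u w by rewrite -hB -!mulmxA h'h !mulmx1.
have gg : g *m invmx g = 1%:M by rewrite mulmxV.
have gg' : invmx g *m g = 1%:M by rewrite mulVmx.
(* Conjugating by h moves the preserved cell onto the one that contains p, so [g1] permutes R. *)
pose g1 := h' *m g *m h; pose g1' := h' *m invmx g *m h.
have g1V : g1 *m g1' = 1%:M.
  by rewrite /g1 /g1' !mulmxA -(mulmxA _ h) hh' mulmx1 -(mulmxA h') gg mulmx1.
have g1V' : g1' *m g1 = 1%:M.
  by rewrite /g1 /g1' !mulmxA -(mulmxA _ h) hh' mulmx1 -(mulmxA h') gg' mulmx1.
have g1B u w : B (u *m g1) (w *m g1) = B u w by rewrite /g1 !mulmxA hB gB h'B.
have X1 v : zroot v -> (0 < B (X *m h) v)%BZ <-> (0 < B (X *m h *m g1) v)%BZ.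
  move=> vv; have vh : zroot (v *m h') by apply: (zroot_mul hh').
  rewrite /g1 !mulmxA -(mulmxA X) hh' mulmx1 -(h'B (X *m h)) -(h'B (X *m g *m h)).
  by rewrite -!mulmxA hh' !mulmx1; exact: Xg.
have permR := symmetry_permutes symG N0 posF Rroot Rneg Rpos Rvol RT2 RT6 low2 low6
  T20 T60 g1V g1V' g1B hP X1.
have g1_inj : injective (fun r : V => r *m g1).
  by apply: (can_inj (g := fun r => r *m g1')) => r; rewrite -(mulmxA r g1) g1V mulmx1.
pose s := r0 *m g1; have sR : s \in R by apply: permR.
have [y yE] : exists y, s - r0 = 3 *: y.
  apply: r03 => //; first by rewrite g1B.
  have -> : [seq B r0 r | r <- R] = [seq B s r | r <- [seq r *m g1 | r <- R]].
    by rewrite -map_comp; apply: eq_map => r /=; rewrite g1B.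
  apply: perm_map; apply: uniq_perm => //.
    by rewrite map_inj_uniq.
  have sub : {subset [seq r *m g1 | r <- R] <= R} by move=> _ /mapP[r /permR rR ->].
  have [||//] := uniq_min_size _ sub; last by rewrite size_map.
  by rewrite map_inj_uniq.
(* Reversal is a property of g, not of its conjugate, so r0 is carried back by h'. As t is a 6-root,
   t / 3 lies in the dual lattice and represents an element of the 3-part. *)
pose t := r0 *m h'.
have t3 : forall w, (3 | B t w)%BZ.
  have : zroot t by apply: (zroot_mul hh') => //; exact: Rroot.
  by case=> [|[_ //]]; rewrite h'B r06.
have [z zE] : intvecQ (3^-1 *: vQ t *m gQ g + 3^-1 *: vQ t).
  apply: g3; last by exists 1%N, t; rewrite expr1 scalerA divff // scale1r.
  move=> w; have [k kE] := t3 w; exists (int_of_Z k); rewrite bilQZl bilQ_int.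
  have -> : bilZ t w = int_of_Z k * 3 by apply: (can_inj Z_of_intK); rewrite -/(Bz t w) kE; lia.
  by rewrite rmorphM mulrC mulfK.
have tg : t *m g + t = 3 *: z.
  apply: vQ_inj; rewrite vQZ -zE vQD vQM scalerDr -scalemxAl !scalerA.
  by rewrite (_ : (3%:~R : rat) * 3^-1 = 1) ?scale1r // divff.
have sr : s + r0 = 3 *: (z *m h).
  rewrite scalemxAl -tg mulmxDl /s /g1 /t !mulmxA; congr (_ + _).
  by rewrite -mulmxA h'h mulmx1.
(* Reversal gives s + r0 in 3 L and the certificate gives s - r0 in 3 L. Hence 2 r0, and so r0, lies
   in 3 L, and the norm 6 would be divisible by 9. *)
have E : r0 = 3 *: (r0 - z *m h + y).
  move: (s) (z *m h) sr yE => s' zh sr {}yE.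
  apply/rowP => i; have := congr1 (fun v : V => v 0 i) sr; have := congr1 (fun v : V => v 0 i) yE.
  rewrite !mxE; move: (s' 0 i) (r0 0 i) (y 0 i) (zh 0 i); clear=> /= a b c d; lia.
have : B r0 r0 = 6%BZ by []; rewrite E !BzE.
by move: (B _ _) => b; lia.
Qed.

End Chirality.

(** * Checking chirality *)

Definition div3 (x : Z) : bool := x mod 3 =? 0.

Lemma div3P x : reflect (Z.divide 3 x) (div3 x).
Proof. by apply: (iffP (Z.eqb_spec _ _)) => /Z.mod_divide; apply. Qed.

Definition is_root (G : seq (seq Z)) (r : seq Z) : bool :=
  (bilL G r r =? 2) || (bilL G r r =? 6) && all div3 [seq dot g r | g <- G].

(* A certificate that the form is nonpositive on a polyhedral cone: a leaf writes D x^2 as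
   minus a nonnegative combination of products of two of the linear forms defining the cone,
   a node cuts the cone by the sign of a linear form. *)
Inductive voltree :=
| VolLeaf of Z & seq (nat * nat * Z)
| VolNode of seq Z & voltree & voltree.

(** The linear form of a cut is appended at the end of H, so the indices of the previous forms
    remain valid below the node. The factor 2 in front of D matches the one built into [qprod]. *)
Fixpoint vol_check (q : qform) (H : seq (seq Z)) (t : voltree) : bool :=
  match t with
  | VolLeaf D cs =>
      [&& 0 <? D,
          all (fun c => (0 <=? c.2) && (size (nth [::] H c.1.1) == size (nth [::] H c.1.2))) cs &
          all (fun b => (b.1 =? 0) && all (Z.eqb 0) b.2)
            (foldr (fun c q' => qadd (qscale c.2 (qprod (nth [::] H c.1.1) (nth [::] H c.1.2))) q')
               (qscale (2 * D) q) cs)]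
  | VolNode l t1 t2 => vol_check q (rcons H l) t1 && vol_check q (rcons H (vscale (-1) l)) t2
  end.

Lemma qeval_zero q v : all (fun b => (b.1 =? 0) && all (Z.eqb 0) b.2) q -> qeval q v = 0.
Proof.
elim: q v => [|[a r] q IH] [|x y] //= /andP[/andP[/Z.eqb_eq -> r0] /IH ->].
have -> : dot r y = 0; last by lia.
by elim: r y r0 => [|b r IHr] [|z y] //= /andP[/Z.eqb_eq <- /IHr ->].
Qed.

Lemma vol_checkP q H t v : vol_check q H t ->
  (forall h, h \in H -> 0 <= dot h v) -> qeval q v <= 0.
Proof.
elim: t H => [D cs|l t1 IH1 t2 IH2] H /=.
  case/and3P=> /Z.ltb_lt D0 c0 /(qeval_zero v) E Hv.
  suff: 2 * D * qeval q v <= 0 by nia.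
  rewrite -{}E; elim: cs c0 => [|[[i j] c] cs IH] /=; first by rewrite qeval_scale; lia.
  case/andP=> /andP[/Z.leb_le c0 /eqP sz] /IH {}IH.
  rewrite qeval_add qeval_scale qeval_prod //.
  have nn k : 0 <= dot (nth [::] H k) v.
    by have [lt|ge] := ltnP k (size H); [apply/Hv/mem_nth | rewrite nth_default].
  have := Z.mul_nonneg_nonneg _ _ c0 (Z.mul_nonneg_nonneg _ _ (nn i) (nn j)); lia.
case/andP=> c1 c2 Hv; have [l0|l0] : 0 <= dot l v \/ 0 <= dot (vscale (-1) l) v.
- by rewrite dot_scale; lia.
- by apply: (IH1 _ c1) => h; rewrite mem_rcons inE => /orP[/eqP->|/Hv].
- by apply: (IH2 _ c2) => h; rewrite mem_rcons inE => /orP[/eqP->|/Hv].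
Qed.

(* [B2] is a basis of the lattice; [B6] is a basis of the sublattice of the vectors whose
   products with the lattice are divisible by 3. *)
Record bases := Bases {
  B2 : seq (seq Z); K2 : seq (seq Z);
  B6 : seq (seq Z); K6 : seq (seq Z); M6 : seq (seq Z) }.

(** The two matrix identities say that the bases span: K2 B2 = 1, and G M6 B6 + 3 K6 B6 = 3. If v G
    = 3 y, multiplying the second identity by v gives v = (y M6 + v K6) B6. Correctness uses only
    spanning; the choice of the bases affects the cost of the enumeration. *)
Definition bases_check (G : seq (seq Z)) (b : bases) : bool :=
  let n := size G in
  [&& trL n G == G, size (B2 b) == n, size (K2 b) == n, size (B6 b) == n, size (K6 b) == n,
      size (M6 b) == n, mulL (K2 b) (B2 b) == scalL n 1 &
      [seq vadd u.1 u.2 | u <- zip (mulL (mulL G (M6 b)) (B6 b))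
                                   [seq vscale 3 r | r <- mulL (K6 b) (B6 b)]] == scalL n 3].

(* The positive definite form N (u, u) + lam (p, u)^2 is at most the given bound on the
   vectors u of norm s with 0 <= (p, u) < T; only these have to satisfy P. *)
Definition low_check (G bs : seq (seq Z)) (p : seq Z) (lam s T : Z) (P : seq Z -> bool) : bool :=
  let N := - bilL G p p in
  if enum_le (size G) (gramq (pdform G N lam p) bs) (s * N + lam * ((T - 1) * (T - 1))) is Some l
  then all (fun c => let u := combL c.1 bs in
    if bilL G u u =? s then
      let h := bilL G p u in if (0 <=? h) && (h <? T) then P u else true
    else true) l
  else false.

Section Checkers.
Local Open Scope ring_scope.
Variables (L : lat) (G : seq (seq Z)).
Hypothesis GP : represents L G.
Local Notation V := 'rV[int]_(ldim L).
Local Notation B := (@Bz L).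
Local Notation rv := (rv (ldim L)).
Local Notation mx := (mx (ldim L)).

Lemma is_rootP r : is_root G r -> (gram L)^T = gram L -> zroot (L := L) (rv r).
Proof.
move=> + symG; rewrite /is_root /zroot (Bz_list GP); case/orP=> [/Z.eqb_eq->|]; first by left.
case/andP=> /Z.eqb_eq -> r3; right; split=> // w.
rewrite (BzC symG) -[w]lsK (Bz_list GP) /bilL.
elim: (ls w) ([seq _ | _ <- _]) r3 => [|x a IH] [|y b] //=; try by exists Z0.
case/andP=> /div3P[k ->] /IH[l ->]; exists (x * k + l)%BZ; lia.
Qed.

Variable b : bases.
Hypothesis bP : bases_check G b.

Let bPn : [/\ trL (ldim L) G = G, size (B2 b) = ldim L, size (K2 b) = ldim L, size (B6 b) = ldim L
  & [/\ size (K6 b) = ldim L, size (M6 b) = ldim L,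
   mulL (K2 b) (B2 b) = scalL (ldim L) 1 &
      [seq vadd u.1 u.2 | u <- zip (mulL (mulL G (M6 b)) (B6 b))
                                   [seq vscale 3 r | r <- mulL (K6 b) (B6 b)]] = scalL (ldim L) 3]].
Proof.
move: bP; rewrite /bases_check (repr_size GP).
by case/and5P=> /eqP ? /eqP ? /eqP ? /eqP ? /and4P[/eqP ? /eqP ? /eqP ? /eqP ?].
Qed.

Lemma bases_sym : (gram L)^T = gram L.
Proof. by case: bPn => E *; rewrite (repr_gram GP) -mx_trL ?(repr_size GP) // E. Qed.

Lemma Bz_delta (v : V) j : B v (delta_mx 0 j) = Z_of_int ((v *m gram L) 0 j).
Proof. by rewrite /Bz /bilZ trmx_delta -colE mxE. Qed.

Lemma basis2 (v : V) : exists c : V, v = c *m mx (B2 b).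
Proof.
case: bPn => _ s1 s2 _ [_ _ E _]; exists (v *m mx (K2 b)).
by rewrite -mulmxA -mx_mulL // E mx_scalL mulmx1.
Qed.

Lemma basis6 (v : V) : (forall w, Z.divide 3 (B v w)) -> exists c : V, v = c *m mx (B6 b).
Proof.
move=> v3; case: bPn => _ _ _ s1 [s2 s3 _ E].
pose y : V := \row_j int_of_Z (B v (delta_mx 0 j) / 3).
have vG : v *m gram L = 3 *: y.
  apply/rowP => j; have [k kE] := v3 (delta_mx 0 j); rewrite [RHS]mxE [y 0 j]mxE.
  by apply: (can_inj Z_of_intK); rewrite -Bz_delta kE Z.div_mul // rmorphM /= int_of_ZK; lia.
exists (y *m mx (M6 b) + v *m mx (K6 b)).
have E3 : mx G *m mx (M6 b) *m mx (B6 b) + 3 *: (mx (K6 b) *m mx (B6 b)) = 3%:M.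
  have sG := repr_size GP.
  rewrite -!mx_mulL ?size_map ?sG // -[3%:M]/((int_of_Z 3)%:M) -mx_scalL -E.
  apply/matrixP => i j; rewrite !mxE (nth_map ([::], [::])) ?size_zip ?size_map ?sG ?s2 ?minnn //=.
  rewrite nth_zip ?size_map ?sG ?s2 //= nth_vadd rmorphD (nth_map [::]) ?size_map ?s2 //.
  by rewrite nth_vscale rmorphM.
have scal3 (u w : V) : 3 *: u = 3 *: w -> u = w.
  by move=> /rowP uw; apply/rowP => j; have := uw j; rewrite !mxE => /mulfI; apply.
apply: scal3.
rewrite mulmxDl scalerDr !scalemxAl -vG -{1}[v]mulmx1 -!mulmxA.
rewrite mulmx1 -scalemxAl [3 *: (v *m _)]scalemxAr -mulmxDr (repr_gram GP) mulmxA E3.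
by rewrite mul_mx_scalar.
Qed.

Lemma low_positive p lam s T P bs : low_check G bs p lam s T P -> size bs = ldim L ->
  (forall v : V, exists c : V, v = c *m mx bs) ->
  forall w, (0 <= Fz (- B (rv p) (rv p)) lam (rv p) w w)%BZ /\
            (Fz (- B (rv p) (rv p)) lam (rv p) w w = Z0 -> w = 0).
Proof.
rewrite /low_check -(Bz_list GP) (repr_size GP); case E : (enum_le _ _ _) => [l|//] _ sbs cov w.
by have [c ->] := cov w; exact: enum_pos bases_sym _ _ _ _ _ _ _ sbs E.
Qed.

Lemma low_checkP p lam s T P bs (u : V) : low_check G bs p lam s T P -> size bs = ldim L ->
  (0 <= lam)%BZ -> B u u = s -> (0 <= B (rv p) u < T)%BZ -> (exists c : V, u = c *m mx bs) ->
  exists2 l, u = rv l & P l.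
Proof.
rewrite /low_check -(Bz_list GP) (repr_size GP); case E : (enum_le _ _ _) => [l|//] /allP lP.
move=> sbs lam0 uu pu [c cE].
have /mapP[y yl yE] : ls c \in [seq y.1 | y <- l].
  apply: (enum_sound GP bases_sym sbs E); rewrite -cE /Fz uu.
  move: (B (rv p) u) pu => h pu; have : (h * h <= (T - 1) * (T - 1))%BZ by nia.
  by move=> hh; have := Z.mul_le_mono_nonneg_l _ _ _ lam0 hh; lia.
have uE : u = rv (combL (ls c) bs) by rewrite rv_combL // lsK.
have := lP _ yl; rewrite -yE -!(Bz_list GP) -uE uu Z.eqb_refl.
have -> : ((0 <=? B (rv p) u) && (B (rv p) u <? T))%BZ by lia.
by exists (combL (ls c) bs).
Qed.

End Checkers.

Record vinberg_data := VinbergData {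
  vd_p : seq Z; vd_lam : Z; vd_T2 : Z; vd_T6 : Z; vd_roots : seq (seq Z); vd_vol : voltree;
  vd_r0 : seq Z; vd_bases : bases }.

(** The height of the reflected vector is multiplied by (r, r), which avoids the division in
    [rcoef]. *)
Definition good_list (G R : seq (seq Z)) (p u : seq Z) : bool :=
  (bilL G p u != 0) &&
  all (fun r => [|| bilL G u r <=? 0, u == r |
                    0 <? bilL G p u * bilL G r r - 2 * bilL G u r * bilL G p r]) R.

(** In [vol_check] the choice N = 1, lam = 0 turns [pdform] into the lattice form itself, in
    standard coordinates; the cone is cut out by the forms x -> (x, r). The case distinction on the
    norm of r records the bounds on heights used by [equal_norm], [long_short] and [short_long]. *)
Definition chiral_check (G K : seq (seq Z)) (D : vinberg_data) : bool :=
  let: VinbergData p lam T2 T6 R vol r0 b := D in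
  let n := size G in
  let B := bilL G in
  [&& bases_check G b, mulL G K == scalL n 6, size K == n, 0 <=? lam, 0 <? T2, 0 <? T6 &
      B p p <? 0] &&
  [&& all (fun r => size r == n) R, uniq R, all (is_root G) R, all (fun r => 0 <? B p r) R,
      all (fun r => all (fun s => (r == s) || (B r s <=? 0)) R) R,
      all (fun r => if B r r =? 2 then (B p r <=? T2) && (B p r <=? T6)
                    else (B p r <? 2 * T2) && (B p r <=? T6)) R &
      vol_check (gramq (pdform G 1 0 [::]) (scalL n 1))
        [seq [seq dot g r | g <- G] | r <- R] vol] &&
  [&& low_check G (B2 b) p lam 2 T2 (good_list G R p),
      low_check G (B6 b) p lam 6 T6 (good_list G R p),
      r0 \in R, B r0 r0 =? 6 &
      all (fun s => (B s s =? 6) && perm_eq [seq B r0 r | r <- R] [seq B s r | r <- R]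
                    ==> all div3 (vadd s (vscale (-1) r0))) R].

Section ChiralCheck.
Local Open Scope ring_scope.
Variables (L : lat) (G K : seq (seq Z)) (D : vinberg_data).
Hypotheses (GP : represents L G) (GD : chiral_check G K D).
Local Notation V := 'rV[int]_(ldim L).
Local Notation B := (@Bz L).
Local Notation rv := (rv (ldim L)).
Local Notation mx := (mx (ldim L)).

Lemma good_listP R p u : (gram L)^T = gram L -> all (is_root G) R -> good_list G R p u ->
  good (rv p) [seq rv r | r <- R] (rv u).
Proof.
move=> symG Rr /andP[/eqP pu /allP gu]; split; first by rewrite (Bz_list GP).
move=> _ /mapP[r rR ->] ur; have := gu r rR; rewrite -!(Bz_list GP) => /or3P[|/eqP->|].
- by lia.
- by left.
have rr := is_rootP GP (allP Rr r rR) symG.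
have r0 : (0 < B (rv r) (rv r))%BZ by case: (rr) => [->|[-> _]].
move=> /Z.ltb_lt pos; right; rewrite B_reflr.
have cE := rcoefE symG (rv u) rr; move: (rcoef _ _) cE => c cE.
apply: (Zmult_lt_0_reg_r _ _ r0).
have -> : ((B (rv p) (rv u) - c * B (rv p) (rv r)) * B (rv r) (rv r) =
  B (rv p) (rv u) * B (rv r) (rv r) - (c * B (rv r) (rv r)) * B (rv p) (rv r))%BZ by lia.
by rewrite cE.
Qed.

Theorem chiral_checkP : chiral L.
Proof.
case: D GD => p lam T2 T6 R vol r0 b /andP[/andP[]].
rewrite (repr_size GP).
move=> /and5P[bP /eqP GK /eqP sK /Z.leb_le lam0 /and3P[/Z.ltb_lt T20 /Z.ltb_lt T60 /Z.ltb_lt pp]].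
move=> /and5P[/allP sR Runiq Rr /allP Rpos /and3P[/allP Rneg /allP RT volP]].
move=> /and5P[l2 l6 r0R /Z.eqb_eq r06 /allP r03].
have symG := bases_sym GP bP.
have inj : {in R &, injective rv}.
  by move=> r s /sR/eqP sr /sR/eqP ss /(congr1 (@ls _)); rewrite !rvK.
have [_ sB2 _ sB6 _] : [/\ true, size (B2 b) = ldim L, true, size (B6 b) = ldim L & true].
  by move: (bP); rewrite /bases_check (repr_size GP) => /and5P[_ /eqP -> _ /eqP -> _].
have cov2 := basis2 GP bP.
apply: (@simple_roots_chiral L (rv p) lam T2 T6 symG _ _ [seq rv r | r <- R] _ _ _ _ _ _ _ _
  T20 T60 (mx K) (rv r0)).
- by rewrite (Bz_list GP); lia.
- exact: low_positive GP _ bP _ _ _ _ _ _ l2 sB2 cov2.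
- by move=> _ /mapP[r rR ->]; exact (is_rootP GP (allP Rr r rR) symG).
- move=> _ _ /mapP[r rR ->] /mapP[s sR' ->] rs; rewrite (Bz_list GP).
  by have := allP (Rneg r rR) s sR'; case/orP=> [/eqP E|/Z.leb_le //]; rewrite E in rs.
- by move=> _ /mapP[r /Rpos/Z.ltb_lt rR ->]; rewrite (Bz_list GP).
- move=> x xR; have := vol_checkP (v := ls x) volP.
  rewrite (qeval_gramq GP symG) ?size_ls; last by rewrite size_map size_iota.
  rewrite rv_combL ?size_map ?size_iota // mx_scalL mulmx1 lsK.
  have -> : Fz 1 0 (rv [::]) x x = B x x by rewrite /Fz; lia.
  apply=> _ /mapP[r rR ->]; have := xR _ (map_f rv rR).
  by rewrite -{1}[x]lsK (Bz_list GP) /bilL dotC.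
- move=> _ /mapP[r /RT rR ->]; rewrite !(Bz_list GP) => E; move: rR; rewrite E /=.
  by case/andP=> /Z.leb_le ? /Z.leb_le.
- move=> _ /mapP[r /RT rR ->]; rewrite !(Bz_list GP) => E; move: rR; rewrite E /=.
  by case/andP=> /Z.ltb_lt ? /Z.leb_le.
- move=> u uu pu; have [l -> lP] := low_checkP GP bP l2 sB2 lam0 uu pu (cov2 u).
  exact: good_listP symG Rr lP.
- move=> u uroot uu pu.
  have u3 : forall w, Z.divide 3 (B u w) by case: uroot => [|[]] //; rewrite uu.
  have [l -> lP] := low_checkP GP bP l6 sB6 lam0 uu pu (basis6 GP bP u3).
  exact: good_listP symG Rr lP.
- by rewrite (repr_gram GP) -mx_mulL ?(repr_size GP) // GK mx_scalL.
- by rewrite map_inj_in_uniq.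
- exact: map_f.
- by rewrite (Bz_list GP).
move=> _ /mapP[s sR' ->]; rewrite (Bz_list GP) => s6.
have bE t : [seq B (rv t) r | r <- [seq rv r | r <- R]] = [seq bilL G t r | r <- R].
  by rewrite -map_comp; apply: eq_map => r /=; rewrite (Bz_list GP).
rewrite !bE => prof; have := r03 s sR'; rewrite s6 prof /= => s3.
pose d := vadd s (vscale (-1) r0).
exists (rv [seq (x / 3)%BZ | x <- d]).
have -> : rv s - rv r0 = rv d by rewrite rvD rvZ scaleN1r.
apply/rowP => i; rewrite !mxE; apply: (can_inj Z_of_intK); rewrite rmorphM /= !int_of_ZK.
have [lt|ge] := ltnP i (size d); last by rewrite !nth_default ?size_map.
rewrite (nth_map Z0) //; have /div3P[k ->] := all_nthP Z0 s3 i lt.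
by rewrite Z.div_mul //; lia.
Qed.

End ChiralCheck.

(** * Checking achirality *)

(** A negative norm ww is bounded by the reversed Cauchy-Schwarz inequality: -ww <= a2 <= E / 4.
    Then 2 E = c - ww <= c + E / 4, whence the constants 7 and 4. *)
Lemma norm_bound (c E xx ww a2 : Z) : xx < 0 -> 0 <= - xx * ww + a2 -> ww + 2 * E = c ->
  4 * a2 <= E -> (0 <=? c) -> 7 * E <= 4 * c.
Proof.
move=> x0 h E1 a4 c0; have [w0|w0] : 0 <= ww \/ ww < 0 by lia.
  by lia.
have : 0 <= (- xx - 1) * - ww by apply: Z.mul_nonneg_nonneg; lia.
by lia.
Qed.

Section Achirality.
Local Open Scope ring_scope.

(** A strengthening of achirality that passes to sums with copies of A1: an involution that fixes an
    integral point of the cone lying on no mirror. *)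
Record witness (L : lat) (x : 'rV[int]_(ldim L)) (g : 'M[int]_(ldim L)) : Prop := Witness {
  wit_aut : isAut g;
  wit_rev : Z3_reversing g;
  wit_inv : g *m g = 1%:M;
  wit_fix : x *m g = x;
  wit_neg : (Bz x x < 0)%BZ;
  wit_gen : forall v, zroot v -> Bz x v <> Z0 }.

(** Fixing x and permuting the roots, g maps the cell of x into itself; since g is an involution,
    this inclusion is an equality. *)
Lemma witness_achiral L x g : @witness L x g -> achiral L.
Proof.
case=> gG g3 gg xg x0 xgen; exists g; split=> //; exists (vQ x).
have gQB y z : bilQ (y *m gQ g) (z *m gQ g) = bilQ (L := L) y z.
  have gGQ : gQ g *m GQ L *m (gQ g)^T = GQ L.
    by rewrite /gQ /GQ map_trmx -!map_mxM gG.
  by rewrite /bilQ trmx_mul !mulmxA -(mulmxA y) -(mulmxA y) gGQ.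
have ggQ : gQ (L := L) g *m gQ g = 1%:M by rewrite /gQ -map_mxM gg map_mx1.
have xgQ : vQ x *m gQ g = vQ x by rewrite -vQM xg.
have cx : cone (vQ x) by rewrite -[vQ x]scale1r; apply/cone_int.
have gx : generic (vQ x) by rewrite -[vQ x]scale1r; apply/generic_int.
split=> //; split=> // y.
have vg v : isroot (L := L) v -> isroot (L := L) (v *m g).
  by move=> /isrootP vv; apply/isrootP/(zroot_mul gg) => // u w; apply: Bz_aut.
have flip (z : 'rV[rat]_(ldim L)) v : bilQ (L := L) (z *m gQ g) (vQ v) = bilQ z (vQ (v *m g)).
  by rewrite -[RHS]gQB vQM -mulmxA ggQ mulmx1.
have fwd z : same_cell (vQ x) z -> same_cell (vQ x) (z *m gQ g).
  case=> [[_ cz xz _ gz] sg]; split=> [|v vv].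
    split=> //; [by rewrite /cone gQB | by rewrite -[vQ x]xgQ gQB |].
    by move=> v /vg/gz; rewrite flip.
  by rewrite flip -(sg _ (vg _ vv)) -(flip (vQ x)) xgQ.
split; first exact: fwd.
by move/fwd; rewrite -mulmxA ggQ mulmx1.
Qed.

Lemma sum_sqr_le s (f : 'I_s -> Z) :
  ((\sum_i f i) * (\sum_i f i) <= Z.of_nat s * \sum_i f i * f i)%BZ.
Proof.
elim: s f => [|s IH] f; first by rewrite !big_ord0.
have E0 : (0 <= \sum_i f (lift ord0 i) * f (lift ord0 i))%BZ.
  by elim/big_rec: _ => // i x _ x0; have := Z.square_nonneg (f (lift ord0 i)); lia.
rewrite !big_ord_recl; have := IH (fun i => f (lift ord0 i)); move: E0.
move: (\sum_i f _) (\sum_i f _ * f _) (f ord0) => S E x E0 le.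
suff : (0 <= Z.of_nat s * (x * x) + E - 2 * x * S)%BZ by rewrite /=; lia.
case: s le {IH f} => [|s] le.
  have S0 : S = Z0 by nia.
  by rewrite S0; lia.
have s0 : (0 < Z.of_nat s.+1)%BZ by lia.
move: (Z.of_nat s.+1) s0 le => n n0 le.
have : (0 <= (n * x - S) * (n * x - S))%BZ by exact: Z.square_nonneg.
by nia.
Qed.

(** Let (w, e) be a root orthogonal to x', with E the sum of the squares of the e_i and S their sum.
    Orthogonality and the Cauchy-Schwarz inequality make (x, w)^2 small compared with E, and
    [norm_bound] leaves E <= 1 for a 2-root and E < 9 for a 6-root. Parity excludes E = 1, and
    divisibility of the e_i by 3 forces E = 0 for a 6-root. With E = 0, w would be a root of L
    orthogonal to x. *)
Lemma witness_tA1 L x g s : @witness L x g ->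
  (forall w, (0 <= - Bz x x * Bz w w + Bz x w * Bz x w)%BZ) ->
  exists x' g', @witness (osum L (tA1 s)) x' g'.
Proof.
case=> gG g3 gg xg x0 xgen hyp.
(* From M (x, w) = -2 S and S^2 <= s E one gets M^2 (x, w)^2 <= 4 s E, and this M suffices for 4 (x,
   w)^2 <= E. It also keeps the norm of x' negative, as M^2 > 2 s. *)
pose M : Z := Z.of_nat (4 * s + 4).
pose x' : 'rV[int]_(ldim L + s) := row_mx (int_of_Z M *: x) (const_mx 1).
pose g' : 'M[int]_(ldim L + s) := block_mx g 0 0 1%:M.
have BE (a b : 'rV[int]_(ldim L)) (c d : 'rV[int]_s) :
    Bz (L := osum L (tA1 s)) (row_mx a c) (row_mx b d) =
    (Bz a b + 2 * \sum_i Z_of_int (c 0 i) * Z_of_int (d 0 i))%BZ.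
  rewrite /Bz /bilZ /= mul_row_block tr_row_mx mul_row_col !mulmx0 addr0 add0r mxE rmorphD /=.
  congr (_ + _)%BZ; rewrite mul_mx_scalar -scalemxAl mxE rmorphM /= mxE rmorph_sum /=.
  by congr (_ * _)%BZ; apply: eq_bigr => i _; rewrite mxE rmorphM.
have x'E w e : Bz (L := osum L (tA1 s)) x' (row_mx w e) =
    (M * Bz x w + 2 * \sum_i Z_of_int (e 0 i))%BZ.
  rewrite BE BzZl int_of_ZK; congr (_ + 2 * _)%BZ.
  by apply: eq_bigr => i _; rewrite mxE mul1r.
exists x', g'; split.
- rewrite /isAut /= tr_block_mx !trmx0 trmx1 !mulmx_block.
  by rewrite !(mul0mx, mulmx0, mul1mx, mulmx1, addr0, add0r) gG.
- move=> y ydual [k [z kz]].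
  have BQE (a b : 'rV[rat]_(ldim L)) (c d : 'rV[rat]_s) :
      bilQ (L := osum L (tA1 s)) (row_mx a c) (row_mx b d) = bilQ a b + 2 * \sum_i c 0 i * d 0 i.
    rewrite /bilQ /GQ /= map_block_mx !map_mx0 mul_row_block tr_row_mx mul_row_col.
    rewrite !mulmx0 addr0 add0r mxE; congr (_ + _).
    rewrite map_scalar_mx mul_mx_scalar -scalemxAl mxE mxE; congr (_ * _).
    by apply: eq_bigr => i _; rewrite mxE.
  pose y1 := lsubmx (y : 'rV_(ldim L + s)); pose y2 := rsubmx (y : 'rV_(ldim L + s)).
  have yE : y = row_mx y1 y2 by rewrite hsubmxK.
  have vQrow (a : 'rV[int]_(ldim L)) (c : 'rV[int]_s) :
      vQ (L := osum L (tA1 s)) (row_mx a c) = row_mx (vQ a) (map_mx intr c).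
    by rewrite /vQ map_row_mx.
  have [z1 z1E] : intvecQ (L := L) (y1 *m gQ g + y1).
    apply: g3 => [w|].
      have [j jE] := ydual (row_mx w 0); exists j; rewrite -jE vQrow yE BQE.
      by rewrite big1 ?mulr0 ?addr0 // => i _; rewrite !mxE mulr0.
    exists k, (lsubmx (z : 'rV_(ldim L + s))).
    by rewrite /vQ map_lsubmx -/(vQ z) -kz /y1 linearZ.
  (* The dual of A1 consists of half-integral vectors, so on these summands the identity satisfies y
     + y in L: they contribute nothing to the 3-part. *)
  have z2P i : exists j : int, 2 * y2 0 i = j%:~R.
    have [j jE] := ydual (row_mx 0 (delta_mx 0 i)); exists j; rewrite -jE vQrow yE BQE.
    have -> : vQ (0 : 'rV[int]_(ldim L)) = 0 by rewrite /vQ map_mx0.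
    have b0 : bilQ (L := L) y1 0 = 0 by rewrite /bilQ trmx0 mulmx0 mxE.
    rewrite b0 add0r (bigD1 i) //= big1 ?addr0 => [|j' ne].
      by rewrite !mxE !eqxx mulr1.
    by rewrite !mxE (negPf ne) andbF mulr0.
  have [f fE] := fin_all_exists z2P.
  exists (row_mx z1 (\row_i f i)); rewrite vQrow -z1E.
  have -> : gQ (L := osum L (tA1 s)) g' = block_mx (gQ g) 0 0 1%:M.
    by rewrite /gQ /g' map_block_mx !map_mx0 map_mx1.
  rewrite [in LHS]yE mul_row_block !mulmx0 mulmx1 addr0 add0r add_row_mx; congr row_mx.
  apply/rowP => i; rewrite [LHS]mxE [RHS]mxE [(\row__ _) 0 i]mxE -[RHS]fE.
  by rewrite mulr_natl mulr2n.
- by rewrite /g' mulmx_block !(mul0mx, mulmx0, mul1mx, mulmx1, addr0, add0r) gg -scalar_mx_block.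
- by rewrite /x' /g' mul_row_block !(mul0mx, mulmx0, mul1mx, mulmx1, addr0, add0r) -scalemxAl xg.
- rewrite {2}/x' x'E BzZr int_of_ZK.
  have -> : \sum_i Z_of_int ((const_mx 1 : 'rV[int]_s) 0 i) = Z.of_nat s.
    under eq_bigr do rewrite mxE.
    by rewrite sumr_const card_ord; lia.
  by rewrite /M; nia.
move=> v; rewrite -[v](@hsubmxK _ 1 (ldim L) s).
move: (lsubmx (v : 'rV_(ldim L + s))) (rsubmx (v : 'rV_(ldim L + s))) => w e vroot.
rewrite x'E => E0; move: vroot; rewrite /zroot BE.
pose f (i : 'I_s) := Z_of_int (e 0 i).
rewrite -[\sum_i Z_of_int (e 0 i) * _]/(\sum_i f i * f i).
rewrite -[\sum_i Z_of_int (e 0 i)]/(\sum_i f i) in E0.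
set S := \sum_i f i in E0; set E := \sum_i _ => vroot.
have SE : (S * S <= Z.of_nat s * E)%BZ by apply: sum_sqr_le.
have E_ge0 : (0 <= E)%BZ.
  by rewrite /E; elim/big_rec: _ => // i y _ y0; have := Z.square_nonneg (f i); lia.
(* E and S have the same parity because n^2 and n do. This excludes E = 1, for which (x, w) = 0 and
   hence S = 0. *)
have [j jE] : exists j : Z, (E - S = 2 * j)%BZ.
  rewrite /E /S; elim/big_rec2: _ => [|i y1 y2 _ [j jE]]; first by exists Z0.
  have [k kE] : exists k : Z, (f i * f i - f i = 2 * k)%BZ.
    move: (f i) => y; have := Z.div_mod y 2 ltac:(lia); have := Z.mod_pos_bound y 2 ltac:(lia).
    move: (y / 2)%BZ (y mod 2)%BZ => q r r2 yE.
    have [rE|rE] : (r = 0 \/ r = 1)%BZ by lia.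
      by exists (2 * q * q - q)%BZ; rewrite yE rE; lia.
    by exists (2 * q * q + q)%BZ; rewrite yE rE; lia.
  by exists (j + k)%BZ; rewrite /=; lia.
have a4 : (4 * (Bz x w * Bz x w) <= E)%BZ.
  have MM : (M * M * (Bz x w * Bz x w) = 4 * (S * S))%BZ by nia.
  by move: MM; rewrite /M; move: (Bz x w * Bz x w)%BZ (Z.square_nonneg (Bz x w)) => a2 a20; nia.
have hw := hyp w.
have fin : E = Z0 -> Bz x w = Z0.
  by move=> E00; rewrite E00 in a4; nia.
case: vroot => [w2|[w6 w3]].
  have E1 : (E = 0 \/ E = 1)%BZ.
    suff : (E < 2)%BZ by lia.
    by have := norm_bound (c := 2) x0 hw w2 a4 isT; lia.
  case: E1 => E1; first by apply: (xgen w (or_introl _) (fin E1)); lia.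
  have a0 : Bz x w = Z0 by rewrite E1 in a4; nia.
  by rewrite a0 in E0; lia.
(* A 6-root has product 2 e_i with the i-th generator, and 2 is invertible modulo 3. *)
have e3 i : Z.divide 3 (f i).
  have := w3 (row_mx 0 (delta_mx 0 i)); rewrite BE Bz0r (bigD1 i) //= big1 => [|k ne].
    by rewrite !mxE !eqxx /= -/(f i) => -[k kE]; exists (f i - k)%BZ; lia.
  by rewrite !mxE (negPf ne) andbF mulr0.
have [k kE] : exists k, (E = 9 * k)%BZ.
  rewrite /E; elim/big_rec: _ => [|i y _ [k ->]]; first by exists Z0.
  by have [l ->] := e3 i; exists (l * l + k)%BZ; rewrite /=; lia.
have E00 : E = Z0.
  suff : (E < 9)%BZ by lia.
  by have := norm_bound (c := 6) x0 hw w6 a4 isT; lia.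
apply: (xgen w _ (fin E00)); right; split=> [|u]; first by lia.
have := w3 (row_mx u 0); rewrite BE big1 ?Z.add_0_r // => k' _.
by rewrite mxE mulr0.
Qed.

End Achirality.

Record symmetry_data := SymmetryData {
  sd_x : seq Z; sd_lam : Z; sd_g : seq (seq Z); sd_bases : bases }.

(** The threshold 1 restricts [low_check] to height 0, and the predicate [xpred0] then asserts that
    no root is orthogonal to x. At height 0 the bound of the enumeration does not involve lam, so
    lam can be taken large. Reversal is tested on [B6], whose elements divided by 3 represent the
    3-part of the discriminant group. *)
Definition achiral_check (G K : seq (seq Z)) (D : symmetry_data) : bool :=
  let: SymmetryData x lam g b := D in
  let n := size G in
  [&& bases_check G b, mulL G K == scalL n 6, size K == n, size g == n, size x == n, 0 <=? lam &
      bilL G x x <? 0] &&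
  [&& mulL (mulL g G) (trL n g) == G, mulL g g == scalL n 1, combL x g == x,
      all (fun r => all div3 (vadd (combL r g) r)) (B6 b),
      low_check G (B2 b) x lam 2 1 xpred0 & low_check G (B6 b) x lam 6 1 xpred0].

Section AchiralCheck.
Local Open Scope ring_scope.
Variables (L : lat) (G K : seq (seq Z)) (D : symmetry_data).
Hypotheses (GP : represents L G) (GD : achiral_check G K D).
Local Notation V := 'rV[int]_(ldim L).
Local Notation B := (@Bz L).
Local Notation rv := (rv (ldim L)).
Local Notation mx := (mx (ldim L)).
Local Notation vQ := (@vQ L).

(** If y in the dual represents an element of the 3-part, then t = 3 y is integral with all products
    divisible by 3, so it is a combination of [B6], on which g + 1 is divisible by 3. *)
Lemma reversing (KM g E : 'M[int]_(ldim L)) (b : bases) : bases_check G b ->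
  gram L *m KM = 6%:M -> mx (B6 b) *m g + mx (B6 b) = 3 *: E -> Z3_reversing (L := L) g.
Proof.
move=> bP GK gE y ydual [k [z kz]].
have [f fE] := fin_all_exists (fun j => ydual (delta_mx 0 j)).
have yG : y *m GQ L = vQ (\row_j f j).
  apply/rowP => j; rewrite [RHS]mxE [(\row__ _) 0 j]mxE -[RHS]fE /bilQ /Defs.vQ.
  by rewrite map_delta_mx trmx_delta -colE [RHS]mxE.
have y6 : 6 *: y = vQ (\row_j f j *m KM).
  rewrite vQM -yG -mulmxA -map_mxM GK map_scalar_mx mul_mx_scalar.
  by [].
have [t tE] : exists t : V, 3 *: y = vQ t.
  (* Both 6 y and 3^k y are integral. With 3^k = 2 m + 1 the identity 3 * 3^k - 6 m = 3 expresses 3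
     y through them. *)
  have [m mE] : exists m : nat, (3 ^ k = m.*2 + 1)%N.
    by exists (3 ^ k)./2; rewrite addn1 -{1}(odd_double_half (3 ^ k)) oddX orbT.
  exists ((3 : int) *: z - m%:Z *: (\row_j f j *m KM)).
  have -> : 3 *: y = (3 : rat) *: (3 ^+ k *: y) - m%:R *: (6 *: y).
    rewrite !scalerA -scalerBl; congr (_ *: _).
    have -> : (3 ^+ k : rat) = (m.*2 + 1)%:R by rewrite -natrX mE.
    by rewrite natrD -muln2 natrM mulrDr mulr1 mulrCA -natrM addrAC subrr add0r.
  by rewrite kz y6 vQD -[in RHS]scaleNr !vQZ mulrNz scaleNr.
have t3 w : Z.divide 3 (B t w).
  have [j jE] := ydual w; exists (Z_of_int j).
  have : (bilZ t w)%:~R = (j * 3)%:~R :> rat.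
    by rewrite -bilQ_int -tE bilQZl jE rmorphM mulrC.
  by move/intr_inj; rewrite /Bz => ->; rewrite rmorphM.
have [c cE] := basis6 GP bP t3.
exists (c *m E); have yE : y = 3^-1 *: vQ t by rewrite -tE scalerA mulVf // scale1r.
rewrite yE -scalemxAl -vQM -scalerDr -vQD cE -mulmxA -{2}[c]mulmx1.
have -> : c *m (mx (B6 b) *m g) + c *m 1%:M *m mx (B6 b) = 3 *: (c *m E).
  by rewrite mulmx1 -mulmxDr gE -scalemxAr.
by rewrite vQZ scalerA mulVf // scale1r.
Qed.

Theorem achiral_checkP : exists x g, @witness L x g /\
  forall w, (0 <= - B x x * B w w + B x w * B x w)%BZ.
Proof.
case: D GD => x lam g b /andP[].
rewrite (repr_size GP) => /and5P[bP /eqP GK /eqP sK /eqP sg].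
case/and3P=> /eqP sx /Z.leb_le lam0 /Z.ltb_lt x0.
case/and5P=> /eqP gG /eqP gg /eqP xg /allP g3 /andP[l2 l6].
have symG := bases_sym GP bP; have sG := repr_size GP.
have [_ sB2 _ sB6 _] : [/\ true, size (B2 b) = ldim L, true, size (B6 b) = ldim L & true].
  by move: (bP); rewrite /bases_check sG => /and5P[_ /eqP -> _ /eqP -> _].
have cov2 := basis2 GP bP.
have neg : (B (rv x) (rv x) < 0)%BZ by rewrite (Bz_list GP).
exists (rv x), (mx g); split; last first.
  move=> w; apply: (hyper (lam := lam)) => //; first by lia.
  exact: (low_positive GP bP l2 sB2 cov2).
split=> //.
- rewrite /isAut (repr_gram GP) -mx_trL // -!mx_mulL ?size_map ?sg ?size_iota //.
  by rewrite gG.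
- pose E := [seq [seq (a / 3)%BZ | a <- vadd (combL r g) r] | r <- B6 b].
  apply: (@reversing (mx K) (mx g) (mx E) b) => //.
    by rewrite (repr_gram GP) -mx_mulL // GK mx_scalL.
  rewrite -mx_mulL //; apply/matrixP => i j; rewrite !mxE.
  rewrite (nth_map [::]) ?sB6 // (nth_map [::]) ?sB6 //.
  have rB : nth [::] (B6 b) i \in B6 b by rewrite mem_nth ?sB6.
  have := g3 _ rB; move: (nth _ _ i) => r r3.
  rewrite -rmorphD -[_ + _]nth_vadd; apply: (can_inj Z_of_intK); rewrite rmorphM /= !int_of_ZK.
  have [lt|ge] := ltnP j (size (vadd (combL r g) r)); last by rewrite !nth_default ?size_map.
  rewrite (nth_map Z0) //; have /div3P[k ->] := all_nthP Z0 r3 j lt.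
  by rewrite Z.div_mul //; lia.
- by rewrite -mx_mulL // gg mx_scalL.
- by rewrite -rv_combL // xg.
move=> v vroot xv; have xv0 : (0 <= B (rv x) v < 1)%BZ by lia.
case: vroot => [v2|[v6 v3]].
  by have [] := low_checkP GP bP l2 sB2 lam0 v2 xv0 (cov2 v).
by have [] := low_checkP GP bP l6 sB6 lam0 v6 xv0 (basis6 GP bP v3).
Qed.

Lemma achiral_tA1 s : achiral (osum L (tA1 s)).
Proof.
have [x [g [wit hyp]]] := achiral_checkP.
by have [x' [g' /witness_achiral]] := witness_tA1 s wit hyp.
Qed.

End AchiralCheck.

(** * The lattices of the table *)

Definition sumL (A C : seq (seq Z)) : seq (seq Z) :=
  [seq r ++ nseq (size C) 0 | r <- A] ++ [seq nseq (size A) 0 ++ r | r <- C].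
Definition funL (n : nat) (f : nat -> nat -> Z) : seq (seq Z) :=
  [seq [seq f i j | j <- iota 0 n] | i <- iota 0 n].
Definition dynkinL (n : nat) (e : rel nat) : seq (seq Z) :=
  funL n (fun i j => if i == j then 2 else if e i j || e j i then -1 else 0).

Section Represents.
Local Open Scope ring_scope.

Lemma represents_fun n (M : 'M[int]_n) f :
  (forall i j, M i j = int_of_Z (f (nat_of_ord i) (nat_of_ord j))) -> represents (Lat M) (funL n f).
Proof.
move=> Mf; split; rewrite /= ?size_map ?size_iota //.
  by apply/allP => _ /mapP[i _ ->]; rewrite size_map size_iota.
apply/matrixP => i j; rewrite Mf mxE (nth_map 0%N) ?size_iota // (nth_map 0%N) ?size_iota //.
by rewrite !nth_iota.
Qed.

Lemma represents_osum L1 L2 G1 G2 : represents L1 G1 -> represents L2 G2 ->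
  represents (osum L1 L2) (sumL G1 G2).
Proof.
move=> [s1 r1 g1] [s2 r2 g2]; split.
- by rewrite size_cat !size_map s1 s2.
- rewrite all_cat !all_map; apply/andP; split.
    by apply: sub_all r1 => r /= /eqP sr; rewrite size_cat size_nseq sr s2.
  by apply: sub_all r2 => r /= /eqP sr; rewrite size_cat size_nseq sr s1.
have row1 i : (i < ldim L1)%N -> size (nth [::] G1 i) = ldim L1.
  by move=> lt; apply/eqP/(all_nthP [::] r1); rewrite s1.
apply/matrixP => i j; rewrite -[i]splitK -[j]splitK [RHS]mxE /sumL nth_cat size_map s1.
case: (split i) => {}i; case: (split j) => {}j /=; rewrite ?ltn_ord ?ltnNge ?leq_addr /= ?addKn.
- rewrite block_mxEul g1 mxE (nth_map [::]) ?s1 // nth_cat row1 // ltn_ord; congr int_of_Z.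
- rewrite block_mxEur mxE (nth_map [::]) ?s1 // nth_cat row1 // ltnNge leq_addr /= addKn.
  by rewrite nth_nseq if_same.
- rewrite block_mxEdl mxE (nth_map [::]) ?s2 // nth_cat size_nseq ltn_ord.
  by rewrite nth_nseq if_same.
- rewrite block_mxEdr g2 mxE (nth_map [::]) ?s2 // nth_cat size_nseq ltnNge leq_addr /= addKn.
  by [].
Qed.

Lemma represents_rk1 c : represents (rk1 (int_of_Z c)) [:: [:: c]].
Proof. by split=> //; apply/matrixP => i j; rewrite !ord1 !mxE. Qed.

Lemma represents_dynkin n e : represents (Lat (dynkin n e)) (dynkinL n e).
Proof.
apply: represents_fun => i j; rewrite mxE -val_eqE /=.
by case: eqP => // _; case: ifP.
Qed.

Lemma represents_U : represents latU [:: [:: 0; 1]; [:: 1; 0]]%BZ.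
Proof.
apply: (@represents_fun 2 _ (fun i j => if i == j then Z0 else 1%BZ)) => i j.
by rewrite mxE -val_eqE /=; case: eqP.
Qed.

Lemma represents_tA1 t : represents (tA1 t) (scalL t 2).
Proof.
apply: (@represents_fun t _ (fun i j => if i == j then 2%BZ else Z0)) => i j.
by rewrite mxE -val_eqE /=; case: eqP.
Qed.

(** Identifies a row at t with the same row at t0 plus t - t0 copies of A1. Their dimensions are
    different expressions, and comparing Gram lists avoids casts between matrix types. *)
Lemma represents_eq L L' G : represents L G -> represents L' G -> L = L'.
Proof.
case: L L' => n M [n' M'] [/= s _ ->] [/= s' _ ->].
by move: s'; rewrite s => E; rewrite E.
Qed.

End Represents.

Definition gramA2 := dynkinL 2 (fun i j => (i == 0)%N && (j == 1)%N).
Definition gramD4 := dynkinL 4 (fun i j => (i == 0)%N && (0 < j)%N).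
Definition gramE8 := dynkinL 8 (fun i j => ((j == i.+1) && (i < 6))%N || ((i == 4) && (j == 7))%N).
Definition gramU := [:: [:: 0; 1]; [:: 1; 0]].
Definition grammA1 := [:: [:: -2]].
Definition gram6 := [:: [:: 6]].

(* The matrices K are 6 times the inverses of the Gram matrices G. *)
Definition dualA2 := [:: [:: 4; 2]; [:: 2; 4]].
Definition dualD4 := [:: [:: 12; 6; 6; 6]; [:: 6; 6; 3; 3]; [:: 6; 3; 6; 3]; [:: 6; 3; 3; 6]].
Definition dualE8 := [:: [:: 12; 18; 24; 30; 36; 24; 12; 18]; [:: 18; 36; 48; 60; 72; 48; 24; 36]; [::
  24; 48; 72; 90; 108; 72; 36; 54]; [:: 30; 60; 90; 120; 144; 96; 48; 72]; [:: 36; 72; 108; 144;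
  180; 120; 60; 90]; [:: 24; 48; 72; 96; 120; 84; 42; 60]; [:: 12; 24; 36; 48; 60; 42; 24; 30]; [::
  18; 36; 54; 72; 90; 60; 30; 48]].
Definition dualU := [:: [:: 0; 6]; [:: 6; 0]].
Definition dualmA1 := [:: [:: -3]].
Definition dual6 := [:: [:: 1]].


Definition gram_row0 t := sumL (sumL grammA1 gram6) (scalL t 2).
Definition dual_row0 t := sumL (sumL dualmA1 dual6) (scalL t 3).
Definition gram_row1 t := sumL (sumL grammA1 gramA2) (scalL t 2).
Definition dual_row1 t := sumL (sumL dualmA1 dualA2) (scalL t 3).
Definition gram_row2 t := sumL (sumL gramU gramA2) (scalL t 2).
Definition dual_row2 t := sumL (sumL dualU dualA2) (scalL t 3).
Definition gram_row3 t := sumL (sumL (sumL gramU gramA2) gramD4) (scalL t 2).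
Definition dual_row3 t := sumL (sumL (sumL dualU dualA2) dualD4) (scalL t 3).
Definition gram_row4 t := sumL (sumL (sumL grammA1 gram6) gramE8) (scalL t 2).
Definition dual_row4 t := sumL (sumL (sumL dualmA1 dual6) dualE8) (scalL t 3).
Definition gram_row5 t := sumL (sumL (sumL grammA1 gramA2) gramE8) (scalL t 2).
Definition dual_row5 t := sumL (sumL (sumL dualmA1 dualA2) dualE8) (scalL t 3).
Definition gram_row6 t := sumL (sumL (sumL gramU gramA2) gramE8) (scalL t 2).
Definition dual_row6 t := sumL (sumL (sumL dualU dualA2) dualE8) (scalL t 3).
Definition gram_row7 t := sumL (sumL (sumL (sumL gramU gramA2) gramD4) gramE8) (scalL t 2).
Definition dual_row7 t := sumL (sumL (sumL (sumL dualU dualA2) dualD4) dualE8) (scalL t 3).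
Definition gram_row8 t := sumL (sumL (sumL (sumL grammA1 gram6) gramE8) gramE8) (scalL t 2).
Definition dual_row8 t := sumL (sumL (sumL (sumL dualmA1 dual6) dualE8) dualE8) (scalL t 3).
Definition gram_row9 t := sumL (sumL (sumL (sumL grammA1 gramA2) gramE8) gramE8) (scalL t 2).
Definition dual_row9 t := sumL (sumL (sumL (sumL dualmA1 dualA2) dualE8) dualE8) (scalL t 3).
Definition gram_row10 t := sumL (sumL (sumL (sumL gramU gramA2) gramE8) gramE8) (scalL t 2).
Definition dual_row10 t := sumL (sumL (sumL (sumL dualU dualA2) dualE8) dualE8) (scalL t 3).

Ltac represents_row :=
  repeat first [exact: represents_tA1 | apply: represents_osum | exact: represents_U
               | exact: represents_dynkin | exact: (represents_rk1 (-2))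
               | exact: (represents_rk1 6)].

Lemma represents_row0 t : represents (Lrow0 t) (gram_row0 t).
Proof. by represents_row. Qed.

Lemma represents_row1 t : represents (Lrow1 t) (gram_row1 t).
Proof. by represents_row. Qed.

Lemma represents_row2 t : represents (Lrow2 t) (gram_row2 t).
Proof. by represents_row. Qed.

Lemma represents_row3 t : represents (Lrow3 t) (gram_row3 t).
Proof. by represents_row. Qed.

Lemma represents_row4 t : represents (Lrow4 t) (gram_row4 t).
Proof. by represents_row. Qed.

Lemma represents_row5 t : represents (Lrow5 t) (gram_row5 t).
Proof. by represents_row. Qed.

Lemma represents_row6 t : represents (Lrow6 t) (gram_row6 t).
Proof. by represents_row. Qed.

Lemma represents_row7 t : represents (Lrow7 t) (gram_row7 t).
Proof. by represents_row. Qed.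

Lemma represents_row8 t : represents (Lrow8 t) (gram_row8 t).
Proof. by represents_row. Qed.

Lemma represents_row9 t : represents (Lrow9 t) (gram_row9 t).
Proof. by represents_row. Qed.

Lemma represents_row10 t : represents (Lrow10 t) (gram_row10 t).
Proof. by represents_row. Qed.

Section Rows.
Variables (row : nat -> lat) (G K : nat -> seq (seq Z)).
Hypothesis rowP : forall t, represents (row t) (G t).

(** One certificate, for the first achiral lattice, serves the whole row; the decomposition of each
    later Gram list is checked by evaluation. *)
Lemma achiral_row S t0 m : achiral_check (G t0) (K t0) S ->
  all (fun t => G t == sumL (G t0) (scalL (t - t0)%N 2)) (iota t0 (m.+1 - t0)) ->
  forall t, (t0 <= t <= m)%N -> achiral (row t).
Proof.
move=> S0 /allP Gt t tm; have /Gt/eqP E : t \in iota t0 (m.+1 - t0) by rewrite mem_iota; lia.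
have := represents_osum (rowP t0) (represents_tA1 (t - t0)); rewrite -E => Rt.
by rewrite (represents_eq (rowP t) Rt); apply: achiral_tA1 (rowP t0) S0 _.
Qed.

Lemma chiral_row D t : chiral_check (G t) (K t) D -> chiral (row t).
Proof. exact: chiral_checkP. Qed.

End Rows.

(** * Certificates for the fourteen chiral lattices *)

(** The smallest case shows the obstruction: both simple roots are 6-roots and their interchange
    respects all products, but their difference (-3, -3) lies in 3 L. *)
Definition vinberg0_0 : vinberg_data := VinbergData
  [:: 3; 1] 2 4 6
  [:: [:: 0; 1]; [:: -3; -2]]
  (VolLeaf 18 [:: (0%N, 0%N, 1); (0%N, 1%N, 4); (1%N, 1%N, 1)])
  [:: 0; 1]
  (Bases
    [:: [:: 1; 0]; [:: 2; 1]]
    [:: [:: 1; 0]; [:: -2; 1]]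
    [:: [:: 0; 1]; [:: 3; 2]]
    [:: [:: 0; 1]; [:: 1; 0]]
    [:: [:: 1; 1]; [:: 0; 0]]).

Definition vinberg0_1 : vinberg_data := VinbergData
  [:: 3; 1; 1] 2 4 6
  [:: [:: 0; 1; 0]; [:: 0; 0; 1]; [:: -3; -1; -3]; [:: -3; -2; 0]]
  (VolLeaf 18 [:: (0%N, 3%N, 2); (1%N, 2%N, 6); (2%N, 2%N, 1)])
  [:: 0; 1; 0]
  (Bases
    [:: [:: 0; 0; 1]; [:: 1; 0; 1]; [:: 2; 1; 1]]
    [:: [:: -1; 1; 0]; [:: 1; -2; 1]; [:: 1; 0; 0]]
    [:: [:: 0; 1; 0]; [:: 3; 2; 0]; [:: 3; 1; 3]]
    [:: [:: 0; 1; 0]; [:: 1; 0; 0]; [:: 1; -1; 1]]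
    [:: [:: 1; 1; 0]; [:: 0; 0; 0]; [:: -1; 1; -1]]).

Definition vinberg1_0 : vinberg_data := VinbergData
  [:: 9; 6; 8] 2 4 6
  [:: [:: 0; 1; 0]; [:: 0; -1; 1]; [:: -3; -2; -4]]
  (VolLeaf 18 [:: (0%N, 1%N, 12); (0%N, 2%N, 12); (1%N, 1%N, 4); (1%N, 2%N, 8); (2%N, 2%N, 1)])
  [:: 0; -1; 1]
  (Bases
    [:: [:: 1; 1; 1]; [:: -1; 0; -1]; [:: -1; -1; -2]]
    [:: [:: 1; -1; 1]; [:: 1; 1; 0]; [:: -1; 0; -1]]
    [:: [:: 3; 3; 3]; [:: 0; 1; -1]; [:: 0; 2; 1]]
    [:: [:: 1; 1; 0]; [:: 0; 1; 1]; [:: 0; -1; 0]]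
    [:: [:: 1; 1; 1]; [:: 0; -1; -1]; [:: 0; 0; 0]]).

Definition vinberg1_1 : vinberg_data := VinbergData
  [:: 9; 6; 8; 1] 2 4 6
  [:: [:: 0; 1; 0; 0]; [:: 0; -1; 1; 0]; [:: 0; 0; 0; 1]; [:: -1; -1; -1; -1]; [:: -3; -2; -4; 0]]
  (VolLeaf 6 [:: (0%N, 1%N, 4); (0%N, 4%N, 4); (1%N, 1%N, 1); (1%N, 3%N, 1); (1%N, 4%N, 2); (2%N,
    3%N, 3); (3%N, 4%N, 1)])
  [:: 0; -1; 1; 0]
  (Bases
    [:: [:: 1; 1; 1; 0]; [:: -1; 0; -1; 0]; [:: 0; 0; 0; 1]; [:: -1; -1; -2; 0]]
    [:: [:: 1; -1; 0; 1]; [:: 1; 1; 0; 0]; [:: -1; 0; 0; -1]; [:: 0; 0; 1; 0]]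
    [:: [:: 3; 3; 3; 0]; [:: 0; 1; -1; 0]; [:: 0; 2; 1; 0]; [:: 0; 0; 0; 3]]
    [:: [:: 1; 1; 0; 0]; [:: 0; 1; 1; 0]; [:: 0; -1; 0; 0]; [:: 0; 0; 0; 1]]
    [:: [:: 1; 1; 1; 0]; [:: 0; -1; -1; 0]; [:: 0; 0; 0; 0]; [:: 0; 0; 0; -1]]).

Definition vinberg1_2 : vinberg_data := VinbergData
  [:: 4; 2; 3; 1; 1] 2 4 6
  [:: [:: 0; 1; 0; 0; 0]; [:: 0; -1; 1; 0; 0]; [:: 0; 0; 0; 1; 0]; [:: 0; 0; 0; 0; 1]; [:: -1; 0; 0;
    -1; -1]; [:: -1; -1; -1; 0; -1]; [:: -1; -1; -1; -1; 0]; [:: -3; -2; -4; 0; 0]]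
  (VolLeaf 6 [:: (0%N, 1%N, 2); (0%N, 7%N, 2); (1%N, 4%N, 1); (1%N, 7%N, 1); (2%N, 6%N, 3); (3%N,
    5%N, 3); (4%N, 7%N, 1)])
  [:: 0; -1; 1; 0; 0]
  (Bases
    [:: [:: 1; 1; 1; 0; 0]; [:: 0; 1; 0; 0; 0]; [:: 1; 1; 1; 1; 0]; [:: 1; 1; 1; 0; 1]; [:: -1; -1;
      -2; 0; 0]]
    [:: [:: 2; -1; 0; 0; 1]; [:: 0; 1; 0; 0; 0]; [:: -1; 0; 0; 0; -1]; [:: -1; 0; 1; 0; 0]; [:: -1;
      0; 0; 1; 0]]
    [:: [:: 0; 1; -1; 0; 0]; [:: 0; 2; 1; 0; 0]; [:: 3; 2; 4; 0; 0]; [:: 3; 1; 2; 3; 0]; [:: 3; 1;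
      2; 0; 3]]
    [:: [:: 0; 0; 1; 0; 0]; [:: 1; 1; 0; 0; 0]; [:: -1; 0; 0; 0; 0]; [:: -1; 1; -1; 1; 0]; [:: -1;
      1; -1; 0; 1]]
    [:: [:: -1; 1; 1; 0; 0]; [:: -1; -1; 0; 0; 0]; [:: 0; 0; 0; 0; 0]; [:: 1; -1; 1; -1; 0]; [:: 1;
      -1; 1; 0; -1]]).

Definition vinberg1_3 : vinberg_data := VinbergData
  [:: 9; 4; 7; 3; 3; 3] 2 7 12
  [:: [:: 0; 1; 0; 0; 0; 0]; [:: 0; -1; 1; 0; 0; 0]; [:: 0; 0; 0; 1; 0; 0]; [:: 0; 0; 0; 0; 1; 0];
    [:: 0; 0; 0; 0; 0; 1]; [:: -1; 0; 0; 0; -1; -1]; [:: -1; 0; 0; -1; 0; -1]; [:: -1; 0; 0; -1; -1;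
    0]; [:: -1; -1; -1; 0; 0; -1]; [:: -1; -1; -1; 0; -1; 0]; [:: -1; -1; -1; -1; 0; 0]; [:: -3; -2;
    -4; 0; 0; 0]; [:: -6; -2; -4; -3; -3; -3]]
  (VolNode [:: -2; 0; 0; 2; 2; 2]
      (VolLeaf 18 [:: (0%N, 1%N, 6); (0%N, 12%N, 6); (1%N, 11%N, 1); (1%N, 12%N, 2); (5%N, 10%N, 9);
        (6%N, 9%N, 9); (7%N, 8%N, 9); (12%N, 13%N, 3)])
      (VolLeaf 6 [:: (0%N, 1%N, 2); (0%N, 11%N, 2); (1%N, 11%N, 1); (2%N, 10%N, 3); (3%N, 13%N, 3);
        (4%N, 8%N, 3); (6%N, 9%N, 3)]))
  [:: 0; -1; 1; 0; 0; 0]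
  (Bases
    [:: [:: 0; 1; 0; 0; 0; 0]; [:: 1; 1; 1; 1; 0; 0]; [:: 1; 1; 1; 0; 1; 0]; [:: 1; 1; 1; 0; 0; 1];
      [:: 1; 1; 1; 0; 0; 0]; [:: 2; 1; 1; 1; 1; 1]]
    [:: [:: 0; -1; -1; -1; 2; 1]; [:: 1; 0; 0; 0; 0; 0]; [:: -1; 1; 1; 1; -1; -1]; [:: 0; 1; 0; 0;
      -1; 0]; [:: 0; 0; 1; 0; -1; 0]; [:: 0; 0; 0; 1; -1; 0]]
    [:: [:: 0; 1; -1; 0; 0; 0]; [:: 0; 2; 1; 0; 0; 0]; [:: 3; 2; 4; 0; 0; 0]; [:: 3; 1; 2; 3; 0; 0];
      [:: 3; 1; 2; 0; 3; 0]; [:: 6; 2; 4; 3; 3; 3]]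
    [:: [:: 0; 0; 1; 0; 0; 0]; [:: 1; 1; 0; 0; 0; 0]; [:: -1; 0; 0; 0; 0; 0]; [:: -1; 1; -1; 1; 0;
      0]; [:: -1; 1; -1; 0; 1; 0]; [:: 0; 0; 0; -1; -1; 1]]
    [:: [:: -1; 1; 1; 0; 0; 0]; [:: -1; -1; 0; 0; 0; 0]; [:: 0; 0; 0; 0; 0; 0]; [:: 1; -1; 1; -1; 0;
      0]; [:: 1; -1; 1; 0; -1; 0]; [:: 0; 0; 0; 1; 1; -1]]).

Definition vinberg1_4 : vinberg_data := VinbergData
  [:: 9; 4; 7; 3; 3; 3; 3] 2 7 12
  [:: [:: 0; 1; 0; 0; 0; 0; 0]; [:: 0; -1; 1; 0; 0; 0; 0]; [:: 0; 0; 0; 1; 0; 0; 0]; [:: 0; 0; 0; 0;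
    1; 0; 0]; [:: 0; 0; 0; 0; 0; 1; 0]; [:: 0; 0; 0; 0; 0; 0; 1]; [:: -1; 0; 0; 0; 0; -1; -1]; [::
    -1; 0; 0; 0; -1; 0; -1]; [:: -1; 0; 0; 0; -1; -1; 0]; [:: -1; 0; 0; -1; 0; 0; -1]; [:: -1; 0; 0;
    -1; 0; -1; 0]; [:: -1; 0; 0; -1; -1; 0; 0]; [:: -1; -1; -1; 0; 0; 0; -1]; [:: -1; -1; -1; 0; 0;
    -1; 0]; [:: -1; -1; -1; 0; -1; 0; 0]; [:: -1; -1; -1; -1; 0; 0; 0]; [:: -3; -2; -4; 0; 0; 0; 0];
    [:: -2; -1; -1; -1; -1; -1; -1]; [:: -6; -2; -4; 0; -3; -3; -3]; [:: -6; -2; -4; -3; 0; -3; -3];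
    [:: -6; -2; -4; -3; -3; 0; -3]; [:: -6; -2; -4; -3; -3; -3; 0]; [:: -9; -4; -8; -3; -3; -3; -3]]
  (VolNode [:: -18; -3; 15; 6; 6; 6; 6]
      (VolLeaf 18 [:: (0%N, 1%N, 6); (0%N, 22%N, 6); (12%N, 21%N, 3); (13%N, 20%N, 3); (14%N, 19%N,
        3); (15%N, 18%N, 3); (16%N, 17%N, 3); (22%N, 23%N, 1)])
      (VolNode [:: 0; 0; 0; -2; 2; 0; 0]
      (VolNode [:: 0; 0; 0; 0; 0; -2; 2]
      (VolNode [:: 0; 0; 0; -2; 0; 2; 0]
      (VolNode [:: 0; 0; 0; 0; 2; -2; 0]
      (VolLeaf 18 [:: (0%N, 13%N, 18); (1%N, 13%N, 3); (1%N, 23%N, 1); (2%N, 17%N, 9); (7%N, 16%N,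
        3); (12%N, 25%N, 9); (14%N, 27%N, 9); (18%N, 26%N, 3)])
      (VolLeaf 18 [:: (0%N, 14%N, 18); (1%N, 14%N, 3); (1%N, 23%N, 1); (2%N, 17%N, 9); (6%N, 16%N,
        3); (12%N, 25%N, 9); (12%N, 27%N, 9); (13%N, 27%N, 9); (18%N, 24%N, 3)]))
      (VolNode [:: 0; 0; 0; 2; 0; 0; -2]
      (VolLeaf 36 [:: (0%N, 12%N, 18); (0%N, 14%N, 12); (0%N, 15%N, 6); (1%N, 14%N, 6); (1%N, 23%N,
        2); (2%N, 24%N, 6); (4%N, 17%N, 18); (4%N, 27%N, 9); (7%N, 24%N, 6); (11%N, 16%N, 6); (14%N,
        24%N, 12); (14%N, 27%N, 15); (15%N, 27%N, 3); (20%N, 25%N, 6); (21%N, 27%N, 3)])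
      (VolLeaf 18 [:: (0%N, 12%N, 6); (0%N, 15%N, 12); (1%N, 12%N, 3); (1%N, 23%N, 1); (4%N, 17%N,
        9); (4%N, 27%N, 3); (6%N, 27%N, 3); (7%N, 16%N, 3); (12%N, 27%N, 6); (14%N, 24%N, 9); (20%N,
        26%N, 3)])))
      (VolNode [:: 0; 0; 0; -2; 0; 0; 2]
      (VolNode [:: 0; 0; 0; 0; 2; 0; -2]
      (VolLeaf 18 [:: (0%N, 12%N, 18); (1%N, 13%N, 3); (1%N, 23%N, 1); (1%N, 25%N, 3); (2%N, 17%N,
        9); (8%N, 16%N, 3); (13%N, 25%N, 9); (14%N, 27%N, 9); (18%N, 26%N, 3)])
      (VolLeaf 36 [:: (0%N, 12%N, 18); (0%N, 14%N, 18); (1%N, 12%N, 6); (1%N, 23%N, 2); (2%N, 17%N,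
        18); (6%N, 16%N, 6); (6%N, 27%N, 9); (12%N, 27%N, 9); (13%N, 25%N, 18); (13%N, 27%N, 9);
        (16%N, 27%N, 3); (18%N, 24%N, 6)]))
      (VolNode [:: 0; 0; 0; 2; 0; -2; 0]
      (VolLeaf 36 [:: (0%N, 13%N, 18); (0%N, 15%N, 18); (1%N, 14%N, 6); (1%N, 23%N, 2); (1%N, 24%N,
        6); (5%N, 17%N, 18); (8%N, 16%N, 3); (11%N, 16%N, 3); (11%N, 27%N, 9); (14%N, 24%N, 18);
        (14%N, 27%N, 9); (15%N, 27%N, 9); (21%N, 25%N, 6)])
      (VolLeaf 18 [:: (0%N, 14%N, 6); (0%N, 15%N, 12); (1%N, 14%N, 3); (1%N, 23%N, 1); (5%N, 17%N,
        9); (5%N, 24%N, 3); (7%N, 24%N, 3); (8%N, 16%N, 3); (13%N, 27%N, 9); (14%N, 24%N, 6); (21%N,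
        26%N, 3)]))))
      (VolNode [:: 0; 0; 0; 0; 0; -2; 2]
      (VolNode [:: 0; 0; 0; 0; -2; 2; 0]
      (VolNode [:: 0; 0; 0; 2; 0; -2; 0]
      (VolLeaf 18 [:: (0%N, 13%N, 12); (0%N, 15%N, 6); (1%N, 15%N, 3); (1%N, 23%N, 1); (3%N, 17%N,
        9); (5%N, 27%N, 3); (9%N, 16%N, 3); (9%N, 27%N, 3); (12%N, 25%N, 9); (15%N, 27%N, 6); (19%N,
        26%N, 3)])
      (VolLeaf 36 [:: (0%N, 12%N, 12); (0%N, 13%N, 6); (0%N, 15%N, 18); (1%N, 12%N, 6); (1%N, 23%N,
        2); (3%N, 17%N, 18); (4%N, 25%N, 6); (6%N, 16%N, 6); (6%N, 25%N, 6); (6%N, 27%N, 9); (12%N,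
        25%N, 12); (12%N, 27%N, 9); (13%N, 27%N, 9); (16%N, 27%N, 3); (19%N, 24%N, 6)]))
      (VolNode [:: 0; 0; 0; 0; 2; 0; -2]
      (VolLeaf 36 [:: (0%N, 12%N, 18); (0%N, 14%N, 6); (0%N, 15%N, 12); (1%N, 15%N, 6); (1%N, 23%N,
        2); (4%N, 17%N, 18); (5%N, 24%N, 6); (9%N, 16%N, 3); (11%N, 16%N, 3); (11%N, 24%N, 6);
        (11%N, 27%N, 9); (14%N, 27%N, 15); (15%N, 24%N, 12); (15%N, 27%N, 3); (20%N, 25%N, 6)])
      (VolLeaf 18 [:: (0%N, 12%N, 6); (0%N, 14%N, 12); (1%N, 12%N, 3); (1%N, 23%N, 1); (4%N, 17%N,
        9); (4%N, 27%N, 3); (6%N, 27%N, 3); (9%N, 16%N, 3); (12%N, 27%N, 6); (15%N, 24%N, 9); (20%N,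
        26%N, 3)])))
      (VolNode [:: 0; 0; 0; 0; -2; 0; 2]
      (VolNode [:: 0; 0; 0; 2; 0; 0; -2]
      (VolLeaf 18 [:: (0%N, 12%N, 12); (0%N, 15%N, 6); (1%N, 15%N, 3); (1%N, 23%N, 1); (3%N, 17%N,
        9); (5%N, 27%N, 3); (9%N, 27%N, 3); (10%N, 16%N, 3); (13%N, 25%N, 9); (15%N, 27%N, 6);
        (19%N, 26%N, 3)])
      (VolLeaf 18 [:: (0%N, 15%N, 18); (1%N, 13%N, 3); (1%N, 23%N, 1); (1%N, 25%N, 3); (1%N, 27%N,
        3); (3%N, 17%N, 9); (6%N, 16%N, 3); (12%N, 27%N, 9); (13%N, 25%N, 9); (13%N, 27%N, 9);
        (19%N, 24%N, 3)]))
      (VolNode [:: 0; 0; 0; 0; 2; -2; 0]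
      (VolLeaf 36 [:: (0%N, 13%N, 18); (0%N, 14%N, 6); (0%N, 15%N, 12); (1%N, 15%N, 6); (1%N, 23%N,
        2); (3%N, 24%N, 6); (5%N, 17%N, 18); (5%N, 27%N, 9); (10%N, 24%N, 6); (11%N, 16%N, 6);
        (14%N, 27%N, 3); (15%N, 24%N, 12); (15%N, 27%N, 15); (20%N, 27%N, 3); (21%N, 25%N, 6)])
      (VolLeaf 18 [:: (0%N, 14%N, 12); (0%N, 15%N, 6); (1%N, 15%N, 3); (1%N, 23%N, 1); (4%N, 24%N,
        3); (5%N, 17%N, 9); (10%N, 16%N, 3); (10%N, 24%N, 3); (13%N, 27%N, 9); (15%N, 24%N, 6);
        (21%N, 26%N, 3)]))))))
  [:: 0; -1; 1; 0; 0; 0; 0]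
  (Bases
    [:: [:: 0; 1; 0; 0; 0; 0; 0]; [:: 1; 1; 1; 1; 0; 0; 0]; [:: 1; 1; 1; 0; 1; 0; 0]; [:: 1; 1; 1;
      0; 0; 1; 0]; [:: 1; 1; 1; 0; 0; 0; 1]; [:: 2; 1; 1; 1; 1; 1; 1]; [:: -3; -1; -3; -1; -1; -1;
      -1]]
    [:: [:: -6; 2; 2; 2; 2; 1; 3]; [:: 1; 0; 0; 0; 0; 0; 0]; [:: 3; -1; -1; -1; -1; -1; -2]; [:: 2;
      0; -1; -1; -1; 0; -1]; [:: 2; -1; 0; -1; -1; 0; -1]; [:: 2; -1; -1; 0; -1; 0; -1]; [:: 2; -1;
      -1; -1; 0; 0; -1]]
    [:: [:: 9; 4; 8; 3; 3; 3; 3]; [:: 0; 1; -1; 0; 0; 0; 0]; [:: 0; 3; 0; 0; 0; 0; 0]; [:: -6; -3;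
      -3; -3; -3; -3; -3]; [:: 3; 3; 3; 3; 0; 0; 0]; [:: 3; 3; 3; 0; 3; 0; 0]; [:: 3; 3; 3; 0; 0; 3;
      0]]
    [:: [:: 1; 1; 0; 1; 0; 0; 0]; [:: 0; 0; 1; 0; 0; 0; 0]; [:: 0; -1; 0; 0; 0; 0; 0]; [:: -1; 0; 0;
      -1; 1; 0; 0]; [:: -1; 0; 0; -1; 0; 1; 0]; [:: -1; 0; 0; -1; 0; 0; 1]; [:: 1; -1; 0; 0; -1; -1;
      -1]]
    [:: [:: 1; -1; 1; 1; 0; 0; 0]; [:: 0; 0; -1; 0; 0; 0; 0]; [:: 0; 0; 0; 0; 0; 0; 0]; [:: 1; -1;
      0; 1; -1; 0; 0]; [:: 1; -1; 0; 1; 0; -1; 0]; [:: 1; -1; 0; 1; 0; 0; -1]; [:: -1; 1; 1; 0; 1;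
      1; 1]]).

Definition vinberg2_1 : vinberg_data := VinbergData
  [:: 8; -7; 2; 3; 2] 2 4 4
  [:: [:: 1; 1; 0; 0; 0]; [:: 0; 0; 1; 0; 0]; [:: 0; 0; -1; 1; 0]; [:: 0; 0; 0; 0; 1]; [:: -1; 0; 0;
    0; -1]; [:: -1; 0; -1; -1; 0]]
  (VolLeaf 6 [:: (0%N, 1%N, 24); (0%N, 2%N, 12); (0%N, 5%N, 12); (1%N, 2%N, 12); (1%N, 3%N, 12);
    (1%N, 4%N, 12); (1%N, 5%N, 24); (2%N, 2%N, 5); (2%N, 5%N, 18); (3%N, 4%N, 6); (4%N, 4%N, 3);
    (5%N, 5%N, 9)])
  [:: 0; 0; -1; 1; 0]
  (Bases
    [:: [:: 1; 0; 0; 0; 0]; [:: 0; 1; 0; 0; 0]; [:: 0; 0; 1; 0; 0]; [:: 0; -1; 1; 1; 0]; [:: 1; 0;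
      0; 0; 1]]
    [:: [:: 1; 0; 0; 0; 0]; [:: 0; 1; 0; 0; 0]; [:: 0; 0; 1; 0; 0]; [:: 0; 1; -1; 1; 0]; [:: -1; 0;
      0; 0; 1]]
    [:: [:: 0; 0; 1; -1; 0]; [:: 0; 0; 2; 1; 0]; [:: 3; 0; 1; 2; 0]; [:: 0; 3; -1; -2; 0]; [:: 3;
      -3; 1; 2; 3]]
    [:: [:: 0; 0; 0; 0; 0]; [:: 0; 0; 0; 0; 0]; [:: 1; 1; 0; 0; 0]; [:: -1; 0; 0; 0; 0]; [:: -1; 1;
      -1; 1; 1]]
    [:: [:: -1; 1; 0; 1; 0]; [:: 1; -1; 1; 0; 0]; [:: -1; -1; 0; 0; 0]; [:: 0; 0; 0; 0; 0]; [:: 1;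
      -1; 1; -1; -1]]).

Definition vinberg2_2 : vinberg_data := VinbergData
  [:: 10; -6; 2; 3; 2; 2] 2 4 4
  [:: [:: 1; 1; 0; 0; 0; 0]; [:: 0; 0; 1; 0; 0; 0]; [:: 0; 0; -1; 1; 0; 0]; [:: 0; 0; 0; 0; 1; 0];
    [:: 0; 0; 0; 0; 0; 1]; [:: -1; 0; 0; 0; 0; -1]; [:: -1; 0; 0; 0; -1; 0]; [:: -1; 0; -1; -1; 0;
    0]]
  (VolLeaf 6 [:: (0%N, 1%N, 24); (0%N, 2%N, 12); (0%N, 7%N, 12); (1%N, 2%N, 6); (1%N, 3%N, 6); (1%N,
    6%N, 6); (1%N, 7%N, 18); (2%N, 2%N, 2); (2%N, 7%N, 12); (3%N, 6%N, 6); (4%N, 5%N, 6); (5%N, 5%N,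
    3); (6%N, 6%N, 3); (7%N, 7%N, 6)])
  [:: 0; 0; -1; 1; 0; 0]
  (Bases
    [:: [:: 1; 0; 0; 0; 0; 0]; [:: 0; 1; 0; 0; 0; 0]; [:: 0; 0; 1; 0; 0; 0]; [:: 1; 0; 1; 1; 0; 0];
      [:: 1; 0; 0; 0; 1; 0]; [:: 1; 0; 0; 0; 0; 1]]
    [:: [:: 1; 0; 0; 0; 0; 0]; [:: 0; 1; 0; 0; 0; 0]; [:: 0; 0; 1; 0; 0; 0]; [:: -1; 0; -1; 1; 0;
      0]; [:: -1; 0; 0; 0; 1; 0]; [:: -1; 0; 0; 0; 0; 1]]
    [:: [:: 3; 0; 0; 0; 0; 0]; [:: 0; 0; 1; -1; 0; 0]; [:: 0; 0; 2; 1; 0; 0]; [:: 0; 3; -1; -2; 0;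
      0]; [:: 3; 0; 0; 0; 3; 0]; [:: 3; 0; 0; 0; 0; 3]]
    [:: [:: 0; 0; 0; 0; 0; 0]; [:: 0; 0; 0; 0; 0; 0]; [:: 0; 1; 1; 0; 0; 0]; [:: 0; -1; 0; 0; 0; 0];
      [:: -1; 0; 0; 0; 1; 0]; [:: -1; 0; 0; 0; 0; 1]]
    [:: [:: 0; -1; 1; 1; 0; 0]; [:: 1; 0; 0; 0; 0; 0]; [:: 0; -1; -1; 0; 0; 0]; [:: 0; 0; 0; 0; 0;
      0]; [:: 1; 0; 0; 0; -1; 0]; [:: 1; 0; 0; 0; 0; -1]]).

Definition vinberg2_3 : vinberg_data := VinbergData
  [:: 13; -12; 4; 7; 5; 5; 5] 2 10 18
  [:: [:: 1; 1; 0; 0; 0; 0; 0]; [:: 0; 0; 1; 0; 0; 0; 0]; [:: 0; 0; -1; 1; 0; 0; 0]; [:: 0; 0; 0; 0;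
    1; 0; 0]; [:: 0; 0; 0; 0; 0; 1; 0]; [:: 0; 0; 0; 0; 0; 0; 1]; [:: -1; 0; 0; 0; 0; 0; -1]; [::
    -1; 0; 0; 0; 0; -1; 0]; [:: -1; 0; 0; 0; -1; 0; 0]; [:: -1; 0; -1; -1; 0; 0; 0]; [:: -6; 6; -2;
    -4; -3; -3; -3]]
  (VolLeaf 6 [:: (0%N, 1%N, 12); (0%N, 2%N, 6); (0%N, 9%N, 6); (1%N, 2%N, 2); (1%N, 9%N, 6); (2%N,
    9%N, 4); (3%N, 8%N, 3); (4%N, 7%N, 3); (5%N, 6%N, 3); (5%N, 10%N, 1); (6%N, 10%N, 1)])
  [:: 0; 0; -1; 1; 0; 0; 0]
  (Bases
    [:: [:: 1; 1; 0; 0; 0; 0; 0]; [:: 0; 0; 1; 0; 0; 0; 0]; [:: 1; 0; 1; 1; 0; 0; 0]; [:: 1; 0; 0;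
      0; 1; 0; 0]; [:: 1; 0; 0; 0; 0; 1; 0]; [:: 1; 0; 0; 0; 0; 0; 1]; [:: 1; 0; 0; 0; 0; 0; 0]]
    [:: [:: 0; 0; 0; 0; 0; 0; 1]; [:: 1; 0; 0; 0; 0; 0; -1]; [:: 0; 1; 0; 0; 0; 0; 0]; [:: 0; -1; 1;
      0; 0; 0; -1]; [:: 0; 0; 0; 1; 0; 0; -1]; [:: 0; 0; 0; 0; 1; 0; -1]; [:: 0; 0; 0; 0; 0; 1; -1]]
    [:: [:: 0; 0; 1; -1; 0; 0; 0]; [:: 3; 0; 1; 2; 0; 0; 0]; [:: 0; 0; -2; -1; 0; 0; 0]; [:: 0; 3;
      -1; -2; 0; 0; 0]; [:: 3; -3; 1; 2; 3; 0; 0]; [:: 3; -3; 1; 2; 0; 3; 0]; [:: 6; -6; 2; 4; 3; 3;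
      3]]
    [:: [:: 0; 0; 0; 0; 0; 0; 0]; [:: 0; 0; 0; 0; 0; 0; 0]; [:: 1; 0; -1; 0; 0; 0; 0]; [:: -1; 0; 0;
      0; 0; 0; 0]; [:: -1; -1; -1; 1; 1; 0; 0]; [:: -1; -1; -1; 1; 0; 1; 0]; [:: 0; 0; 0; 0; -1; -1;
      1]]
    [:: [:: -1; 0; -1; 1; 0; 0; 0]; [:: 1; 1; 1; 0; 0; 0; 0]; [:: -1; 0; 1; 0; 0; 0; 0]; [:: 0; 0;
      0; 0; 0; 0; 0]; [:: 1; 1; 1; -1; -1; 0; 0]; [:: 1; 1; 1; -1; 0; -1; 0]; [:: 0; 0; 0; 0; 1; 1;
      -1]]).

Definition vinberg2_4 : vinberg_data := VinbergData
  [:: 19; -18; 6; 11; 7; 7; 7; 7] 2 16 30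
  [:: [:: 1; 1; 0; 0; 0; 0; 0; 0]; [:: 0; 0; 1; 0; 0; 0; 0; 0]; [:: 0; 0; -1; 1; 0; 0; 0; 0]; [:: 0;
    0; 0; 0; 1; 0; 0; 0]; [:: 0; 0; 0; 0; 0; 1; 0; 0]; [:: 0; 0; 0; 0; 0; 0; 1; 0]; [:: 0; 0; 0; 0;
    0; 0; 0; 1]; [:: -1; 0; 0; 0; 0; 0; 0; -1]; [:: -1; 0; 0; 0; 0; 0; -1; 0]; [:: -1; 0; 0; 0; 0;
    -1; 0; 0]; [:: -1; 0; 0; 0; -1; 0; 0; 0]; [:: -1; 0; -1; -1; 0; 0; 0; 0]; [:: -2; 2; -1; -1; -1;
    -1; -1; -1]; [:: -6; 6; -2; -4; 0; -3; -3; -3]; [:: -6; 6; -2; -4; -3; 0; -3; -3]; [:: -6; 6;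
    -2; -4; -3; -3; 0; -3]; [:: -6; 6; -2; -4; -3; -3; -3; 0]]
  (VolNode [:: -2; 2; 1; 1; 2; 2; 4; 2]
      (VolNode [:: 0; 0; 2; -1; 0; 0; 0; -2]
      (VolLeaf 24 [:: (0%N, 2%N, 2); (0%N, 7%N, 18); (0%N, 8%N, 6); (0%N, 16%N, 6); (0%N, 17%N, 6);
        (1%N, 2%N, 6); (2%N, 8%N, 1); (2%N, 11%N, 16); (2%N, 16%N, 2); (2%N, 18%N, 2); (3%N, 10%N,
        6); (4%N, 9%N, 6); (6%N, 11%N, 18); (6%N, 12%N, 12); (8%N, 15%N, 3); (8%N, 16%N, 2); (8%N,
        17%N, 3); (9%N, 14%N, 2); (10%N, 13%N, 2); (11%N, 16%N, 4); (11%N, 18%N, 24); (16%N, 17%N,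
        2); (16%N, 18%N, 4)])
      (VolNode [:: -2; 2; 1; 1; 4; 2; 2; 2]
      (VolNode [:: 0; 1; 1; 1; 0; 2; 0; 0]
      (VolNode [:: 0; 1; 0; 0; 2; 0; 0; 2]
      (VolNode [:: -2; 1; 0; 0; 2; 2; 2; 2]
      (VolLeaf 6 [:: (0%N, 7%N, 6); (0%N, 16%N, 2); (1%N, 2%N, 2); (2%N, 12%N, 1); (7%N, 16%N, 1);
        (8%N, 15%N, 1); (9%N, 11%N, 3); (9%N, 14%N, 1); (10%N, 13%N, 1); (11%N, 20%N, 3); (12%N,
        22%N, 3)])
      (VolNode [:: -2; 1; 1; 1; 2; 0; 2; 2]
      (VolLeaf 12 [:: (0%N, 7%N, 6); (0%N, 14%N, 2); (0%N, 16%N, 2); (0%N, 22%N, 6); (0%N, 23%N, 6);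
        (1%N, 2%N, 4); (2%N, 11%N, 2); (7%N, 16%N, 2); (8%N, 15%N, 2); (10%N, 13%N, 2); (11%N, 14%N,
        1); (11%N, 15%N, 1); (11%N, 21%N, 3); (11%N, 22%N, 9); (12%N, 20%N, 6); (14%N, 23%N, 2)])
      (VolLeaf 12 [:: (0%N, 8%N, 6); (0%N, 9%N, 2); (0%N, 14%N, 2); (1%N, 2%N, 4); (2%N, 11%N, 1);
        (2%N, 23%N, 1); (6%N, 9%N, 2); (7%N, 16%N, 2); (8%N, 11%N, 1); (8%N, 15%N, 1); (9%N, 19%N,
        2); (9%N, 20%N, 2); (9%N, 23%N, 6); (10%N, 11%N, 5); (10%N, 13%N, 2); (11%N, 19%N, 5);
        (11%N, 22%N, 6); (15%N, 21%N, 1); (17%N, 22%N, 2); (17%N, 23%N, 1)])))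
      (VolLeaf 36 [:: (0%N, 2%N, 6); (0%N, 7%N, 18); (0%N, 10%N, 18); (0%N, 16%N, 6); (0%N, 19%N,
        18); (1%N, 2%N, 12); (2%N, 8%N, 3); (2%N, 11%N, 6); (2%N, 16%N, 1); (2%N, 21%N, 3); (6%N,
        13%N, 3); (8%N, 15%N, 3); (8%N, 17%N, 9); (9%N, 11%N, 36); (9%N, 20%N, 18); (10%N, 13%N, 3);
        (11%N, 20%N, 18); (13%N, 16%N, 1); (16%N, 19%N, 3); (16%N, 21%N, 6); (19%N, 21%N, 9)]))
      (VolLeaf 648 [:: (0%N, 2%N, 6); (0%N, 7%N, 366); (0%N, 10%N, 330); (0%N, 14%N, 36); (0%N,
        16%N, 114); (0%N, 17%N, 24); (0%N, 19%N, 402); (0%N, 20%N, 180); (1%N, 2%N, 168); (1%N, 7%N,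
        144); (1%N, 11%N, 468); (1%N, 14%N, 84); (2%N, 8%N, 7); (2%N, 11%N, 162); (2%N, 14%N, 66);
        (2%N, 20%N, 42); (4%N, 9%N, 162); (6%N, 7%N, 312); (7%N, 11%N, 126); (7%N, 20%N, 48); (8%N,
        13%N, 16); (8%N, 14%N, 18); (8%N, 15%N, 45); (8%N, 17%N, 201); (8%N, 20%N, 228); (9%N, 14%N,
        42); (10%N, 11%N, 54); (10%N, 13%N, 64); (10%N, 16%N, 8); (10%N, 19%N, 168); (11%N, 12%N,
        198); (12%N, 17%N, 12); (17%N, 20%N, 150)]))
      (VolLeaf 264 [:: (0%N, 2%N, 54); (0%N, 7%N, 174); (0%N, 8%N, 60); (0%N, 9%N, 60); (0%N, 10%N,
        42); (0%N, 11%N, 144); (0%N, 16%N, 54); (1%N, 2%N, 105); (1%N, 11%N, 120); (1%N, 13%N, 17);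
        (1%N, 19%N, 3); (2%N, 8%N, 17); (2%N, 11%N, 104); (3%N, 18%N, 18); (3%N, 19%N, 69); (4%N,
        9%N, 102); (6%N, 13%N, 2); (7%N, 8%N, 36); (7%N, 9%N, 36); (7%N, 11%N, 54); (7%N, 16%N, 26);
        (7%N, 18%N, 48); (7%N, 19%N, 6); (8%N, 9%N, 60); (8%N, 11%N, 102); (8%N, 13%N, 11); (8%N,
        15%N, 34); (9%N, 11%N, 102); (9%N, 19%N, 51); (10%N, 11%N, 42); (10%N, 13%N, 14); (11%N,
        19%N, 36); (13%N, 17%N, 28); (16%N, 19%N, 1)])))
      (VolLeaf 432 [:: (0%N, 1%N, 64); (0%N, 3%N, 376); (0%N, 7%N, 54); (0%N, 8%N, 24); (0%N, 9%N,
        42); (0%N, 10%N, 460); (0%N, 11%N, 32); (1%N, 2%N, 140); (1%N, 5%N, 24); (1%N, 7%N, 54);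
        (1%N, 9%N, 42); (1%N, 10%N, 60); (1%N, 11%N, 432); (2%N, 11%N, 270); (2%N, 15%N, 2); (2%N,
        17%N, 10); (3%N, 10%N, 174); (3%N, 15%N, 14); (4%N, 9%N, 171); (4%N, 15%N, 13); (4%N, 17%N,
        6); (5%N, 17%N, 108); (6%N, 7%N, 189); (6%N, 15%N, 11); (7%N, 9%N, 48); (7%N, 10%N, 69);
        (7%N, 11%N, 54); (7%N, 17%N, 6); (8%N, 10%N, 12); (8%N, 15%N, 32); (9%N, 10%N, 63); (9%N,
        11%N, 42); (9%N, 14%N, 8); (10%N, 11%N, 72)]))
  [:: 0; 0; -1; 1; 0; 0; 0; 0]
  (Bases
    [:: [:: 1; 1; 0; 0; 0; 0; 0; 0]; [:: 0; 0; 1; 0; 0; 0; 0; 0]; [:: 1; 0; 1; 1; 0; 0; 0; 0]; [::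
      1; 0; 0; 0; 1; 0; 0; 0]; [:: 1; 0; 0; 0; 0; 1; 0; 0]; [:: 1; 0; 0; 0; 0; 0; 1; 0]; [:: 2; -2;
      1; 1; 1; 1; 1; 1]; [:: 1; 0; 0; 0; 0; 0; 0; 1]]
    [:: [:: -2; 0; 1; 1; 1; 1; -1; 1]; [:: 3; 0; -1; -1; -1; -1; 1; -1]; [:: 0; 1; 0; 0; 0; 0; 0;
      0]; [:: 2; -1; 0; -1; -1; -1; 1; -1]; [:: 2; 0; -1; 0; -1; -1; 1; -1]; [:: 2; 0; -1; -1; 0;
      -1; 1; -1]; [:: 2; 0; -1; -1; -1; 0; 1; -1]; [:: 2; 0; -1; -1; -1; -1; 1; 0]]
    [:: [:: 0; 0; 1; -1; 0; 0; 0; 0]; [:: 3; 0; 1; 2; 0; 0; 0; 0]; [:: 0; 3; -1; -2; 0; 0; 0; 0];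
      [:: 0; 0; -2; -1; 0; 0; 0; 0]; [:: 6; -6; 1; 2; 3; 3; 3; 3]; [:: 3; 0; 0; 0; 3; 0; 0; 0]; [::
      3; 0; 0; 0; 0; 3; 0; 0]; [:: 3; 0; 0; 0; 0; 0; 3; 0]]
    [:: [:: 0; 0; 0; 0; 0; 0; 0; 0]; [:: 0; 0; 0; 0; 0; 0; 0; 0]; [:: 1; 0; 0; -1; 0; 0; 0; 0]; [::
      -1; 0; 0; 0; 0; 0; 0; 0]; [:: -1; -1; 0; -1; 0; 1; 0; 0]; [:: -1; -1; 0; -1; 0; 0; 1; 0]; [::
      -1; -1; 0; -1; 0; 0; 0; 1]; [:: 0; 1; 0; 0; 1; -1; -1; -1]]
    [:: [:: -1; 0; 1; -1; 0; 0; 0; 0]; [:: 1; 1; 0; 1; 0; 0; 0; 0]; [:: -1; 0; 0; 1; 0; 0; 0; 0];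
      [:: 0; 0; 0; 0; 0; 0; 0; 0]; [:: 1; 1; 0; 1; 0; -1; 0; 0]; [:: 1; 1; 0; 1; 0; 0; -1; 0]; [::
      1; 1; 0; 1; 0; 0; 0; -1]; [:: 0; -1; 1; 0; -1; 1; 1; 1]]).

Definition vinberg3_1 : vinberg_data := VinbergData
  [:: 22; -21; 7; 13; 20; 13; 13; 13; 10] 2 22 42
  [:: [:: 1; 1; 0; 0; 0; 0; 0; 0; 0]; [:: 0; 0; 1; 0; 0; 0; 0; 0; 0]; [:: 0; 0; -1; 1; 0; 0; 0; 0;
    0]; [:: 0; 0; 0; 0; 1; 0; 0; 0; 0]; [:: 0; 0; 0; 0; 0; 1; 0; 0; 0]; [:: 0; 0; 0; 0; 0; 0; 1; 0;
    0]; [:: 0; 0; 0; 0; 0; 0; 0; 1; 0]; [:: 0; 0; 0; 0; 0; 0; 0; 0; 1]; [:: -1; 0; 0; 0; 0; 0; 0; 0;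
    -1]; [:: -1; 0; 0; 0; -2; -1; -1; -1; 0]; [:: -1; 0; -1; -1; 0; 0; 0; 0; 0]; [:: -6; 6; -2; -4;
    -6; -3; -3; -6; -3]; [:: -6; 6; -2; -4; -6; -3; -6; -3; -3]; [:: -6; 6; -2; -4; -6; -6; -3; -3;
    -3]]
  (VolLeaf 6 [:: (0%N, 7%N, 6); (0%N, 8%N, 6); (0%N, 9%N, 6); (1%N, 2%N, 2); (1%N, 9%N, 12); (1%N,
    10%N, 6); (2%N, 9%N, 5); (2%N, 10%N, 4); (3%N, 4%N, 6); (3%N, 13%N, 2); (4%N, 13%N, 1); (5%N,
    12%N, 1); (6%N, 11%N, 1); (7%N, 8%N, 3); (8%N, 9%N, 3); (9%N, 10%N, 9)])
  [:: 0; 0; -1; 1; 0; 0; 0; 0; 0]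
  (Bases
    [:: [:: 1; 1; 0; 0; 0; 0; 0; 0; 0]; [:: 0; 0; 1; 0; 0; 0; 0; 0; 0]; [:: 1; 0; 1; 1; 0; 0; 0; 0;
      0]; [:: 1; 0; 0; 0; 2; 1; 1; 1; 0]; [:: 2; -1; 1; 1; 2; 1; 1; 1; 1]; [:: -2; 1; -1; -1; -1;
      -1; -1; -1; -1]; [:: -1; 0; 0; 0; -1; 0; -1; -1; 0]; [:: -1; 0; 0; 0; -1; -1; 0; -1; 0]; [::
      1; 0; 0; 0; 1; 1; 1; 0; 0]]
    [:: [:: 0; 0; 0; -2; 1; 1; -1; -1; 1]; [:: 1; 0; 0; 2; -1; -1; 1; 1; -1]; [:: 0; 1; 0; 0; 0; 0;
      0; 0; 0]; [:: 0; -1; 1; 2; -1; -1; 1; 1; -1]; [:: 0; 0; 0; 0; 1; 1; 0; 0; 0]; [:: 0; 0; 0; 1;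
      -1; -1; 1; 0; 0]; [:: 0; 0; 0; 1; -1; -1; 0; 1; 0]; [:: 0; 0; 0; 1; -1; -1; 0; 0; -1]; [:: 1;
      0; -1; 1; 0; -1; 1; 1; -1]]
    [:: [:: 0; 0; 1; -1; 0; 0; 0; 0; 0]; [:: 3; 0; 1; 2; 0; 0; 0; 0; 0]; [:: 0; 3; -1; -2; 0; 0; 0;
      0; 0]; [:: 0; 0; -2; -1; 0; 0; 0; 0; 0]; [:: 3; -3; 1; 2; 6; 3; 3; 3; 0]; [:: 6; -3; 1; 2; 6;
      3; 3; 3; 3]; [:: -6; 3; -1; -2; -3; -3; -3; -3; -3]; [:: -3; 0; 0; 0; -3; 0; -3; -3; 0]; [::
      -3; 0; 0; 0; -3; -3; 0; -3; 0]]
    [:: [:: 0; 0; 0; 0; 0; 0; 0; 0; 0]; [:: 0; 0; 0; 0; 0; 0; 0; 0; 0]; [:: 1; 0; 0; -1; 0; 0; 0; 0;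
      0]; [:: -1; 0; 0; 0; 0; 0; 0; 0; 0]; [:: 1; 1; 0; 1; 0; 1; 1; 0; 0]; [:: -1; -1; 0; -1; 0; -1;
      -1; 1; 0]; [:: -1; -1; 0; -1; 0; -1; -1; 0; 1]; [:: 0; 0; 0; 0; 0; 0; 0; -1; -1]; [:: -1; -1;
      0; -1; -1; 1; 0; 0; 0]]
    [:: [:: -1; 0; 1; -1; 0; 0; 0; 0; 0]; [:: 1; 1; 0; 1; 0; 0; 0; 0; 0]; [:: -1; 0; 0; 1; 0; 0; 0;
      0; 0]; [:: 0; 0; 0; 0; 0; 0; 0; 0; 0]; [:: -1; -1; 1; -1; 1; 0; 0; 0; 0]; [:: 1; 1; 1; 1; 1;
      1; 1; -1; 0]; [:: 1; 1; 1; 1; 1; 1; 1; 0; -1]; [:: -1; -1; 0; -1; 0; 0; 0; 1; 1]; [:: 1; 1; 0;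
      1; 1; -1; 0; 0; 0]]).

Definition vinberg4_0 : vinberg_data := VinbergData
  [:: 33; 11; 29; 57; 84; 110; 135; 91; 46; 68] 2 34 66
  [:: [:: 0; 1; 0; 0; 0; 0; 0; 0; 0; 0]; [:: 0; 0; 1; 0; 0; 0; 0; 0; 0; 0]; [:: 0; 0; 0; 1; 0; 0; 0;
    0; 0; 0]; [:: 0; 0; 0; 0; 1; 0; 0; 0; 0; 0]; [:: 0; 0; 0; 0; 0; 1; 0; 0; 0; 0]; [:: 0; 0; 0; 0;
    0; 0; 1; 0; 0; 0]; [:: 0; 0; 0; 0; 0; 0; 0; 1; 0; 0]; [:: 0; 0; 0; 0; 0; 0; 0; 0; 1; 0]; [:: 0;
    0; 0; 0; 0; 0; 0; 0; 0; 1]; [:: -1; 0; -2; -4; -6; -8; -10; -7; -4; -5]; [:: -3; -1; -6; -9;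
    -12; -15; -18; -12; -6; -9]; [:: -3; -2; 0; 0; 0; 0; 0; 0; 0; 0]; [:: -2; -1; -2; -4; -6; -8;
    -10; -7; -4; -5]]
  (VolLeaf 30 [:: (0%N, 12%N, 5); (1%N, 2%N, 30); (1%N, 3%N, 60); (1%N, 4%N, 90); (1%N, 8%N, 6);
    (1%N, 10%N, 10); (2%N, 3%N, 30); (2%N, 4%N, 60); (2%N, 8%N, 12); (2%N, 10%N, 20); (3%N, 4%N,
    30); (3%N, 8%N, 18); (3%N, 10%N, 30); (4%N, 8%N, 24); (4%N, 10%N, 40); (5%N, 6%N, 30); (5%N,
    7%N, 60); (5%N, 8%N, 30); (5%N, 9%N, 60); (5%N, 11%N, 10); (5%N, 12%N, 30); (6%N, 7%N, 30);
    (6%N, 8%N, 36); (6%N, 9%N, 45); (6%N, 11%N, 10); (6%N, 12%N, 15); (7%N, 8%N, 42); (7%N, 9%N,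
    30); (7%N, 11%N, 10); (8%N, 9%N, 27); (8%N, 11%N, 2); (8%N, 12%N, 21); (9%N, 11%N, 5)])
  [:: 0; 1; 0; 0; 0; 0; 0; 0; 0; 0]
  (Bases
    [:: [:: 0; 0; 1; 0; 0; 0; 0; 0; 0; 0]; [:: 0; 0; 0; 1; 0; 0; 0; 0; 0; 0]; [:: 0; 0; 0; 1; 1; 0;
      0; 0; 0; 0]; [:: 0; 0; 0; 1; 1; 1; 0; 0; 0; 0]; [:: 0; 0; 0; 1; 1; 1; 1; 0; 0; 0]; [:: 0; 0;
      0; 1; 1; 2; 2; 2; 1; 1]; [:: 0; 0; 0; -1; -1; -2; -2; -1; -1; -1]; [:: 0; 0; 0; -1; -1; -2;
      -2; -1; 0; -1]; [:: 1; 0; 2; 3; 5; 7; 8; 6; 3; 4]; [:: 2; 1; 2; 3; 5; 7; 8; 6; 3; 4]]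
    [:: [:: -2; 2; -2; 1; 0; -2; 1; 1; 1; 0]; [:: 2; -2; 2; -1; 0; 2; -1; -1; -2; 1]; [:: 1; 0; 0;
      0; 0; 0; 0; 0; 0; 0]; [:: 0; 1; 0; 0; 0; 0; 0; 0; 0; 0]; [:: 0; -1; 1; 0; 0; 0; 0; 0; 0; 0];
      [:: 0; 0; -1; 1; 0; 0; 0; 0; 0; 0]; [:: 0; 0; 0; -1; 1; 0; 0; 0; 0; 0]; [:: 0; 0; 0; 0; 0; 1;
      1; 0; 0; 0]; [:: 0; 0; 0; 0; 0; 0; -1; 1; 0; 0]; [:: 0; 0; 1; 0; -2; -1; -1; -1; 0; 0]]
    [:: [:: -3; -1; -6; -9; -12; -15; -18; -12; -6; -9]; [:: -3; -1; -3; -9; -12; -15; -18; -12; -6;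
      -9]; [:: -3; -1; -3; -6; -12; -15; -18; -12; -6; -9]; [:: -3; -1; -3; -6; -9; -15; -18; -12;
      -6; -9]; [:: 0; 1; 0; 0; 0; 0; 0; 0; 0; 0]; [:: 0; 0; 3; 3; 3; 6; 9; 6; 3; 3]; [:: 0; 0; 0;
      -3; -6; -9; -9; -6; -3; -6]; [:: -3; -1; -3; -6; -9; -12; -18; -12; -6; -9]; [:: -3; -1; -3;
      -6; -9; -12; -15; -12; -6; -6]; [:: -3; -1; -3; -6; -6; -9; -12; -9; -6; -6]]
    [:: [:: 0; 0; 0; -1; -1; -1; 1; 0; 0; 0]; [:: 0; 0; 0; 0; 1; 0; 0; 0; 0; 0]; [:: 0; 0; 0; -1; 0;
      -1; 1; 0; 0; 0]; [:: 0; 0; 0; 1; 0; 1; -1; 0; 0; 0]; [:: 0; 0; 0; 0; 0; 0; 0; 0; 0; 0]; [:: 0;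
      0; 0; 0; 0; -1; 1; 0; 0; 0]; [:: 0; 0; 0; -1; 0; 1; -1; 0; 0; 0]; [:: 0; 0; 0; 0; 0; -1; 1; 0;
      0; 0]; [:: 0; 0; 0; 1; 0; 1; -1; 0; 0; 0]; [:: 0; 0; 0; 1; 0; 0; 0; 0; 0; 0]]
    [:: [:: 0; 0; 0; -1; -1; -1; 1; 0; 0; 0]; [:: 0; 0; 0; 0; 0; 0; 0; 0; 0; 0]; [:: -1; 0; 0; 1; 0;
      1; -1; 0; 0; 0]; [:: -1; -1; 0; -1; 0; -1; 1; 0; 0; 0]; [:: -1; -1; -1; 0; 0; 0; 0; 0; 0; 0];
      [:: -1; -1; -1; 0; 0; 1; -1; 0; 0; 0]; [:: -1; -1; -1; 1; 0; -1; 1; -1; 0; 0]; [:: -1; 0; 0;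
      0; 0; 0; -1; -1; -1; 0]; [:: 0; 0; -1; -1; 0; -1; 1; 0; 0; -1]; [:: -1; 0; 0; -1; 0; -1; 0;
      -1; 0; 0]]).

Definition vinberg5_0 : vinberg_data := VinbergData
  [:: 45; 18; 35; 36; 71; 105; 138; 170; 115; 59; 86] 2 31 60
  [:: [:: 0; 1; 0; 0; 0; 0; 0; 0; 0; 0; 0]; [:: 0; -1; 1; 0; 0; 0; 0; 0; 0; 0; 0]; [:: 0; 0; 0; 1;
    0; 0; 0; 0; 0; 0; 0]; [:: 0; 0; 0; 0; 1; 0; 0; 0; 0; 0; 0]; [:: 0; 0; 0; 0; 0; 1; 0; 0; 0; 0;
    0]; [:: 0; 0; 0; 0; 0; 0; 1; 0; 0; 0; 0]; [:: 0; 0; 0; 0; 0; 0; 0; 1; 0; 0; 0]; [:: 0; 0; 0; 0;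
    0; 0; 0; 0; 1; 0; 0]; [:: 0; 0; 0; 0; 0; 0; 0; 0; 0; 1; 0]; [:: 0; 0; 0; 0; 0; 0; 0; 0; 0; 0;
    1]; [:: -1; 0; 0; -2; -4; -6; -8; -10; -7; -4; -5]; [:: -1; -1; -1; -2; -3; -4; -5; -6; -4; -2;
    -3]; [:: -3; -2; -4; 0; 0; 0; 0; 0; 0; 0; 0]]
  (VolLeaf 42 [:: (0%N, 1%N, 14); (0%N, 2%N, 84); (0%N, 3%N, 126); (0%N, 4%N, 168); (0%N, 5%N, 210);
    (0%N, 9%N, 6); (0%N, 11%N, 42); (1%N, 2%N, 42); (1%N, 3%N, 56); (1%N, 4%N, 70); (1%N, 5%N, 84);
    (1%N, 11%N, 28); (2%N, 3%N, 42); (2%N, 4%N, 84); (2%N, 5%N, 126); (2%N, 9%N, 18); (2%N, 11%N,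
    42); (3%N, 4%N, 42); (3%N, 5%N, 84); (3%N, 9%N, 24); (3%N, 11%N, 84); (4%N, 5%N, 42); (4%N, 9%N,
    30); (4%N, 11%N, 126); (5%N, 9%N, 36); (5%N, 11%N, 168); (6%N, 7%N, 42); (6%N, 8%N, 84); (6%N,
    9%N, 42); (6%N, 10%N, 126); (6%N, 12%N, 28); (7%N, 8%N, 42); (7%N, 9%N, 48); (7%N, 10%N, 84);
    (7%N, 12%N, 21); (8%N, 9%N, 54); (8%N, 10%N, 42); (8%N, 12%N, 14); (9%N, 10%N, 60); (9%N, 11%N,
    12); (9%N, 12%N, 11); (10%N, 12%N, 7)])
  [:: 0; -1; 1; 0; 0; 0; 0; 0; 0; 0; 0]
  (Bases
    [:: [:: 0; 1; 0; 0; 0; 0; 0; 0; 0; 0; 0]; [:: 1; 1; 1; 0; 0; 0; 0; 0; 0; 0; 0]; [:: 0; 0; 0; 1;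
      0; 0; 0; 0; 0; 0; 0]; [:: 0; 0; 0; 1; 1; 0; 0; 0; 0; 0; 0]; [:: 0; 0; 0; 1; 1; 1; 0; 0; 0; 0;
      0]; [:: 1; 1; 1; 1; 1; 2; 2; 3; 2; 1; 1]; [:: 1; 1; 1; 1; 1; 2; 3; 3; 2; 1; 1]; [:: -1; -1;
      -1; -1; -1; -2; -2; -2; -2; -1; -1]; [:: 0; 0; 0; -1; -1; -2; -2; -2; -1; -1; -1]; [:: -1; -1;
      -1; -2; -3; -4; -5; -6; -4; -2; -3]; [:: 0; 0; -1; 2; 3; 4; 5; 6; 4; 2; 3]]
    [:: [:: -1; 2; 0; 0; 0; 0; 0; 0; 0; 1; 1]; [:: 1; 0; 0; 0; 0; 0; 0; 0; 0; 0; 0]; [:: 0; -1; 0;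
      0; 0; 0; 0; 0; 0; -1; -1]; [:: 0; 0; 1; 0; 0; 0; 0; 0; 0; 0; 0]; [:: 0; 0; -1; 1; 0; 0; 0; 0;
      0; 0; 0]; [:: 0; 0; 0; -1; 1; 0; 0; 0; 0; 0; 0]; [:: 0; 0; 0; 0; 0; -1; 1; 0; 0; 0; 0]; [:: 0;
      0; 0; 0; 0; 1; 0; 1; 0; 0; 0]; [:: 0; -1; 0; 0; 0; 0; 0; -1; 1; 0; 0]; [:: 0; 0; -1; 2; -2; 1;
      -1; -1; -2; 1; 0]; [:: 0; 1; 1; -1; 0; -1; -1; 0; 0; -1; 0]]
    [:: [:: 0; 1; -1; 0; 0; 0; 0; 0; 0; 0; 0]; [:: 0; 2; 1; 0; 0; 0; 0; 0; 0; 0; 0]; [:: 3; 2; 4; 0;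
      0; 0; 0; 0; 0; 0; 0]; [:: -3; -1; -2; -6; -9; -12; -15; -18; -12; -6; -9]; [:: -3; -1; -2; -3;
      -9; -12; -15; -18; -12; -6; -9]; [:: -3; -1; -2; -3; -6; -12; -15; -18; -12; -6; -9]; [:: -3;
      -1; -2; -3; -6; -9; -15; -18; -12; -6; -9]; [:: -3; -3; -3; -3; -3; -6; -9; -9; -6; -3; -6];
      [:: 3; 3; 3; 3; 6; 6; 9; 9; 6; 3; 3]; [:: 3; 3; 3; 3; 3; 6; 9; 12; 6; 3; 6]; [:: -3; -1; -2;
      0; -3; -6; -9; -12; -9; -6; -6]]
    [:: [:: 0; 0; 1; 0; 0; 0; 0; 0; 0; 0; 0]; [:: 1; 1; 0; 0; 0; 0; 0; 0; 0; 0; 0]; [:: -1; 0; 0; 0;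
      0; 0; 0; 0; 0; 0; 0]; [:: 1; -1; 1; 0; 0; 0; 0; 0; 0; 0; 0]; [:: -1; 1; -1; 0; 0; 0; 0; 0; 0;
      0; 0]; [:: 0; 0; 0; 0; 0; 0; 0; 0; 0; 0; 0]; [:: 0; -1; 0; 1; 0; 0; 1; 0; 0; 0; 0]; [:: 1; 0;
      1; -1; 0; 0; -1; 0; 0; 0; 0]; [:: 0; 1; 0; -1; 0; 0; -1; 0; 0; 0; 0]; [:: -1; 0; -1; 1; 0; 0;
      1; 0; 0; 0; 0]; [:: -1; 0; -1; 1; 0; 0; 1; 0; 0; 0; 0]]
    [:: [:: -1; 1; 1; 0; 0; 0; 0; 0; 0; 0; 0]; [:: -1; -1; 0; 0; 0; 0; 0; 0; 0; 0; 0]; [:: 0; 0; 0;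
      0; 0; 0; 0; 0; 0; 0; 0]; [:: -1; 1; -1; -1; 0; 0; 0; 0; 0; 0; 0]; [:: 1; -1; 1; -1; -1; 0; 0;
      0; 0; 0; 0]; [:: 0; 0; 0; -1; -1; -1; 0; 0; 0; 0; 0]; [:: -1; 1; -1; -1; -1; -1; -1; 0; 0; 0;
      0]; [:: -1; 0; -1; 1; -1; -1; 1; 1; -1; 0; 0]; [:: 1; -1; 1; 1; 0; -1; 1; 1; -1; -1; 0]; [::
      1; -1; 1; -1; 0; 0; 0; 0; 0; 0; -1]; [:: 1; 0; 1; -1; -1; 0; -1; 0; -1; 0; 0]]).

(** * Involutions and fixed points for the first achiral lattice of each row *)

Definition symmetry0 : symmetry_data := SymmetryData
  [:: 3; 1; 1; 1] 56
  [:: [:: 3; 1; 1; 2]; [:: -3; -1; 0; -3]; [:: -1; 0; -1; -1]; [:: -2; -1; -1; -1]]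
  (Bases
    [:: [:: 1; 1; 0; 0]; [:: 0; 0; -1; 1]; [:: 1; 0; 1; 2]; [:: 0; 0; 1; 0]]
    [:: [:: 0; -2; 1; -3]; [:: 1; 2; -1; 3]; [:: 0; 0; 0; 1]; [:: 0; 1; 0; 1]]
    [:: [:: 0; -1; 3; 0]; [:: 3; 2; 3; 0]; [:: 3; 1; 3; 3]; [:: -3; -1; -3; 0]]
    [:: [:: -1; 0; 0; -1]; [:: 0; 1; 0; 1]; [:: 1; 1; 0; 1]; [:: 0; 0; 1; 1]]
    [:: [:: -1; 1; 0; 0]; [:: 0; 0; 0; 0]; [:: -1; -1; 0; -1]; [:: 0; 0; -1; -1]]).

Definition symmetry1 : symmetry_data := SymmetryData
  [:: 6; 3; 4; 2; 2; 2; 2; 2] 42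
  [:: [:: 17; 6; 12; 6; 6; 6; 6; 6]; [:: 0; 1; 0; 0; 0; 0; 0; 0]; [:: -9; -4; -7; -3; -3; -3; -3;
    -3]; [:: -6; -2; -4; -3; -2; -2; -2; -2]; [:: -6; -2; -4; -2; -3; -2; -2; -2]; [:: -6; -2; -4;
    -2; -2; -3; -2; -2]; [:: -6; -2; -4; -2; -2; -2; -3; -2]; [:: -6; -2; -4; -2; -2; -2; -2; -3]]
  (Bases
    [:: [:: -1; -1; -2; 0; 0; 0; 0; 0]; [:: 0; 0; 0; -1; 1; 0; 0; 0]; [:: 2; 1; 2; 1; 0; 1; 1; 0];
      [:: 0; 0; 0; 0; -1; 1; 0; 0]; [:: 2; 1; 2; 1; 0; 1; 0; 1]; [:: -2; -1; -2; -1; 0; 0; -1; -1];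
      [:: 1; 1; 1; 1; 0; 0; 0; 0]; [:: 3; 3; 2; 1; 1; 1; 1; 1]]
    [:: [:: 4; 10; -2; 7; -2; -5; 12; -3]; [:: -1; -2; 0; -1; 0; 1; -2; 1]; [:: -2; -4; 1; -3; 1; 2;
      -5; 1]; [:: -1; -4; 1; -3; 1; 2; -4; 1]; [:: -1; -3; 1; -3; 1; 2; -4; 1]; [:: -1; -3; 1; -2;
      1; 2; -4; 1]; [:: -1; -3; 1; -2; 0; 1; -4; 1]; [:: -1; -3; 0; -2; 1; 1; -4; 1]]
    [:: [:: 0; -1; -2; 3; 0; 0; 0; 0]; [:: 3; 2; 4; 3; 0; 0; 0; 0]; [:: 3; 1; 2; 3; 3; 0; 0; 0]; [::
      3; 1; 2; 3; 0; 3; 0; 0]; [:: 3; 1; 2; 3; 0; 0; 3; 0]; [:: 3; 1; 2; 3; 0; 0; 0; 3]; [:: 0; 1;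
      -1; 0; 0; 0; 0; 0]; [:: 9; 9; 6; 3; 3; 3; 3; 3]]
    [:: [:: -3; 0; 1; 1; 1; 1; 4; -1]; [:: 0; 1; -1; -1; -1; -1; 0; 1]; [:: 1; 0; 0; 0; 0; 0; -2;
      0]; [:: 1; 1; -1; -1; -1; -1; -2; 1]; [:: 0; 0; 0; -1; -1; -1; -2; 1]; [:: 0; 0; -1; 0; -1;
      -1; -2; 1]; [:: 0; 0; -1; -1; 0; -1; -2; 1]; [:: 0; 0; -1; -1; -1; 0; -2; 1]]
    [:: [:: -1; 1; 0; 0; 0; 0; 0; 0]; [:: 1; -1; 1; 1; 1; 1; -1; -1]; [:: 0; 0; 0; 0; 0; 0; 0; 0];
      [:: 0; -1; 1; 1; 1; 1; 1; -1]; [:: 1; 0; 0; 1; 1; 1; 1; -1]; [:: 1; 0; 1; 0; 1; 1; 1; -1]; [::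
      1; 0; 1; 1; 0; 1; 1; -1]; [:: 1; 0; 1; 1; 1; 0; 1; -1]]).

Definition symmetry2 : symmetry_data := SymmetryData
  [:: 11; -10; 3; 5; 4; 4; 4; 4; 4] 154
  [:: [:: 8; -8; 3; 5; 3; 3; 3; 3; 3]; [:: -8; 8; -2; -5; -3; -3; -3; -3; -3]; [:: 1; 1; 0; 0; 0; 0;
    0; 0; 0]; [:: -8; 7; -2; -4; -3; -3; -3; -3; -3]; [:: -6; 6; -2; -4; -3; -2; -2; -2; -2]; [::
    -6; 6; -2; -4; -2; -3; -2; -2; -2]; [:: -6; 6; -2; -4; -2; -2; -3; -2; -2]; [:: -6; 6; -2; -4;
    -2; -2; -2; -3; -2]; [:: -6; 6; -2; -4; -2; -2; -2; -2; -3]]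
  (Bases
    [:: [:: -1; -1; 1; 0; 0; 0; 0; 0; 0]; [:: 0; 0; -1; -1; 1; 0; 0; 0; 0]; [:: 0; 0; -1; -1; 0; 1;
      0; 0; 0]; [:: 2; -1; 0; 1; 0; 1; 1; 1; 0]; [:: 0; 0; -1; -1; 0; 0; 1; 0; 0]; [:: 2; -1; 0; 1;
      0; 1; 0; 1; 1]; [:: -2; 1; 0; -1; 0; -1; -1; 0; -1]; [:: 3; -1; 1; 0; 1; 1; 1; 1; 1]; [:: 1;
      1; 0; 0; 0; 0; 0; 0; 0]]
    [:: [:: -9; -4; 1; -1; -2; -3; 1; 4; -10]; [:: 9; 4; -1; 1; 2; 3; -1; -4; 11]; [:: 1; 0; 0; 0;
      0; 0; 0; 0; 1]; [:: 6; 3; -1; 1; 1; 2; -1; -3; 7]; [:: 7; 4; -1; 1; 1; 2; -1; -3; 8]; [:: 7;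
      3; 0; 1; 1; 2; -1; -3; 8]; [:: 7; 3; -1; 1; 2; 2; -1; -3; 8]; [:: 7; 3; -1; 1; 2; 3; 0; -3;
      8]; [:: 7; 3; -1; 0; 2; 3; -1; -3; 8]]
    [:: [:: 3; 0; 2; 4; 0; 0; 0; 0; 0]; [:: 3; 0; -1; 1; 3; 0; 0; 0; 0]; [:: 0; -3; 2; 1; 3; 0; 0;
      0; 0]; [:: 0; -3; 2; 1; 0; 3; 0; 0; 0]; [:: 0; -3; 2; 1; 0; 0; 3; 0; 0]; [:: 0; -3; 2; 1; 0;
      0; 0; 3; 0]; [:: 6; -6; -1; 1; 3; 3; 3; 3; 3]; [:: 9; -3; 3; 0; 3; 3; 3; 3; 3]; [:: 3; 3; 0;
      0; 0; 0; 0; 0; 0]]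
    [:: [:: 0; 2; -2; 0; 0; 0; -1; 1; -3]; [:: 0; -2; 2; 0; 0; 0; 1; -1; 4]; [:: 0; -1; 1; 0; 0; 0;
      0; 0; 1]; [:: 0; -1; 1; 0; 0; 0; 1; -1; 2]; [:: -1; -2; 1; 0; 0; 0; 1; -1; 2]; [:: -1; -2; 2;
      1; 0; 0; 1; -1; 2]; [:: -1; -2; 2; 0; 1; 0; 1; -1; 2]; [:: -1; -2; 2; 0; 0; 1; 1; -1; 2]; [::
      0; -3; 2; -1; -1; -1; 2; -1; 2]]
    [:: [:: -1; 0; 0; 0; 0; 0; 1; -1; -1]; [:: 1; 0; 0; 0; 0; 0; -1; 1; -1]; [:: 0; 1; -1; 0; 0; 0;
      0; 0; -1]; [:: 0; 0; 0; 0; 0; 0; 0; 0; 0]; [:: 1; 1; 1; 0; 0; 0; 0; 0; 1]; [:: 1; 1; -1; -1;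
      0; 0; 0; 0; 1]; [:: 1; 1; -1; 0; -1; 0; 0; 0; 1]; [:: 1; 1; -1; 0; 0; -1; 0; 0; 1]; [:: 0; 1;
      0; 1; 1; 1; -1; 0; 1]]).

Definition symmetry3 : symmetry_data := SymmetryData
  [:: 17; -15; 5; 9; 14; 9; 9; 9; 7; 7] 490
  [:: [:: 7; -6; 2; 4; 6; 4; 4; 4; 3; 3]; [:: -6; 7; -2; -4; -6; -4; -4; -4; -3; -3]; [:: 0; 0; 0;
    0; 1; 0; 0; 0; 0; 0]; [:: -6; 6; -2; -4; -5; -3; -3; -3; -3; -3]; [:: 0; 0; 1; 0; 0; 0; 0; 0; 0;
    0]; [:: -2; 2; -1; -1; -2; -2; -1; -1; -1; -1]; [:: -2; 2; -1; -1; -2; -1; -2; -1; -1; -1]; [::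
    -2; 2; -1; -1; -2; -1; -1; -2; -1; -1]; [:: -6; 6; -2; -4; -6; -4; -4; -4; -3; -2]; [:: -6; 6;
    -2; -4; -6; -4; -4; -4; -2; -3]]
  (Bases
    [:: [:: 0; 0; -1; 0; 1; 0; 0; 0; 0; 0]; [:: 1; 0; 1; 1; 1; 0; 0; 0; 0; 0]; [:: 0; 0; 0; -1; 1;
      1; 1; 1; 0; 0]; [:: 1; -1; 1; 1; 2; 2; 1; 1; 0; 0]; [:: 1; 0; 1; 0; 0; 0; 0; 0; 1; 0]; [:: 1;
      -1; 1; 1; 2; 1; 2; 1; 0; 0]; [:: 1; 0; 1; 0; 0; 0; 0; 0; 0; 1]; [:: -2; 2; 0; -1; -3; -2; -1;
      -2; -1; -1]; [:: 2; 1; 0; 1; 0; 0; 0; 0; 0; 0]; [:: 0; 0; 1; 0; 0; 0; 0; 0; 0; 0]]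
    [:: [:: -6; 8; 3; 0; 1; -1; 1; 1; -3; -15]; [:: 7; -9; -3; 0; -1; 1; -1; -1; 4; 17]; [:: 0; 0;
      0; 0; 0; 0; 0; 0; 0; 1]; [:: 5; -7; -3; 0; -1; 1; -1; -1; 3; 13]; [:: 1; 0; 0; 0; 0; 0; 0; 0;
      0; 1]; [:: 2; -3; -1; 1; 0; 0; 0; 0; 1; 4]; [:: 2; -3; -1; 0; 0; 1; 0; 0; 1; 4]; [:: 0; -1; 0;
      -1; -1; 0; -1; -1; 1; 4]; [:: 6; -8; -3; 0; 0; 1; -1; -1; 3; 14]; [:: 6; -8; -3; 0; -1; 1; 0;
      -1; 3; 14]]
    [:: [:: 0; 0; 1; -1; 0; 3; 0; 0; 0; 0]; [:: 0; 0; -2; -1; 3; 3; 0; 0; 0; 0]; [:: 0; 0; -2; -1;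
      3; 0; 3; 0; 0; 0]; [:: 0; 0; -2; -1; 3; 0; 0; 3; 0; 0]; [:: 3; -3; 1; 2; 3; 0; 3; 3; 3; 0];
      [:: 3; -3; 1; 2; 3; 0; 3; 3; 0; 3]; [:: 0; -3; -1; 1; 3; 3; 3; 3; 0; 0]; [:: -3; 3; -2; -4;
      -6; -3; -3; -3; 0; 0]; [:: 6; 3; 0; 3; 0; 0; 0; 0; 0; 0]; [:: 0; 0; -3; 0; 0; 0; 0; 0; 0; 0]]
    [:: [:: 4; -3; 1; 1; 0; 0; -3; -2; -1; 5]; [:: -5; 4; -1; -1; 0; 0; 4; 3; 1; -6]; [:: 0; 0; 0;
      0; 0; 0; 0; 0; 0; -1]; [:: -4; 3; -1; -1; 0; 0; 3; 2; 1; -4]; [:: -2; 1; -1; -1; 0; 0; 0; 1;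
      -1; -1]; [:: 0; 1; 0; 0; 0; 0; 1; 0; 1; -1]; [:: 0; 0; 1; 0; 0; 0; 1; 0; 1; -1]; [:: 0; 0; 0;
      1; 0; 0; 1; 0; 1; -1]; [:: -4; 4; -1; -1; 1; 0; 3; 3; 1; -4]; [:: -4; 4; -1; -1; 0; 1; 3; 3;
      1; -4]]
    [:: [:: 1; -1; 0; 0; 0; 0; -1; -1; 1; 1]; [:: 1; -1; 0; 0; 0; 0; -1; -1; 0; 0]; [:: 0; 0; 0; 0;
      0; 0; 0; 0; 0; 1]; [:: 0; 0; 0; 0; 0; 0; 0; 0; 0; 0]; [:: 1; 0; 1; 1; 0; 0; 0; 0; 0; 1]; [::
      -1; 0; 0; 0; 0; 0; 0; 1; -1; 0]; [:: -1; 1; -1; 0; 0; 0; 0; 1; -1; 0]; [:: -1; 1; 0; -1; 0; 0;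
      0; 1; -1; 0]; [:: 0; -1; 0; 0; -1; 0; 0; -1; 0; -1]; [:: 0; -1; 0; 0; 0; -1; 0; -1; 0; -1]]).

Definition symmetry4 : symmetry_data := SymmetryData
  [:: 165; 55; 207; 402; 582; 761; 938; 633; 317; 472; 55] 980
  [:: [:: 89; 30; 114; 210; 300; 396; 492; 336; 174; 240; 30]; [:: -90; -31; -114; -210; -300; -396;
    -492; -336; -174; -240; -30]; [:: -9; -3; -12; -22; -31; -41; -51; -34; -17; -25; -3]; [:: -3;
    -1; -4; -7; -10; -13; -16; -12; -6; -8; -1]; [:: 3; 1; 4; 7; 10; 13; 17; 12; 6; 9; 1]; [:: 0; 0;
    0; 0; 0; 1; 0; 0; 0; 0; 0]; [:: -6; -2; -8; -14; -21; -28; -34; -23; -12; -17; -2]; [:: -3; -1;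
    -4; -8; -10; -13; -16; -11; -6; -8; -1]; [:: -6; -2; -7; -14; -21; -28; -35; -24; -12; -17; -2];
    [:: 6; 2; 8; 15; 22; 28; 34; 23; 12; 17; 2]; [:: -30; -10; -38; -70; -100; -132; -164; -112;
    -58; -80; -11]]
  (Bases
    [:: [:: 1; 1; 0; 0; 0; 0; 0; 0; 0; 0; 0]; [:: 0; 0; -1; 0; 0; 1; 1; 0; 0; 0; 0]; [:: 0; 0; 0; 0;
      -1; 0; 0; 0; 1; 0; 0]; [:: 0; 0; -1; 0; 0; 0; 0; 1; 1; 0; 0]; [:: 0; 0; -1; -1; -1; 0; 1; 1;
      1; 1; 0]; [:: 4; 1; 7; 12; 17; 22; 27; 18; 9; 13; 1]; [:: -4; -1; -5; -10; -15; -19; -24; -17;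
      -8; -12; -2]; [:: 1; 0; 1; 3; 5; 6; 7; 5; 3; 3; 1]; [:: -15; -5; -19; -37; -54; -69; -85; -58;
      -29; -43; -5]; [:: 3; 1; 4; 7; 11; 15; 17; 12; 6; 8; 1]; [:: 3; 1; 4; 7; 10; 13; 17; 12; 6; 9;
      1]]
    [:: [:: 60; -123; 59; -11; 113; 61; -140; -80; -24; -51; -330]; [:: -59; 123; -59; 11; -113;
      -61; 140; 80; 24; 51; 330]; [:: -2; 4; -2; 0; -4; -2; 5; 3; 1; 2; 12]; [:: -3; 6; -2; 1; -6;
      -3; 6; 3; 1; 2; 15]; [:: 0; 0; -1; 0; 0; 0; 1; 1; 0; 0; 1]; [:: -1; 1; 0; 0; -1; -1; 1; 0; 0;
      1; 2]; [:: -1; 4; -2; 0; -3; -1; 4; 3; 1; 1; 10]; [:: -2; 4; -2; 1; -4; -2; 4; 2; 1; 2; 11];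
      [:: 0; 0; 0; 0; 0; 0; 1; 1; 0; 0; 1]; [:: -2; 2; -1; 0; -2; -2; 3; 1; 0; 1; 6]; [:: -20; 41;
      -19; 3; -38; -21; 46; 27; 8; 17; 110]]
    [:: [:: 0; -1; 3; 6; 9; 9; 9; 6; 3; 3; 0]; [:: 3; 2; 3; 6; 9; 9; 9; 6; 3; 3; 0]; [:: 3; 1; 3; 9;
      15; 18; 21; 15; 9; 9; 0]; [:: -3; -1; -6; -9; -15; -18; -21; -12; -6; -9; 0]; [:: 12; 4; 18;
      33; 45; 57; 69; 48; 24; 33; 3]; [:: 15; 5; 18; 33; 48; 66; 84; 57; 30; 42; 6]; [:: -12; -4;
      -15; -30; -45; -57; -72; -51; -24; -36; -3]; [:: -3; -1; -6; -9; -15; -15; -18; -15; -9; -9;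
      0]; [:: 33; 11; 42; 81; 117; 150; 183; 123; 63; 93; 12]; [:: 9; 3; 12; 21; 33; 45; 51; 36; 18;
      24; 3]; [:: 0; 0; 0; 0; 3; 0; 0; 0; 0; 0; 0]]
    [:: [:: 72; 73; -34; -4; -90; 20; -35; -41; 8; -17; -110]; [:: -73; -72; 34; 4; 90; -20; 35; 41;
      -8; 17; 110]; [:: -3; -3; 0; -1; 4; -1; 1; 2; 0; 1; 4]; [:: -4; -4; 3; 1; 4; -1; 2; 2; -1; 1;
      5]; [:: 1; 1; -1; 0; 0; 0; 0; -1; 0; 0; 0]; [:: -1; -1; 1; 0; 1; -1; 1; 1; 1; 0; 1]; [:: -2;
      -2; 0; 1; 2; 1; 0; 1; -2; 0; 4]; [:: -3; -3; 2; -1; 3; -2; 1; 2; 1; 2; 3]; [:: 0; 0; 0; 1; 1;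
      1; 1; -1; -1; -1; 1]; [:: -1; -1; 1; -1; 2; -1; 1; 1; 1; 0; 1]; [:: -23; -23; 11; 1; 29; -7;
      11; 13; -2; 5; 36]]
    [:: [:: -1; 1; 0; 0; 0; 0; 0; 0; 0; 0; 0]; [:: 0; 0; 0; 0; 0; 0; 0; 0; 0; 0; 0]; [:: 1; 1; 1; 1;
      -1; 1; 0; -1; 0; -1; 0]; [:: 1; 1; -1; -1; 0; 1; -1; 0; 1; -1; 0]; [:: -1; -1; 1; -1; 0; 1;
      -1; 1; 0; 0; 0]; [:: 0; 0; 0; -1; 0; 1; -1; -1; -1; 1; -1]; [:: 0; 0; 1; -1; 1; -1; 1; -1; 1;
      1; -1]; [:: 1; 1; -1; 1; 0; 1; 0; -1; -1; -1; 0]; [:: 0; 0; 0; -1; -1; -1; -1; 1; 1; 1; -1];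
      [:: -1; -1; 0; 1; 0; 0; 0; -1; -1; 1; 1]; [:: -1; -1; 0; 1; 1; 1; 1; 1; -1; 1; 1]]).

Definition symmetry5 : symmetry_data := SymmetryData
  [:: 30; 9; 17; 33; 65; 96; 125; 153; 103; 52; 77; 13] 1596
  [:: [:: 13; 4; 8; 14; 28; 42; 56; 70; 48; 24; 36; 6]; [:: 0; 0; 0; 0; 0; 0; 0; 0; 0; 1; 0; 0]; [::
    -6; -2; -4; -6; -12; -18; -24; -30; -21; -11; -15; -3]; [:: 0; 0; 0; 0; 0; 0; 0; 1; 0; 0; 0; 0];
    [:: 0; 0; 0; 0; 0; 0; 1; 0; 0; 0; 0; 0]; [:: 0; 0; 0; 0; 0; 1; 0; 0; 0; 0; 0; 0]; [:: 0; 0; 0;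
    0; 1; 0; 0; 0; 0; 0; 0; 0]; [:: 0; 0; 0; 1; 0; 0; 0; 0; 0; 0; 0; 0]; [:: -1; -1; -1; -2; -3; -4;
    -5; -6; -4; -2; -3; 0]; [:: 0; 1; 0; 0; 0; 0; 0; 0; 0; 0; 0; 0]; [:: -1; 0; 0; -2; -3; -4; -5;
    -6; -4; -2; -3; -1]; [:: -6; -2; -4; -6; -12; -18; -24; -30; -20; -10; -16; -3]]
  (Bases
    [:: [:: 0; -1; 0; 1; 0; 0; 0; 0; 0; 0; 0; 0]; [:: 0; -1; 0; 0; 1; 0; 0; 0; 0; 0; 0; 0]; [:: 0;
      -1; 0; 0; 0; 0; 1; 0; 0; 0; 0; 0]; [:: 0; -1; 0; 0; 0; 0; 0; 1; 0; 0; 0; 0]; [:: 0; -1; 0; 0;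
      0; 0; 0; 0; 1; 0; 0; 0]; [:: 0; -1; 0; 0; 0; 0; 0; 0; 0; 1; 0; 0]; [:: -1; 0; -1; -2; -3; -4;
      -5; -7; -5; -2; -3; 0]; [:: 1; 0; 1; 2; 3; 4; 5; 7; 4; 2; 4; 0]; [:: 2; 0; 1; 3; 6; 8; 11; 13;
      9; 4; 7; 1]; [:: 0; 0; 0; 0; 1; 1; 0; -1; -1; -1; 0; 0]; [:: 1; 1; 1; 0; 0; 1; 1; 2; 1; 1; 1;
      1]; [:: 0; 1; 0; 0; 0; 0; 0; 0; 0; 0; 0; 0]]
    [:: [:: -3; 1; -10; -18; -21; -10; -6; -6; 1; -7; -1; -60]; [:: 0; 0; 0; 0; 0; 0; 0; 0; 0; 0; 0;
      1]; [:: 1; 0; 5; 7; 9; 4; 2; 3; -1; 3; 1; 25]; [:: 1; 0; 0; 0; 0; 0; 0; 0; 0; 0; 0; 1]; [:: 0;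
      1; 0; 0; 0; 0; 0; 0; 0; 0; 0; 1]; [:: 0; -1; 0; 1; 1; 1; 0; 0; 0; 1; 0; 2]; [:: 0; 0; 1; 0; 0;
      0; 0; 0; 0; 0; 0; 1]; [:: 0; 0; 0; 1; 0; 0; 0; 0; 0; 0; 0; 1]; [:: 0; 0; 0; 0; 1; 0; 0; 0; 0;
      0; 0; 1]; [:: 0; 0; 0; 0; 0; 1; 0; 0; 0; 0; 0; 1]; [:: 0; 0; 0; 0; 1; 0; 1; 1; 0; 0; 0; 1];
      [:: 2; 0; 4; 8; 9; 4; 3; 2; 0; 3; 1; 26]]
    [:: [:: 0; 1; -1; 0; 3; 3; 3; 6; 3; 0; 3; 0]; [:: 0; -2; -1; 3; 3; 3; 3; 6; 3; 0; 3; 0]; [:: 0;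
      -2; -1; 0; 3; 3; 6; 6; 3; 0; 3; 0]; [:: 0; -1; -2; 0; 3; 6; 9; 12; 6; 3; 6; 0]; [:: 0; -1; 1;
      0; 0; -3; -6; -6; -3; 0; -3; 0]; [:: 0; 1; 2; -3; -6; -6; -6; -9; -6; -3; -6; 0]; [:: 3; 1; 2;
      6; 12; 15; 18; 24; 18; 9; 12; 0]; [:: 6; 2; 4; 6; 12; 21; 30; 36; 24; 12; 18; 3]; [:: 0; -2;
      -1; 0; 0; 3; 3; 6; 6; 3; 3; 0]; [:: 0; 1; -1; 3; 3; 3; 3; 3; 3; 3; 0; 0]; [:: 0; 0; 0; 0; 0;
      3; 0; 0; -3; -3; 0; 0]; [:: 0; 3; 0; 0; 0; 0; 0; 0; 0; 0; 0; 0]]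
    [:: [:: 10; -4; -9; -3; -10; -2; 1; 0; -5; 2; -3; -20]; [:: 0; 0; 0; 0; 0; 0; 0; 0; 0; 0; 0; 1];
      [:: -4; 2; 4; 1; 4; 1; 0; 0; 2; -1; 1; 8]; [:: 0; 1; -1; -1; 0; 0; 0; 0; 1; 0; -1; 0]; [:: 0;
      0; 1; 1; 0; 0; 0; 0; -1; 0; 1; 1]; [:: 0; -1; 1; 0; 1; 0; 0; 0; 1; 0; 0; 0]; [:: -1; 1; -1;
      -1; 0; 0; 0; 0; -1; 0; 0; 1]; [:: 0; 0; 1; 2; -1; 1; 0; 0; 1; 0; 0; 0]; [:: 0; 0; 1; -1; 1;
      -1; 0; 0; 1; 1; 0; 0]; [:: 0; 0; -1; 0; 0; 1; 0; 0; -1; -1; 0; 0]; [:: 0; 0; -1; -1; 1; -1; 0;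
      0; -1; -1; 0; 1]; [:: -3; 2; 5; 0; 5; 0; 0; 1; 3; 0; 1; 8]]
    [:: [:: 1; 1; 1; -1; -1; 0; 1; 0; 0; 0; -1; 0]; [:: 0; 0; 0; 0; 0; 0; 0; 0; 0; 0; 0; -1]; [:: 0;
      0; 0; 0; 0; 0; 0; 0; 0; 0; 0; 0]; [:: -1; -1; 1; 1; 0; 0; 0; 0; -1; 0; 1; 0]; [:: -1; 0; -1;
      -1; 0; 0; 0; 0; 1; 0; -1; -1]; [:: -1; 1; -1; 0; -1; 0; 0; 0; 0; 0; 0; 0]; [:: 0; -1; 1; 1; 0;
      0; 0; 0; 1; 0; 0; -1]; [:: -1; 0; -1; -1; 1; 0; 0; 0; -1; 0; 0; 0]; [:: -1; 0; -1; 1; -1; 1;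
      0; 0; -1; -1; 0; 1]; [:: -1; 0; 1; 1; 0; -1; 0; 0; 1; 1; 0; 1]; [:: -1; 0; 1; 1; -1; 1; 0; 0;
      1; 1; 0; -1]; [:: -1; 0; -1; 1; -1; 1; -1; -1; -1; -1; 0; 1]]).

Definition symmetry6 : symmetry_data := SymmetryData
  [:: 34; -33; 11; 21; 32; 63; 92; 120; 147; 99; 50; 74; 16] 2310
  [:: [:: 6; -6; 2; 4; 6; 12; 18; 24; 30; 20; 10; 15; 3]; [:: -6; 6; -2; -4; -6; -12; -18; -24; -29;
    -20; -10; -15; -3]; [:: 0; 0; 0; 0; 0; 0; 0; 0; 0; 0; 1; 0; 0]; [:: -6; 6; -2; -4; -6; -12; -18;
    -24; -30; -21; -11; -15; -3]; [:: 0; 0; 0; 0; 0; 0; 1; 0; 0; 0; 0; 0; 0]; [:: 0; 0; 0; 0; 0; 1;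
    0; 0; 0; 0; 0; 0; 0]; [:: 0; 0; 0; 0; 1; 0; 0; 0; 0; 0; 0; 0; 0]; [:: -1; 0; 0; 0; -2; -3; -4;
    -5; -6; -4; -2; -3; 0]; [:: 1; 1; 0; 0; 0; 0; 0; 0; 0; 0; 0; 0; 0]; [:: -1; 0; -1; -1; 0; 0; 0;
    0; 0; 0; 0; 0; 0]; [:: 0; 0; 1; 0; 0; 0; 0; 0; 0; 0; 0; 0; 0]; [:: -1; 0; 0; 0; 0; 0; 0; 0; 0;
    0; 0; 0; -1]; [:: -6; 6; -2; -4; -6; -12; -18; -24; -30; -20; -10; -16; -3]]
  (Bases
    [:: [:: -1; -1; 1; 0; 0; 0; 0; 0; 0; 0; 0; 0; 0]; [:: -1; -1; 0; 0; 1; 0; 0; 0; 0; 0; 0; 0; 0];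
      [:: 0; -1; 1; 1; 0; 1; 0; 0; 0; 0; 0; 0; 0]; [:: -1; -1; 0; 0; 0; 0; 1; 0; 0; 0; 0; 0; 0]; [::
      1; 0; 1; 1; 1; 0; 0; 0; 0; 0; 0; 0; 0]; [:: -1; -1; 0; 0; 0; 0; 0; 1; 0; 0; 0; 0; 0]; [:: -1;
      -1; 0; 0; 0; 0; 0; 0; 1; 0; 0; 0; 0]; [:: -1; -1; 0; 0; 0; 0; 0; 0; 0; 1; 0; 0; 0]; [:: 0; -1;
      1; 1; 0; 0; 0; 0; 0; 1; 1; 0; 0]; [:: 1; -1; 1; 1; 2; 4; 5; 5; 6; 4; 2; 3; 0]; [:: 1; -1; 1;
      1; 1; 3; 4; 6; 7; 5; 2; 4; 0]; [:: 1; -2; 1; 1; 2; 3; 4; 6; 8; 5; 2; 4; 1]; [:: 1; 1; 0; 0; 0;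
      0; 0; 0; 0; 0; 0; 0; 0]]
    [:: [:: 0; -13; -7; -8; 8; -2; -3; 1; -2; 4; -3; 0; -33]; [:: 0; 13; 7; 8; -8; 2; 3; -1; 2; -4;
      3; 0; 34]; [:: 1; 0; 0; 0; 0; 0; 0; 0; 0; 0; 0; 0; 1]; [:: -1; 12; 7; 8; -7; 2; 3; -1; 2; -4;
      3; 0; 31]; [:: 0; 1; 0; 0; 0; 0; 0; 0; 0; 0; 0; 0; 1]; [:: 0; 1; 1; 0; -1; 0; 0; 0; 0; 0; 0;
      0; 2]; [:: 0; 0; 0; 1; 0; 0; 0; 0; 0; 0; 0; 0; 1]; [:: 0; 0; 0; 0; 0; 1; 0; 0; 0; 0; 0; 0; 1];
      [:: 0; 0; 0; 0; 0; 0; 1; 0; 0; 0; 0; 0; 1]; [:: 0; 0; 0; 0; 0; 0; 0; 1; 0; 0; 0; 0; 1]; [:: 0;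
      1; 0; 0; -1; 0; 0; -1; 1; 0; 0; 0; 1]; [:: 0; 2; 1; 1; -1; -1; -1; -1; 0; -1; 1; 0; 1]; [:: 0;
      12; 7; 8; -8; 2; 2; -1; 2; -4; 2; 1; 32]]
    [:: [:: -3; -3; 3; 0; 0; 0; 0; 0; 0; 0; 0; 0; 0]; [:: -3; -3; 0; 0; 3; 0; 0; 0; 0; 0; 0; 0; 0];
      [:: 0; -3; 1; 2; 3; 3; 6; 6; 6; 6; 3; 3; 0]; [:: 0; -3; 1; 2; 3; 3; 3; 6; 9; 6; 3; 3; 0]; [::
      0; 0; -1; 1; 0; 0; -3; -6; -9; -6; -3; -3; 0]; [:: -3; 0; -1; -2; -3; -3; -3; -6; -6; -6; -3;
      -3; 0]; [:: 0; 0; -1; 1; 0; -3; -3; -6; -6; -3; -3; -3; 0]; [:: 0; 0; 2; 1; -3; -3; -6; -6;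
      -6; -3; 0; -3; 0]; [:: 0; 0; -1; 1; 0; -3; -3; -3; -6; -6; -3; -3; 0]; [:: 0; 0; 1; -1; 3; 3;
      3; 3; 6; 3; 3; 3; 0]; [:: 0; 3; -1; -2; 0; -3; -3; -6; -9; -6; -3; -6; 0]; [:: 6; -6; 2; 4; 6;
      15; 24; 30; 36; 24; 12; 18; 3]; [:: 3; 3; 0; 0; 0; 0; 0; 0; 0; 0; 0; 0; 0]]
    [:: [:: 1; -7; -2; -2; -1; -5; 3; -1; 2; 4; 1; 0; -11]; [:: -1; 7; 2; 2; 1; 5; -3; 1; -2; -4;
      -1; 0; 11]; [:: 1; 0; 0; 0; 0; 0; 0; 0; 0; 0; 0; 0; 1]; [:: -1; 6; 2; 2; 1; 5; -3; 1; -2; -4;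
      -1; 0; 10]; [:: -1; 0; 0; 0; 0; 0; 1; 1; 1; 0; 0; 0; 1]; [:: 1; 0; 0; 0; 0; 0; -1; -1; -1; 0;
      0; 0; 0]; [:: 0; 0; 0; 1; 1; 1; 0; 0; 0; -1; 0; 0; 1]; [:: -1; 1; 1; -1; -1; 0; -1; 1; 0; 1;
      0; 0; 0]; [:: 1; -1; -1; 1; 0; -1; 1; -1; -1; -1; 0; 0; 0]; [:: 0; 1; 0; 0; 1; 1; 0; 0; 1; -1;
      1; 0; 0]; [:: 0; 0; 0; 0; -1; 0; 0; 0; -1; 1; -1; 0; 1]; [:: -1; 1; 1; -1; 0; 1; -1; 1; 1; 1;
      -1; 0; 1]; [:: 0; 7; 2; 1; 1; 5; -3; 2; -3; -5; 0; 1; 10]]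
    [:: [:: 1; -1; 0; 0; 0; 1; -1; 0; -1; -1; 0; 0; 1]; [:: -1; 1; 0; 0; 0; -1; 1; 0; 1; 1; 0; 0;
      0]; [:: -1; 0; 0; 0; 0; 0; 0; 0; 0; 0; 0; 0; -1]; [:: 0; 0; 0; 0; 0; 0; 0; 0; 0; 0; 0; 0; 0];
      [:: 1; 1; 0; 0; 0; 0; -1; -1; -1; 0; 0; 0; -1]; [:: -1; 1; 0; 0; 0; 0; 1; 1; 1; 0; 0; 0; 0];
      [:: 0; 0; 0; -1; -1; -1; 1; 0; 1; 1; 0; 0; -1]; [:: 1; -1; -1; 1; 1; 0; 1; -1; 1; -1; 0; 0;
      0]; [:: -1; 0; 1; 0; 0; 1; -1; 1; 1; 1; 0; 0; 0]; [:: -1; -1; 1; 0; -1; -1; -1; 1; -1; 1; -1;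
      0; 0]; [:: -1; 0; 1; 0; 1; 0; -1; 1; 1; -1; 1; 0; -1]; [:: 1; -1; -1; 1; 0; -1; 1; -1; -1; -1;
      1; 0; -1]; [:: -1; 0; -1; 1; 0; 0; 0; -1; 1; 1; -1; -1; 1]]).

(** The matrix is that of [symmetry6], extended by the identity on D4. The fixed point has to be
    chosen anew, since it must also avoid the mirrors of the additional roots. *)
Definition symmetry7 : symmetry_data := SymmetryData
  [:: 34; -33; 11; 21; -3; -3; 4; 8; 31; 63; 91; 120; 147; 99; 50; 74; 16] 560
  [:: [:: 6; -6; 2; 4; 0; 0; 0; 0; 6; 12; 18; 24; 30; 20; 10; 15; 3]; [:: -6; 6; -2; -4; 0; 0; 0; 0;
    -6; -12; -18; -24; -29; -20; -10; -15; -3]; [:: 0; 0; 0; 0; 0; 0; 0; 0; 0; 0; 0; 0; 0; 0; 1; 0;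
    0]; [:: -6; 6; -2; -4; 0; 0; 0; 0; -6; -12; -18; -24; -30; -21; -11; -15; -3]; [:: 0; 0; 0; 0;
    1; 0; 0; 0; 0; 0; 0; 0; 0; 0; 0; 0; 0]; [:: 0; 0; 0; 0; 0; 1; 0; 0; 0; 0; 0; 0; 0; 0; 0; 0; 0];
    [:: 0; 0; 0; 0; 0; 0; 1; 0; 0; 0; 0; 0; 0; 0; 0; 0; 0]; [:: 0; 0; 0; 0; 0; 0; 0; 1; 0; 0; 0; 0;
    0; 0; 0; 0; 0]; [:: 0; 0; 0; 0; 0; 0; 0; 0; 0; 0; 1; 0; 0; 0; 0; 0; 0]; [:: 0; 0; 0; 0; 0; 0; 0;
    0; 0; 1; 0; 0; 0; 0; 0; 0; 0]; [:: 0; 0; 0; 0; 0; 0; 0; 0; 1; 0; 0; 0; 0; 0; 0; 0; 0]; [:: -1;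
    0; 0; 0; 0; 0; 0; 0; -2; -3; -4; -5; -6; -4; -2; -3; 0]; [:: 1; 1; 0; 0; 0; 0; 0; 0; 0; 0; 0; 0;
    0; 0; 0; 0; 0]; [:: -1; 0; -1; -1; 0; 0; 0; 0; 0; 0; 0; 0; 0; 0; 0; 0; 0]; [:: 0; 0; 1; 0; 0; 0;
    0; 0; 0; 0; 0; 0; 0; 0; 0; 0; 0]; [:: -1; 0; 0; 0; 0; 0; 0; 0; 0; 0; 0; 0; 0; 0; 0; 0; -1]; [::
    -6; 6; -2; -4; 0; 0; 0; 0; -6; -12; -18; -24; -30; -20; -10; -16; -3]]
  (Bases
    [:: [:: -1; -1; 1; 0; 0; 0; 0; 0; 0; 0; 0; 0; 0; 0; 0; 0; 0]; [:: 0; 0; -1; 0; 1; 1; 0; 1; 0; 0;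
      0; 0; 0; 0; 0; 0; 0]; [:: 1; 1; 0; 0; 0; 0; 0; 0; 1; 0; 0; 0; 0; 0; 0; 0; 0]; [:: 1; 0; 1; 1;
      1; 1; 0; 1; 0; 0; 0; 0; 0; 0; 0; 0; 0]; [:: 0; 1; 0; -1; 0; 1; 0; 0; 0; 0; 0; 0; 0; 0; 0; 0;
      0]; [:: 0; 1; 0; -1; 2; 1; 1; 1; 0; 0; 0; 0; 0; 0; 0; 0; 0]; [:: 0; 0; 0; 0; -1; 0; 0; -1; 0;
      1; 0; 0; 0; 0; 0; 0; 0]; [:: 0; -1; 1; 1; 0; 0; 0; 0; 1; 1; 1; 0; 0; 0; 0; 0; 0]; [:: -1; -1;
      0; 0; 0; 0; 0; 0; 0; 0; 1; 1; 0; 0; 0; 0; 0]; [:: 1; 0; 0; 1; 0; 0; 0; 0; 0; 0; 1; 1; 1; 0; 0;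
      0; 0]; [:: 0; -1; 0; 1; 0; 0; 0; 0; 0; 0; 1; 1; 1; 1; 0; 0; 0]; [:: 0; 1; 0; 0; 1; 0; 0; 0;
      -1; -2; -2; -3; -3; -2; -1; -2; 0]; [:: 2; -1; 0; 0; -1; -1; 0; 0; 2; 4; 6; 8; 10; 7; 4; 5;
      1]; [:: -2; 2; 0; -1; 0; 1; 0; -1; -2; -4; -6; -8; -10; -7; -3; -5; -1]; [:: 0; 0; 0; -1; 0;
      0; 0; 0; 2; 3; 4; 5; 6; 4; 2; 3; 0]; [:: -2; 2; -1; -1; 0; 0; -1; 0; -2; -5; -7; -9; -12; -8;
      -4; -6; -1]; [:: 1; 1; 0; 0; 0; 0; 0; 0; 0; 0; 0; 0; 0; 0; 0; 0; 0]]
    [:: [:: -24; -16; -3; 10; 6; 3; -1; 1; -2; 1; -1; 0; 1; -2; 1; 3; -33]; [:: 24; 16; 3; -10; -6;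
      -3; 1; -1; 2; -1; 1; 0; -1; 2; -1; -3; 34]; [:: 1; 0; 0; 0; 0; 0; 0; 0; 0; 0; 0; 0; 0; 0; 0;
      0; 1]; [:: 22; 15; 3; -9; -6; -3; 1; -1; 2; -1; 1; 0; -1; 2; -1; -3; 31]; [:: -11; -7; -1; 5;
      2; 1; 0; 0; 0; 0; -1; 1; 0; -1; 1; 1; -15]; [:: -2; -1; 0; 1; 1; 0; 0; 0; 0; 0; 0; 0; 0; 0; 0;
      0; -3]; [:: 8; 5; 1; -4; -2; 0; 0; 0; 0; 0; 1; -1; 0; 1; -1; -1; 11]; [:: 14; 9; 1; -6; -3;
      -1; 0; 0; 0; 0; 1; -1; 0; 1; -1; -1; 19]; [:: 0; 0; 1; 0; 0; 0; 0; 0; 0; 0; 0; 0; 0; 0; 0; 0;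
      -1]; [:: 3; 2; 0; -1; -1; 0; 1; 0; 0; 0; 0; 0; 0; 0; 0; 0; 4]; [:: -2; -1; -1; 0; 1; 0; -1; 1;
      0; 0; 0; 0; 0; 0; 0; 0; -1]; [:: 2; 1; 1; 0; -1; 0; 1; -1; 1; 0; 0; 0; 0; 0; 0; 0; 2]; [:: 2;
      1; 0; -1; 0; 0; 0; 0; -1; 1; 0; 0; 0; 0; 0; 0; 1]; [:: 0; 0; 0; 0; 0; 0; 0; 0; 0; -1; 1; 0; 0;
      0; 0; 0; 1]; [:: 1; 1; 0; 0; -1; 0; 0; 0; 0; 0; 0; 0; 1; 1; 0; 0; 1]; [:: -1; 0; 0; 0; 0; -1;
      -1; 0; 1; -1; -1; 0; -1; 0; 0; -1; 1]; [:: 24; 16; 4; -10; -5; -3; 2; -1; 3; -1; 0; 1; -1; 1;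
      -2; -3; 32]]
    [:: [:: 0; 0; -2; -1; 0; 0; 3; 0; 0; 0; 0; 0; 0; 0; 0; 0; 0]; [:: 3; 0; 1; 2; 3; 3; 3; 3; 0; 0;
      0; 0; 0; 0; 0; 0; 0]; [:: -3; -3; 3; 0; 0; 0; 0; 0; 0; 0; 0; 0; 0; 0; 0; 0; 0]; [:: 0; 0; 3;
      0; -3; -3; 0; -3; 0; 0; 0; 0; 0; 0; 0; 0; 0]; [:: 0; 0; 3; 0; 0; 0; 0; 0; 3; 0; 0; 0; 0; 0; 0;
      0; 0]; [:: 0; 3; 0; -3; 6; 3; 3; 3; 0; 0; 0; 0; 0; 0; 0; 0; 0]; [:: 0; 3; 0; -3; 0; 3; 0; 0;
      0; 0; 0; 0; 0; 0; 0; 0; 0]; [:: 0; 0; 0; 0; 3; 0; 3; 0; 0; 3; 0; 0; 0; 0; 0; 0; 0]; [:: 0; -3;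
      3; 3; 0; 0; 0; 0; 3; 3; 3; 0; 0; 0; 0; 0; 0]; [:: 3; 0; 1; 2; 0; 0; 0; 0; 3; 3; 3; 6; 6; 6; 3;
      3; 0]; [:: 0; 0; 2; 1; 0; 0; 0; 0; 0; -3; -3; -3; -6; -6; -3; -3; 0]; [:: 0; 0; 2; 1; 0; 0; 0;
      0; 0; -3; -6; -6; -6; -3; -3; -3; 0]; [:: -3; 3; -1; -2; 3; 0; 0; 0; -6; -9; -12; -15; -18;
      -12; -6; -9; 0]; [:: 6; -6; 1; 5; 0; 0; 0; 3; 6; 9; 12; 15; 18; 12; 6; 9; 3]; [:: 0; -3; 1; 2;
      0; 0; 0; 0; 3; 3; 3; 6; 9; 6; 3; 3; 0]; [:: -6; 6; -2; -4; 3; 3; 0; 0; -6; -9; -15; -21; -27;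
      -18; -9; -15; -3]; [:: 0; 0; 3; 0; 0; 0; 0; 0; 0; 0; 0; 0; 0; 0; 0; 0; 0]]
    [:: [:: -4; 3; 3; 5; 2; 1; 0; 0; -2; -1; -1; 0; -1; 1; -1; 1; -11]; [:: 4; -3; -3; -5; -2; -1;
      0; 0; 2; 1; 1; 0; 1; -1; 1; -1; 11]; [:: 0; 0; 0; 0; 0; 0; 0; 0; 0; 0; 0; 0; 0; 0; 0; 0; 1];
      [:: 4; -3; -3; -5; -2; -1; 0; 0; 2; 1; 1; 0; 1; -1; 1; -1; 10]; [:: -2; 1; 1; 2; 0; 0; 0; 0;
      0; -1; -1; 0; -1; 1; -1; 1; -5]; [:: 0; 0; 0; 0; 0; 1; 1; 0; 0; 0; 0; 0; 0; 0; 0; 0; -1]; [::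
      2; 0; 0; -2; 0; 0; 0; 0; 0; 1; 1; 0; 1; -1; 1; -1; 3]; [:: 2; -2; -2; -2; 0; -1; -1; 0; 0; 1;
      1; 0; 1; -1; 1; -1; 7]; [:: 0; 1; 0; 0; 0; -1; 0; 0; 0; 0; 0; 0; 1; 0; 0; 0; -1]; [:: 0; -1;
      0; -1; 1; 1; 0; 0; 0; 0; 0; 0; -1; 0; 0; 0; 2]; [:: 1; 0; -1; 1; -1; -1; 0; 0; 0; 0; 0; 0; 0;
      0; 0; 0; -1]; [:: -1; -1; 1; -1; -1; 1; 0; 0; 1; 0; 0; 0; 1; 0; 0; 0; 1]; [:: 1; 1; -1; 1; 1;
      0; 0; 0; -1; 1; 1; 0; -1; 0; 1; 0; 0]; [:: 1; 0; 1; -1; -1; 0; 0; 0; 0; -1; 0; 0; 0; 1; -1; 1;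
      0]; [:: -1; 0; -1; 0; 1; 0; 0; 0; 0; 1; -1; 0; 0; -1; 1; -1; 1]; [:: -1; -1; 0; -1; 0; -1; 0;
      0; 1; -1; -1; 0; 1; -1; -1; -1; 1]; [:: 5; -4; -3; -5; -2; -1; 1; 0; 2; 1; 1; 0; 2; 0; 1; -1;
      10]]
    [:: [:: 1; -1; -1; -1; 0; 0; 0; 0; 0; 0; 0; 0; 0; 0; 0; 0; 1]; [:: -1; 1; 0; 1; 0; 0; 0; 0; 0;
      0; 0; 0; 0; 0; 0; 0; 0]; [:: 0; 0; 0; 0; 0; 0; 0; 0; 0; 0; 0; 0; 0; 0; 0; 0; -1]; [:: 0; 0; 0;
      0; 0; 0; 0; 0; 0; 0; 0; 0; 0; 0; 0; 0; 0]; [:: -1; 1; 1; 1; 0; 1; 0; 0; 0; 0; 0; 0; 0; 0; 0;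
      0; 0]; [:: -1; 1; 1; 1; 0; -1; -1; 0; 0; 0; 0; 0; 0; 0; 0; 0; 0]; [:: -1; -1; -1; 1; -1; 0; 0;
      0; 1; -1; -1; 0; -1; 1; -1; 1; 1]; [:: 0; 1; 1; -1; -1; 1; 1; 0; 1; -1; -1; 0; -1; 1; -1; 1;
      -1]; [:: 0; -1; 0; 0; 0; 1; 0; 0; 0; 0; 0; 0; -1; 0; 0; 0; 1]; [:: 0; 1; 0; 0; -1; -1; 0; 0;
      0; 0; 0; 0; 1; 0; 0; 0; 0]; [:: -1; 1; 1; -1; 1; 1; 0; -1; 0; 0; 0; 0; 0; 0; 0; 0; 1]; [:: 1;
      1; -1; 0; 1; -1; 0; -1; -1; 0; 0; 0; -1; 0; 0; 0; 0]; [:: -1; -1; 0; -1; -1; 0; 0; -1; 1; -1;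
      -1; 0; 1; 0; 0; 0; 0]; [:: -1; -1; -1; 1; 0; 0; 0; -1; 1; 1; 0; 0; 1; -1; 1; -1; 0]; [:: 1; 0;
      1; 0; 0; -1; 0; 0; 0; -1; 1; -1; 1; 1; -1; 1; -1]; [:: 1; 1; 0; 0; 0; 1; 0; 0; -1; 1; 1; 0;
      -1; 1; 1; 1; -1]; [:: -1; 1; 0; 0; 0; 0; -1; 0; 0; 0; 0; 0; -1; -1; 0; 0; 1]]).

Definition symmetry8 : symmetry_data := SymmetryData
  [:: 67924; 22634; 90156; 158831; 222570; 285136; 347326; 231915; 116053; 177513; 45608; 90054;
    133137; 172355; 209752; 142239; 73963; 104877] 532
  [:: [:: 1573045; 524348; 2086920; 3677982; 5153322; 6600684; 8039898; 5368566; 2686722; 4108854;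
    1057374; 2086872; 3085398; 3992970; 4859274; 3295680; 1713864; 2429376]; [:: -1573044; -524347;
    -2086920; -3677982; -5153322; -6600684; -8039898; -5368566; -2686722; -4108854; -1057374;
    -2086872; -3085398; -3992970; -4859274; -3295680; -1713864; -2429376]; [:: -247929; -82643;
    -328921; -579690; -812219; -1040338; -1267173; -846143; -423456; -647599; -166654; -328914;
    -486293; -629337; -765876; -519436; -270124; -382897]; [:: -57861; -19287; -76763; -135286;
    -189553; -242791; -295730; -197471; -98825; -151135; -38893; -76761; -113489; -146872; -178737;
    -121224; -63041; -89359]; [:: -13989; -4663; -18559; -32708; -45828; -58700; -71498; -47742;
    -23893; -36540; -9403; -18558; -27438; -35509; -43213; -29308; -15241; -21604]; [:: -4074;
    -1358; -5405; -9526; -13348; -17096; -20824; -13905; -6959; -10642; -2738; -5404; -7990; -10340;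
    -12583; -8534; -4438; -6291]; [:: -846; -282; -1122; -1978; -2771; -3550; -4324; -2888; -1445;
    -2210; -569; -1123; -1660; -2148; -2614; -1773; -922; -1307]; [:: -5256; -1752; -6973; -12289;
    -17218; -22054; -26863; -17937; -8977; -13728; -3533; -6973; -10310; -13343; -16238; -11013;
    -5727; -8118]; [:: -2439; -813; -3236; -5703; -7991; -10235; -12466; -8324; -4165; -6371; -1639;
    -3235; -4783; -6190; -7533; -5109; -2657; -3766]; [:: -88905; -29635; -117948; -207871; -291254;
    -373055; -454396; -303418; -151847; -232223; -59761; -117946; -174380; -225674; -274636;
    -186265; -96864; -137303]; [:: -13938; -4646; -18491; -32588; -45660; -58484; -71236; -47567;
    -23805; -36406; -9369; -18492; -27340; -35382; -43058; -29203; -15186; -21527]; [:: -15486;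
    -5162; -20545; -36209; -50733; -64982; -79151; -52852; -26450; -40451; -10409; -20543; -30373;
    -39307; -47835; -32443; -16872; -23915]; [:: -45477; -15159; -60333; -106331; -148984; -190828;
    -232436; -155207; -77674; -118788; -30569; -60332; -89199; -115438; -140483; -95279; -49548;
    -70234]; [:: -20634; -6878; -27375; -48245; -67597; -86582; -105460; -70420; -35242; -53896;
    -13870; -27374; -40472; -52376; -63740; -43230; -22481; -31867]; [:: -261; -87; -346; -610;
    -855; -1095; -1334; -891; -446; -682; -175; -346; -512; -663; -807; -548; -285; -403]; [::
    -9111; -3037; -12087; -21302; -29847; -38230; -46566; -31094; -15561; -23798; -6125; -12088;
    -17872; -23129; -28147; -19089; -9927; -14072]; [:: -66024; -22008; -87593; -154374; -216297;
    -277046; -337453; -225331; -112768; -172458; -44379; -87589; -129498; -167590; -203950; -138324;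
    -71933; -101964]; [:: 261; 87; 346; 610; 855; 1095; 1334; 891; 446; 682; 175; 346; 512; 663;
    808; 548; 285; 404]]
  (Bases
    [:: [:: -1; 0; -2; -4; -5; -6; -8; -5; -2; -4; -1; -2; -2; -3; -4; -3; -2; -2]; [:: 0; 0; 0; 1;
      1; 1; 0; 0; 0; 0; 0; 0; 0; 0; -1; -1; -1; -1]; [:: 6; 2; 8; 14; 19; 24; 30; 20; 10; 15; 5; 9;
      12; 15; 19; 13; 7; 10]; [:: 15; 5; 20; 35; 48; 61; 75; 50; 25; 39; 10; 20; 29; 38; 47; 32; 17;
      23]; [:: -12; -4; -16; -28; -39; -50; -61; -40; -20; -31; -8; -16; -23; -30; -37; -25; -14;
      -19]; [:: -40; -13; -54; -95; -133; -170; -207; -139; -69; -106; -27; -53; -78; -102; -124;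
      -84; -44; -62]; [:: -39; -13; -51; -90; -127; -163; -199; -132; -66; -102; -27; -53; -78;
      -101; -124; -84; -44; -62]; [:: 58; 19; 77; 137; 192; 246; 300; 200; 100; 153; 39; 78; 116;
      150; 182; 123; 64; 91]; [:: 192; 64; 255; 449; 630; 807; 983; 656; 328; 503; 128; 253; 374;
      485; 591; 401; 209; 296]; [:: -375; -125; -498; -878; -1229; -1574; -1917; -1280; -640; -980;
      -251; -496; -733; -950; -1156; -784; -408; -578]; [:: 645; 215; 856; 1508; 2113; 2707; 3298;
      2202; 1102; 1686; 432; 854; 1263; 1635; 1990; 1350; 703; 995]; [:: 282; 94; 374; 659; 924;
      1184; 1442; 963; 482; 737; 189; 374; 553; 717; 872; 592; 307; 436]; [:: 732; 244; 971; 1710;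
      2397; 3071; 3741; 2498; 1250; 1912; 492; 971; 1437; 1860; 2263; 1535; 798; 1132]; [:: -153;
      -51; -203; -357; -501; -641; -780; -521; -261; -399; -103; -203; -301; -390; -475; -322; -167;
      -237]; [:: -1404; -468; -1863; -3282; -4599; -5892; -7178; -4793; -2398; -3669; -943; -1862;
      -2752; -3562; -4336; -2940; -1529; -2168]; [:: 1588; 529; 2108; 3714; 5205; 6668; 8123; 5424;
      2714; 4151; 1066; 2105; 3112; 4030; 4904; 3326; 1730; 2452]; [:: -4205; -1401; -5582; -9834;
      -13780; -17654; -21505; -14359; -7185; -10991; -2823; -5574; -8241; -10669; -12985; -8806;
      -4579; -6492]; [:: -18; -6; -24; -42; -58; -74; -90; -60; -30; -46; -12; -24; -36; -47; -57;
      -39; -20; -28]]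
    [:: [:: -93444; -60744; -79545; 7182; -20023; 49532; 19195; -32300; -92097; -67700; -9156;
      19320; 21903; -55229; 7694; -20541; -4465; 135848]; [:: 93414; 60724; 79519; -7180; 20017;
      -49515; -19189; 32289; 92067; 67677; 9153; -19314; -21896; 55211; -7692; 20535; 4464;
      -135804]; [:: 14775; 9605; 12577; -1135; 3165; -7832; -3034; 5107; 14563; 10706; 1447; -3055;
      -3463; 8733; -1217; 3248; 706; -21481]; [:: 3396; 2207; 2891; -261; 728; -1800; -698; 1174;
      3346; 2459; 333; -702; -796; 2007; -279; 746; 162; -4936]; [:: 806; 525; 687; -62; 173; -427;
      -165; 279; 796; 585; 79; -167; -189; 476; -67; 178; 39; -1173]; [:: 259; 168; 220; -21; 55;
      -138; -54; 89; 254; 187; 26; -53; -61; 153; -21; 56; 12; -376]; [:: 60; 39; 51; -4; 13; -31;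
      -12; 21; 60; 44; 5; -13; -14; 36; -5; 14; 3; -88]; [:: 310; 201; 264; -25; 67; -165; -64; 107;
      305; 224; 31; -64; -73; 183; -26; 68; 15; -451]; [:: 133; 86; 113; -9; 28; -70; -27; 46; 130;
      96; 13; -27; -31; 78; -10; 29; 6; -191]; [:: 5297; 3444; 4509; -406; 1135; -2808; -1088; 1831;
      5221; 3838; 519; -1095; -1241; 3131; -436; 1164; 253; -7700]; [:: 800; 520; 681; -61; 172;
      -424; -165; 276; 788; 579; 78; -166; -187; 473; -65; 176; 38; -1162]; [:: 937; 610; 798; -72;
      200; -497; -192; 324; 924; 680; 92; -193; -220; 554; -78; 206; 45; -1363]; [:: 2658; 1728;
      2263; -205; 570; -1409; -546; 919; 2620; 1926; 261; -550; -623; 1571; -219; 584; 127; -3865];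
      [:: 1253; 815; 1066; -95; 268; -664; -257; 433; 1235; 908; 122; -259; -293; 741; -103; 276;
      60; -1821]; [:: 23; 14; 19; -2; 5; -12; -5; 8; 22; 16; 2; -5; -6; 13; -2; 5; 1; -33]; [:: 524;
      341; 447; -41; 113; -278; -108; 181; 517; 380; 52; -108; -123; 310; -43; 115; 25; -763]; [::
      3912; 2543; 3330; -301; 838; -2074; -804; 1352; 3855; 2834; 384; -809; -917; 2312; -322; 860;
      187; -5687]; [:: 2; 1; 2; 0; 0; -1; 0; 1; 2; 1; 0; 0; 0; 1; 0; 0; 0; -2]]
    [:: [:: 3; 0; 6; 12; 15; 18; 24; 15; 6; 12; 3; 6; 6; 9; 12; 9; 6; 6]; [:: -15; -6; -18; -30;
      -42; -54; -66; -45; -24; -33; -12; -21; -30; -36; -45; -30; -15; -24]; [:: -60; -20; -81;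
      -141; -195; -249; -303; -204; -102; -153; -39; -78; -117; -153; -186; -126; -66; -93]; [::
      120; 39; 162; 285; 399; 510; 621; 417; 207; 318; 81; 159; 234; 306; 372; 252; 132; 186]; [::
      -177; -59; -234; -411; -576; -738; -900; -600; -300; -459; -120; -237; -351; -456; -558; -378;
      -198; -279]; [:: -72; -24; -96; -165; -231; -297; -360; -240; -120; -183; -48; -99; -147;
      -189; -231; -156; -81; -117]; [:: 6; 1; 9; 18; 27; 36; 45; 30; 15; 21; 3; 9; 15; 18; 21; 15;
      9; 9]; [:: 9; 3; 12; 21; 30; 39; 45; 30; 15; 21; 6; 12; 18; 24; 30; 21; 12; 12]; [:: -177;
      -59; -234; -414; -579; -741; -900; -600; -300; -459; -120; -237; -351; -456; -555; -375; -195;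
      -276]; [:: 165; 55; 219; 384; 537; 687; 837; 558; 279; 429; 114; 222; 327; 423; 513; 348; 180;
      258]; [:: 1146; 382; 1521; 2682; 3756; 4812; 5862; 3915; 1959; 2994; 768; 1518; 2244; 2904;
      3534; 2397; 1248; 1767]; [:: 489; 163; 648; 1143; 1599; 2049; 2499; 1668; 834; 1278; 330; 651;
      960; 1242; 1512; 1026; 534; 756]; [:: -1851; -617; -2457; -4329; -6066; -7770; -9465; -6321;
      -3162; -4839; -1242; -2451; -3624; -4692; -5709; -3873; -2013; -2856]; [:: 867; 289; 1152;
      2028; 2838; 3633; 4425; 2955; 1479; 2262; 582; 1149; 1698; 2199; 2676; 1815; 945; 1338]; [::
      -3813; -1271; -5061; -8913; -12489; -15999; -19488; -13011; -6510; -9960; -2559; -5055; -7476;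
      -9678; -11778; -7986; -4152; -5889]; [:: -4836; -1612; -6417; -11304; -15840; -20292; -24717;
      -16503; -8259; -12633; -3249; -6417; -9483; -12276; -14940; -10131; -5268; -7470]; [:: -18372;
      -6122; -24384; -42960; -60201; -77124; -93948; -62730; -31392; -48015; -12336; -24357; -36012;
      -46620; -56736; -38475; -20007; -28368]; [:: 651; 217; 864; 1524; 2136; 2736; 3330; 2223;
      1113; 1701; 435; 861; 1275; 1650; 2007; 1362; 708; 1002]]
    [:: [:: 1873; 5753; 3210; -25516; 14262; -8336; 14913; 12255; -21318; -12599; -6541; -13094;
      -25477; 18158; 9004; 1896; -1489; -45282]; [:: -1872; -5751; -3209; 25507; -14257; 8333;
      -14909; -12251; 21312; 12595; 6540; 13089; 25468; -18153; -9002; -1895; 1488; 45268]; [::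
      -295; -910; -507; 4034; -2254; 1319; -2359; -1938; 3371; 1992; 1034; 2070; 4029; -2871; -1424;
      -300; 236; 7160]; [:: -69; -208; -117; 927; -519; 302; -542; -445; 774; 457; 237; 476; 926;
      -660; -327; -69; 54; 1646]; [:: -16; -51; -28; 221; -123; 72; -128; -106; 184; 110; 57; 112;
      219; -157; -78; -16; 12; 391]; [:: -5; -15; -8; 70; -39; 23; -41; -33; 60; 34; 19; 37; 71;
      -50; -25; -6; 5; 125]; [:: -1; -5; -3; 17; -10; 5; -11; -9; 13; 9; 3; 9; 17; -12; -6; -1; 0;
      29]; [:: -7; -18; -11; 85; -47; 28; -48; -40; 72; 41; 23; 43; 85; -60; -30; -6; 6; 151]; [::
      -2; -9; -4; 35; -20; 12; -22; -17; 29; 18; 8; 18; 35; -26; -12; -3; 1; 63]; [:: -106; -325;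
      -181; 1446; -808; 473; -845; -695; 1208; 714; 371; 742; 1443; -1029; -510; -107; 85; 2567];
      [:: -17; -50; -28; 218; -122; 71; -128; -104; 182; 108; 56; 112; 218; -155; -77; -15; 13;
      388]; [:: -18; -57; -32; 256; -143; 83; -150; -123; 215; 126; 66; 131; 256; -182; -90; -20;
      15; 454]; [:: -53; -165; -91; 726; -406; 238; -424; -349; 605; 359; 185; 373; 724; -517; -257;
      -54; 43; 1288]; [:: -26; -76; -43; 342; -191; 112; -199; -165; 287; 169; 89; 176; 342; -243;
      -120; -25; 19; 608]; [:: 1; -1; -2; 6; -3; 1; -5; -2; 4; 2; 1; 2; 6; -4; -3; -1; 1; 10]; [::
      -11; -33; -17; 144; -81; 47; -83; -70; 120; 71; 36; 74; 143; -103; -51; -11; 8; 255]; [:: -79;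
      -240; -135; 1068; -597; 349; -624; -512; 893; 528; 274; 548; 1066; -759; -376; -79; 62; 1895];
      [:: -1; -1; 1; 0; 0; 1; 0; 0; 1; 1; 1; 1; 1; -1; 1; 1; 0; 1]]
    [:: [:: 1; 0; 0; -1; 1; -1; -1; 0; 1; 0; 1; -1; -1; -1; -1; 1; -1; 1]; [:: 0; 0; 0; 0; 0; 0; 0;
      0; 0; 0; 0; 0; 0; 0; 0; 0; 0; 0]; [:: -1; 0; -1; 1; -1; -1; 1; 0; 1; 1; 1; 1; -1; 0; 0; 1; -1;
      0]; [:: 1; -1; 0; 0; 1; 1; 0; -1; 1; 1; 1; 1; -1; 1; 0; 1; 0; -1]; [:: 0; 1; 0; -1; 0; 1; -1;
      -1; 0; -1; -1; 1; 0; 1; 0; 0; 1; 0]; [:: -1; 0; -1; 0; 0; 0; -1; -1; -1; 1; -1; -1; -1; 0; 0;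
      1; -1; 1]; [:: -1; 1; 0; -1; 1; 0; 1; 1; 1; 0; 1; -1; -1; 0; -1; -1; 0; 1]; [:: 0; -1; 0; 0;
      0; -1; -1; -1; -1; 1; -1; 1; -1; 0; -1; -1; -1; 0]; [:: -1; 1; -1; 1; 0; -1; 1; -1; 1; 0; 1;
      1; 1; 1; -1; 0; 1; 1]; [:: -1; -1; -1; 0; 0; -1; 0; 1; 1; 0; 0; 0; 1; 0; -1; -1; -1; 0]; [::
      1; 1; 1; 1; 0; 1; 1; -1; 0; 0; 0; 0; 0; -1; 0; -1; -1; -1]; [:: -1; 0; 0; 1; 0; 1; 1; 0; -1;
      0; 0; 0; 0; -1; 0; 1; -1; 0]; [:: -1; 1; 0; 1; 0; -1; 0; 1; 1; -1; 1; -1; 1; 0; 1; 1; -1; 0];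
      [:: 0; -1; 0; 1; -1; 0; -1; 1; -1; 0; -1; -1; 0; -1; 0; 0; 1; -1]; [:: -1; -1; 1; 1; -1; 1; 1;
      -1; 0; 0; 0; 1; 0; 0; 1; 1; 0; 1]; [:: 1; 0; -1; -1; 1; 0; -1; 1; -1; -1; 1; 0; 0; 1; 1; 1; 1;
      0]; [:: 1; -1; 1; 0; 0; 0; -1; -1; -1; -1; 1; 0; 1; -1; -1; 0; 1; 1]; [:: 1; 1; -1; 1; -1; -1;
      0; -1; -1; -1; -1; -1; -1; 1; -1; -1; 0; 0]]).

Definition symmetry9 : symmetry_data := SymmetryData
  [:: 35167; 11401; 21422; 36406; 71290; 104581; 137739; 170894; 116341; 58173; 85704; 33581; 65581;
    97138; 123231; 148992; 99333; 49669; 75275] 560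
  [:: [:: 2650909; 859684; 1614438; 2744706; 5371920; 7881642; 10379970; 12878298; 8767792; 4384224;
    6458038; 2532314; 4946452; 7326086; 9293358; 11235858; 7490572; 3745286; 5677222]; [:: -52465;
    -17014; -31952; -54321; -106317; -155988; -205433; -254878; -173526; -86769; -127813; -50118;
    -97897; -144993; -183928; -222372; -148248; -74124; -112359]; [:: -1184596; -384162; -721434;
    -1226511; -2400519; -3522024; -4638437; -5754850; -3918012; -1959153; -2885866; -1131600;
    -2210392; -3273765; -4152868; -5020902; -3347268; -1673634; -2536947]; [:: -58746; -19051;
    -35777; -60824; -119046; -174663; -230028; -285393; -194301; -97158; -143115; -56118; -109617;
    -162351; -205947; -248994; -165996; -82998; -125811]; [:: -58746; -19051; -35777; -60825;
    -119045; -174663; -230028; -285393; -194301; -97158; -143115; -56118; -109617; -162351; -205947;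
    -248994; -165996; -82998; -125811]; [:: -5697; -1848; -3470; -5898; -11544; -16937; -22306;
    -27674; -18841; -9421; -13878; -5442; -10630; -15744; -19972; -24147; -16098; -8049; -12201];
    [:: 0; 0; 0; 0; 0; 0; 1; 0; 0; 0; 0; 0; 0; 0; 0; 0; 0; 0; 0]; [:: -75398; -24451; -45918;
    -78066; -152790; -224172; -295231; -366289; -249377; -124698; -183682; -72025; -140689; -208372;
    -264326; -319575; -213050; -106525; -161474]; [:: -136531; -44277; -83149; -141362; -276673;
    -405933; -534606; -663279; -451573; -225803; -332612; -130423; -254759; -377318; -478639;
    -578685; -385790; -192895; -292396]; [:: -328; -106; -200; -340; -665; -975; -1284; -1593;
    -1084; -542; -799; -313; -612; -906; -1149; -1389; -926; -463; -702]; [:: -18889; -6126; -11504;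
    -19557; -38277; -56160; -73961; -91762; -62473; -31239; -46015; -18044; -35246; -52202; -66220;
    -80061; -53374; -26687; -40453]; [:: -59088; -19162; -35985; -61179; -119739; -175680; -231367;
    -287054; -195432; -97723; -143948; -56445; -110256; -163297; -207148; -250446; -166964; -83482;
    -126545]; [:: -17252; -5595; -10507; -17863; -34961; -51294; -67553; -83812; -57061; -28533;
    -42029; -16480; -32190; -47676; -60478; -73119; -48746; -24373; -36945]; [:: -206181; -66864;
    -125567; -213476; -417814; -613014; -807328; -1001642; -681937; -340994; -502290; -196956;
    -384722; -569804; -722814; -873897; -582598; -291299; -441560]; [:: -12386; -4017; -7543;
    -12824; -25099; -36825; -48498; -60171; -40965; -20484; -30174; -11833; -23113; -34232; -43424;
    -52500; -35000; -17500; -26527]; [:: -5282; -1713; -3217; -5469; -10704; -15705; -20683; -25661;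
    -17471; -8736; -12868; -5045; -9855; -14596; -18515; -22385; -14924; -7462; -11311]; [:: 0; 0;
    0; 0; 0; 0; 0; 0; 0; 0; 0; 0; 0; 0; 0; 0; 1; 0; 0]; [:: 0; 0; 0; 0; 0; 0; 0; 0; 0; 0; 0; 0; 0;
    0; 0; 0; 0; 1; 0]; [:: -59293; -19228; -36110; -61391; -120154; -176289; -232169; -288049;
    -196109; -98062; -144447; -56641; -110638; -163864; -207867; -251316; -167544; -83772; -126984]]
  (Bases
    [:: [:: 0; 0; 0; 0; 0; 0; 0; 0; 0; -1; 0; 0; 0; 0; 0; 0; 0; 1; 0]; [:: 1; 0; 1; 1; 1; 3; 3; 4;
      3; 1; 2; 1; 1; 2; 2; 2; 1; 1; 1]; [:: -2; -1; -1; -2; -4; -6; -9; -10; -7; -4; -5; -2; -4; -6;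
      -8; -10; -7; -4; -5]; [:: -9; -3; -6; -9; -18; -27; -34; -42; -29; -14; -21; -8; -16; -24;
      -30; -36; -24; -12; -18]; [:: 12; 4; 7; 13; 26; 38; 50; 62; 42; 21; 31; 11; 22; 32; 40; 48;
      32; 17; 24]; [:: -124; -40; -75; -129; -253; -370; -487; -604; -411; -205; -303; -119; -232;
      -343; -436; -528; -352; -176; -267]; [:: -123; -40; -75; -128; -250; -367; -483; -600; -408;
      -204; -301; -117; -228; -338; -429; -519; -345; -172; -262]; [:: -3; -1; -2; -3; -6; -9; -11;
      -14; -9; -4; -7; -3; -5; -8; -11; -13; -8; -4; -7]; [:: -36; -12; -22; -38; -74; -107; -141;
      -175; -119; -60; -88; -34; -67; -99; -125; -151; -101; -50; -76]; [:: 322; 104; 196; 334; 653;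
      958; 1261; 1565; 1065; 533; 785; 308; 601; 890; 1129; 1364; 909; 454; 689]; [:: 100; 32; 61;
      104; 202; 297; 391; 486; 331; 165; 244; 95; 186; 276; 350; 423; 282; 141; 214]; [:: -440;
      -143; -268; -455; -892; -1308; -1723; -2138; -1455; -728; -1072; -420; -821; -1216; -1542;
      -1865; -1243; -621; -942]; [:: 217; 71; 132; 224; 439; 644; 849; 1053; 717; 358; 528; 208;
      406; 601; 763; 922; 615; 308; 466]; [:: -221; -72; -135; -228; -447; -655; -863; -1071; -729;
      -365; -537; -211; -413; -611; -775; -937; -625; -312; -474]; [:: -680; -220; -414; -704;
      -1378; -2022; -2662; -3303; -2249; -1124; -1656; -650; -1269; -1880; -2385; -2883; -1922;
      -961; -1457]; [:: 118; 38; 72; 122; 239; 351; 461; 573; 390; 195; 287; 113; 220; 326; 413;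
      499; 333; 167; 252]; [:: 2522; 818; 1536; 2610; 5112; 7499; 9877; 12255; 8343; 4172; 6146;
      2408; 4704; 6968; 8840; 10688; 7126; 3563; 5400]; [:: 2782; 902; 1695; 2880; 5639; 8273;
      10896; 13518; 9203; 4602; 6779; 2656; 5187; 7684; 9748; 11786; 7858; 3929; 5954]; [:: -105;
      -34; -64; -109; -213; -312; -411; -510; -347; -174; -256; -100; -196; -290; -368; -445; -297;
      -148; -225]]
    [:: [:: -34964; -14708; -13537; -14242; 9698; -24175; 20214; -10155; -335; 19195; 48599; -8228;
      3980; -19516; 25588; 4449; -9075; 9525; 70334]; [:: 685; 289; 265; 279; -190; 474; -397; 199;
      6; -377; -953; 161; -77; 383; -502; -87; 178; -187; -1380]; [:: 15632; 6575; 6052; 6367;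
      -4336; 10808; -9037; 4540; 150; -8581; -21727; 3679; -1780; 8724; -11439; -1989; 4057; -4258;
      -31443]; [:: 757; 318; 292; 308; -210; 523; -438; 220; 7; -415; -1051; 178; -86; 422; -554;
      -96; 196; -206; -1522]; [:: 793; 333; 307; 323; -220; 548; -458; 230; 7; -435; -1102; 187;
      -91; 442; -580; -101; 206; -216; -1593]; [:: 65; 28; 25; 26; -18; 45; -38; 19; 1; -36; -91;
      15; -7; 37; -48; -8; 17; -18; -133]; [:: 1; 1; 1; 1; 0; 1; 0; 0; 0; -1; -2; 0; 0; 1; -1; -1;
      0; 0; -3]; [:: 996; 418; 386; 406; -276; 689; -576; 289; 10; -547; -1384; 234; -113; 556;
      -729; -126; 258; -271; -2004]; [:: 1798; 756; 696; 732; -499; 1243; -1040; 523; 17; -987;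
      -2499; 424; -205; 1003; -1316; -229; 467; -490; -3615]; [:: 3; 1; 0; 1; -1; 2; -2; 1; 0; -1;
      -4; 1; -1; 1; -2; 0; 1; -1; -5]; [:: 255; 109; 99; 104; -71; 176; -147; 74; 2; -140; -355; 60;
      -29; 143; -186; -33; 67; -70; -514]; [:: 785; 332; 305; 321; -218; 543; -454; 228; 7; -432;
      -1093; 185; -89; 439; -575; -100; 204; -214; -1581]; [:: 221; 92; 85; 89; -61; 152; -128; 65;
      3; -120; -306; 52; -25; 122; -161; -28; 57; -60; -443]; [:: 2715; 1144; 1052; 1107; -753;
      1878; -1569; 788; 25; -1492; -3775; 638; -309; 1517; -1988; -346; 705; -740; -5464]; [:: 166;
      68; 64; 67; -46; 115; -96; 48; 2; -90; -230; 40; -19; 92; -121; -21; 43; -45; -332]; [:: 74;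
      30; 27; 29; -21; 50; -43; 22; 1; -39; -101; 17; -9; 40; -53; -9; 19; -20; -145]; [:: 0; 1; 2;
      1; 0; 1; 0; 0; 0; -2; -2; 0; 1; 2; -1; 0; 0; 0; -5]; [:: 4; 1; 0; 1; -1; 2; -2; 1; 0; -1; -4;
      1; -1; 1; -2; 0; 1; -1; -5]; [:: 773; 327; 300; 316; -214; 535; -447; 224; 7; -426; -1076;
      182; -88; 432; -567; -99; 201; -211; -1558]]
    [:: [:: -3; 1; -1; -6; -12; -21; -27; -33; -21; -12; -15; 0; 0; 0; 0; 0; 0; 0; 0]; [:: 45; 15;
      27; 48; 96; 141; 183; 228; 153; 78; 114; 42; 81; 120; 153; 183; 120; 60; 93]; [:: -15; -5;
      -10; -15; -30; -45; -60; -72; -48; -24; -36; -15; -27; -39; -48; -60; -42; -21; -30]; [:: 342;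
      110; 208; 354; 693; 1017; 1341; 1665; 1134; 567; 834; 324; 636; 945; 1197; 1449; 966; 483;
      732]; [:: 603; 194; 367; 624; 1221; 1794; 2364; 2934; 1998; 999; 1470; 576; 1125; 1665; 2112;
      2553; 1701; 852; 1290]; [:: 1047; 340; 638; 1086; 2124; 3117; 4104; 5091; 3465; 1734; 2553;
      999; 1950; 2889; 3666; 4431; 2952; 1476; 2238]; [:: -54; -16; -32; -57; -111; -162; -213;
      -264; -180; -90; -132; -54; -102; -150; -192; -234; -156; -78; -120]; [:: 318; 104; 193; 330;
      648; 948; 1248; 1548; 1053; 525; 777; 303; 594; 879; 1116; 1350; 900; 450; 681]; [:: 945; 306;
      576; 978; 1914; 2805; 3693; 4581; 3120; 1560; 2298; 903; 1767; 2616; 3318; 4011; 2673; 1338;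
      2025]; [:: -375; -122; -229; -387; -759; -1110; -1464; -1815; -1236; -618; -909; -360; -702;
      -1038; -1317; -1593; -1062; -531; -804]; [:: -123; -40; -74; -129; -252; -369; -486; -603;
      -411; -204; -303; -117; -228; -339; -429; -519; -345; -171; -264]; [:: 273; 88; 167; 282; 552;
      810; 1065; 1320; 897; 450; 663; 261; 510; 756; 960; 1161; 774; 387; 588]; [:: 627; 203; 382;
      648; 1272; 1866; 2457; 3048; 2076; 1038; 1527; 597; 1170; 1731; 2196; 2655; 1770; 885; 1341];
      [:: -1314; -427; -800; -1359; -2661; -3906; -5145; -6384; -4347; -2172; -3201; -1254; -2451;
      -3633; -4608; -5571; -3714; -1857; -2814]; [:: 516; 170; 316; 534; 1044; 1530; 2016; 2502;
      1704; 852; 1254; 492; 960; 1422; 1803; 2178; 1452; 726; 1101]; [:: 675; 218; 412; 699; 1365;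
      2001; 2637; 3273; 2229; 1113; 1641; 645; 1260; 1866; 2367; 2862; 1908; 954; 1446]; [:: -2136;
      -694; -1301; -2211; -4329; -6348; -8361; -10374; -7062; -3531; -5202; -2043; -3987; -5904;
      -7488; -9054; -6036; -3018; -4575]; [:: 6990; 2267; 4258; 7236; 14169; 20784; 27375; 33966;
      23124; 11562; 17034; 6675; 13035; 19308; 24498; 29619; 19746; 9873; 14964]; [:: 42; 14; 25;
      45; 90; 132; 174; 216; 144; 72; 108; 39; 75; 111; 141; 171; 114; 57; 87]]
    [:: [:: 8738; -7996; 3045; -3191; -9969; 6434; -3298; -20341; 8486; 4951; 1483; -8715; 9841;
      -1324; -4986; 1485; 2286; 150; 23444]; [:: -172; 156; -59; 62; 195; -126; 64; 400; -166; -97;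
      -29; 171; -193; 26; 98; -30; -45; -3; -460]; [:: -3906; 3575; -1362; 1427; 4457; -2876; 1475;
      9093; -3794; -2213; -663; 3896; -4399; 592; 2229; -663; -1022; -67; -10481]; [:: -190; 172;
      -66; 70; 216; -139; 71; 440; -183; -106; -33; 189; -214; 28; 108; -31; -50; -4; -507]; [::
      -198; 182; -68; 71; 225; -146; 74; 461; -192; -113; -33; 197; -222; 30; 113; -35; -52; -3;
      -531]; [:: -16; 15; -7; 7; 19; -12; 7; 39; -17; -9; -2; 16; -19; 3; 9; -2; -4; 0; -44]; [:: 0;
      0; 0; 0; 1; 0; 0; 0; 1; -1; -1; 1; 0; 0; 1; 0; 0; -1; -1]; [:: -250; 228; -86; 91; 283; -184;
      94; 580; -243; -141; -43; 249; -281; 37; 141; -42; -66; -3; -669]; [:: -448; 411; -158; 164;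
      513; -331; 169; 1046; -436; -254; -75; 447; -505; 68; 257; -77; -117; -8; -1204]; [:: -1; 1;
      1; 0; 0; 0; 0; 1; -1; 0; -1; 1; -1; 0; 0; 0; 0; 0; -2]; [:: -64; 58; -22; 23; 74; -46; 25;
      148; -61; -36; -10; 63; -72; 11; 37; -11; -16; -2; -171]; [:: -196; 179; -69; 71; 225; -145;
      74; 458; -191; -112; -33; 196; -221; 30; 111; -34; -51; -4; -528]; [:: -55; 51; -19; 20; 62;
      -41; 21; 127; -54; -31; -10; 54; -61; 8; 32; -9; -15; -1; -147]; [:: -679; 621; -237; 249;
      775; -499; 256; 1581; -659; -384; -115; 678; -766; 103; 388; -115; -178; -11; -1821]; [:: -41;
      38; -14; 14; 46; -31; 16; 96; -39; -24; -7; 41; -46; 6; 23; -8; -10; -1; -111]; [:: -18; 16;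
      -6; 7; 22; -13; 7; 41; -19; -10; -3; 17; -19; 3; 10; -2; -5; 0; -48]; [:: -1; 0; -1; 0; 0; -1;
      1; 2; 0; -1; 0; 1; -2; -1; 0; 0; 0; 0; -2]; [:: 0; 1; 0; 0; 1; 0; -1; 2; -1; 0; 0; 1; 0; 1; 1;
      0; 0; 0; -1]; [:: -194; 178; -67; 71; 220; -142; 72; 451; -187; -109; -33; 194; -219; 30; 111;
      -34; -51; -4; -520]]
    [:: [:: -1; -1; 0; 0; 0; 1; 1; 0; 0; 1; 0; 0; 1; 0; 0; 1; -1; 0; -1]; [:: 1; 1; -1; 1; 1; 0; 1;
      -1; -1; 0; 0; 0; 0; 0; 0; 1; 0; 0; 0]; [:: 0; 0; 0; 0; 0; 0; 0; 0; 0; 0; 0; 0; 0; 0; 0; 0; 0;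
      0; 0]; [:: 1; 1; 0; -1; 0; 0; 1; 0; -1; -1; 1; 0; 1; 1; 0; -1; 1; 1; -1]; [:: 0; 0; -1; 1; 1;
      0; 1; -1; 0; 1; -1; 1; -1; 0; 0; 1; 1; 0; -1]; [:: -1; 1; 1; -1; 0; 0; -1; -1; 1; 1; -1; 1; 0;
      -1; 0; -1; 0; 0; -1]; [:: -1; 1; 0; 0; 0; 0; 0; 1; -1; 1; 1; 0; -1; 0; -1; -1; 0; 1; 0]; [::
      1; 1; -1; 1; 1; 1; 0; 0; 1; 0; 1; 0; 0; 1; 0; 0; 0; -1; 1]; [:: -1; 0; 1; 1; 0; 1; 1; -1; 1;
      -1; -1; 1; -1; 1; -1; 1; -1; 0; -1]; [:: 0; -1; -1; 1; 1; 0; 1; 0; 1; -1; 1; 0; 0; 1; 0; 0;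
      -1; 0; 0]; [:: 1; 1; -1; 1; -1; -1; -1; 1; -1; 0; -1; 1; 0; -1; -1; 0; -1; 1; 0]; [:: -1; 1;
      1; 1; -1; 1; 0; -1; 1; 1; 0; 0; -1; 0; 1; 1; 0; 1; 1]; [:: -1; -1; 1; 0; 1; 1; 0; 1; 1; 0; 1;
      1; -1; 1; -1; 0; 1; 0; -1]; [:: -1; 0; 1; -1; 0; -1; 0; -1; 0; -1; 0; -1; 1; 0; -1; 0; 1; -1;
      -1]; [:: -1; 0; 0; 1; 1; 0; -1; 0; -1; 0; 0; 0; -1; 0; 1; 1; 0; 0; 0]; [:: 1; 1; -1; 1; -1; 0;
      -1; 1; 1; 0; 0; 0; -1; 0; 1; -1; 1; 0; 0]; [:: 0; 1; 1; 1; 0; 0; -1; -1; 0; 1; 0; -1; 1; 1; 1;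
      -1; 0; 0; 0]; [:: -1; 0; 0; 1; 0; -1; 1; -1; 1; 0; 0; -1; -1; -1; 0; -1; 0; 0; -1]; [:: 1; -1;
      -1; 0; 1; -1; 1; 0; -1; -1; 0; -1; 1; -1; 0; 1; 1; 1; 1]]).

(** Again the matrix of [symmetry6], extended by the identity on the second E8. *)
Definition symmetry10 : symmetry_data := SymmetryData
  [:: 105; -101; 33; 65; 95; 185; 265; 340; 409; 275; 138; 199; 3; -43; -68; -64; -63; -28; -17;
    -30; 56] 546
  [:: [:: 6; -6; 2; 4; 6; 12; 18; 24; 30; 20; 10; 15; 0; 0; 0; 0; 0; 0; 0; 0; 3]; [:: -6; 6; -2; -4;
    -6; -12; -18; -24; -29; -20; -10; -15; 0; 0; 0; 0; 0; 0; 0; 0; -3]; [:: 0; 0; 0; 0; 0; 0; 0; 0;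
    0; 0; 1; 0; 0; 0; 0; 0; 0; 0; 0; 0; 0]; [:: -6; 6; -2; -4; -6; -12; -18; -24; -30; -21; -11;
    -15; 0; 0; 0; 0; 0; 0; 0; 0; -3]; [:: 0; 0; 0; 0; 0; 0; 1; 0; 0; 0; 0; 0; 0; 0; 0; 0; 0; 0; 0;
    0; 0]; [:: 0; 0; 0; 0; 0; 1; 0; 0; 0; 0; 0; 0; 0; 0; 0; 0; 0; 0; 0; 0; 0]; [:: 0; 0; 0; 0; 1; 0;
    0; 0; 0; 0; 0; 0; 0; 0; 0; 0; 0; 0; 0; 0; 0]; [:: -1; 0; 0; 0; -2; -3; -4; -5; -6; -4; -2; -3;
    0; 0; 0; 0; 0; 0; 0; 0; 0]; [:: 1; 1; 0; 0; 0; 0; 0; 0; 0; 0; 0; 0; 0; 0; 0; 0; 0; 0; 0; 0; 0];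
    [:: -1; 0; -1; -1; 0; 0; 0; 0; 0; 0; 0; 0; 0; 0; 0; 0; 0; 0; 0; 0; 0]; [:: 0; 0; 1; 0; 0; 0; 0;
    0; 0; 0; 0; 0; 0; 0; 0; 0; 0; 0; 0; 0; 0]; [:: -1; 0; 0; 0; 0; 0; 0; 0; 0; 0; 0; 0; 0; 0; 0; 0;
    0; 0; 0; 0; -1]; [:: 0; 0; 0; 0; 0; 0; 0; 0; 0; 0; 0; 0; 1; 0; 0; 0; 0; 0; 0; 0; 0]; [:: 0; 0;
    0; 0; 0; 0; 0; 0; 0; 0; 0; 0; 0; 1; 0; 0; 0; 0; 0; 0; 0]; [:: 0; 0; 0; 0; 0; 0; 0; 0; 0; 0; 0;
    0; 0; 0; 1; 0; 0; 0; 0; 0; 0]; [:: 0; 0; 0; 0; 0; 0; 0; 0; 0; 0; 0; 0; 0; 0; 0; 1; 0; 0; 0; 0;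
    0]; [:: 0; 0; 0; 0; 0; 0; 0; 0; 0; 0; 0; 0; 0; 0; 0; 0; 1; 0; 0; 0; 0]; [:: 0; 0; 0; 0; 0; 0; 0;
    0; 0; 0; 0; 0; 0; 0; 0; 0; 0; 1; 0; 0; 0]; [:: 0; 0; 0; 0; 0; 0; 0; 0; 0; 0; 0; 0; 0; 0; 0; 0;
    0; 0; 1; 0; 0]; [:: 0; 0; 0; 0; 0; 0; 0; 0; 0; 0; 0; 0; 0; 0; 0; 0; 0; 0; 0; 1; 0]; [:: -6; 6;
    -2; -4; -6; -12; -18; -24; -30; -20; -10; -16; 0; 0; 0; 0; 0; 0; 0; 0; -3]]
  (Bases
    [:: [:: -1; -1; 0; 0; 0; 0; 0; 0; 1; 0; 0; 0; 0; 0; 0; 0; 0; 0; 0; 0; 0]; [:: 1; 0; 0; 1; 0; 0;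
      0; 0; 1; 0; 0; 0; 0; 0; 0; 0; 0; 0; 0; 0; 0]; [:: 0; -1; 0; 1; 0; 0; 0; 0; 1; 1; 1; 0; 0; 0;
      0; 0; 0; 0; 0; 0; 0]; [:: 0; -1; 1; 1; 0; 0; 0; 0; 1; 1; 0; 0; 0; 0; 0; 0; 0; 0; 0; 0; 0]; [::
      0; 0; 0; 0; 0; 0; 1; 1; 0; 0; 0; 1; 0; 0; 0; 0; 0; 0; 0; 0; 0]; [:: -1; 0; -1; -1; 0; 0; 0;
      -1; -1; -1; -1; -1; 0; 0; 0; 0; 0; 0; 0; 0; 0]; [:: 0; 0; 0; 0; 0; 0; 0; 0; -2; -1; 0; -1; 0;
      0; 0; 0; 0; 0; 0; 0; 0]; [:: 1; -1; 1; 1; 0; 0; 0; 0; -1; 0; 0; 0; 0; 0; 0; 0; 0; 0; 0; 0; 1];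
      [:: 2; -1; 1; 1; 2; 3; 4; 6; 7; 5; 2; 4; 0; 0; 0; 0; 0; 0; 0; 0; 1]; [:: -2; 1; -1; -1; -1;
      -3; -5; -6; -7; -5; -2; -4; 0; 0; 0; 0; 0; 0; 0; 0; -1]; [:: -1; 1; 0; -1; -1; -2; -3; -3; -4;
      -2; -1; -2; 0; 1; 1; 0; 0; 0; 0; 0; 0]; [:: 3; -2; 1; 1; 2; 4; 6; 8; 9; 6; 3; 4; 0; -1; -1; 0;
      0; 0; 0; 0; 2]; [:: 3; -2; 1; 2; 3; 5; 7; 8; 10; 7; 3; 5; 1; 0; 0; 0; 0; 0; 0; 0; 1]; [:: 1;
      -2; 0; 1; 1; 2; 3; 4; 5; 3; 2; 2; 0; 0; -1; 0; 0; 0; 0; 0; 1]; [:: -1; 2; 0; -1; -1; -2; -2;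
      -2; -3; -2; -1; -1; 0; 1; 1; 1; 0; 0; 0; 0; -1]; [:: 1; -1; 0; 0; 1; 2; 3; 3; 3; 2; 1; 2; 1;
      1; 1; 1; 2; 2; 1; 1; 1]; [:: -3; 2; -1; -2; -2; -4; -6; -7; -8; -5; -2; -4; -1; 0; 1; 1; 1; 0;
      0; 0; -1]; [:: -3; 4; -1; -2; -4; -7; -9; -12; -14; -9; -5; -7; 1; 3; 4; 4; 4; 2; 1; 2; -2];
      [:: -2; 2; 0; -1; -2; -4; -7; -8; -10; -7; -4; -5; 0; 1; 2; 2; 2; 1; 1; 1; -1]; [:: 9; -8; 3;
      6; 8; 16; 22; 29; 35; 24; 12; 17; 0; -4; -6; -6; -6; -3; -2; -3; 4]; [:: 0; 0; 1; 0; 0; 0; 0;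
      0; 0; 0; 0; 0; 0; 0; 0; 0; 0; 0; 0; 0; 0]]
    [:: [:: 35; -15; -83; 51; -56; -81; 23; -4; -29; -27; 3; 3; 28; 0; 0; 0; 0; -28; -28; -28;
      -101]; [:: -37; 16; 86; -53; 58; 84; -24; 4; 30; 28; -3; -3; -29; 0; 0; 0; 0; 29; 29; 29;
      105]; [:: 0; 0; 0; 0; 0; 0; 0; 0; 0; 0; 0; 0; 0; 0; 0; 0; 0; 0; 0; 0; 1]; [:: -34; 15; 80;
      -49; 54; 78; -22; 4; 28; 26; -3; -3; -27; 0; 0; 0; 0; 27; 27; 27; 97]; [:: -2; 1; 4; -2; 3; 4;
      -1; 0; 2; 2; 0; 0; -1; 0; 0; 0; 0; 1; 1; 1; 5]; [:: -3; 1; 8; -6; 4; 8; -2; 1; 3; 2; -1; -1;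
      -3; 0; 0; 0; 0; 3; 3; 3; 10]; [:: -2; 1; 4; -2; 3; 4; -1; 0; 1; 1; 0; 0; -1; 0; 0; 0; 0; 1; 1;
      1; 5]; [:: -2; 1; 5; -3; 4; 5; -1; 0; 2; 2; 0; 0; -2; 0; 0; 0; 0; 2; 2; 2; 6]; [:: -1; 1; 3;
      -2; 2; 3; -1; 0; 1; 1; 0; 0; -1; 0; 0; 0; 0; 1; 1; 1; 4]; [:: -2; 0; 3; -1; 2; 3; -1; 0; 1; 1;
      0; 0; -1; 0; 0; 0; 0; 1; 1; 1; 3]; [:: 0; 0; 1; -1; 0; 0; 0; 0; 0; 0; 0; 0; 0; 0; 0; 0; 0; 0;
      0; 0; 1]; [:: 4; -2; -9; 5; -6; -9; 2; 0; -3; -3; 0; 0; 3; 0; 0; 0; 0; -3; -3; -3; -11]; [::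
      -17; 7; 40; -25; 28; 39; -12; 2; 13; 14; -1; -1; -13; 0; 0; 0; 0; 14; 14; 14; 49]; [:: 7; -3;
      -18; 11; -12; -17; 5; -1; -6; -6; 1; 0; 6; 1; 0; 0; 0; -6; -6; -6; -21]; [:: 11; -4; -23; 14;
      -16; -23; 7; -1; -8; -8; 1; 1; 8; -1; 0; 0; 0; -8; -8; -8; -29]; [:: -1; 0; 3; -2; 1; 3; -1;
      1; 1; 1; -1; 0; -1; 0; 1; 0; 0; 1; 1; 1; 3]; [:: 1; 0; -5; 3; -1; -4; 1; -1; -2; -1; 1; 0; 2;
      1; -1; 0; 1; -1; -1; -1; -4]; [:: -8; 4; 20; -12; 12; 20; -5; 2; 8; 7; -2; -1; -8; -1; 1; 1;
      0; 7; 6; 7; 24]; [:: 0; -1; -4; 4; -1; -5; 0; -2; -4; -2; 2; 1; 3; 1; 0; 0; 0; -3; 0; -2; -6];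
      [:: 0; -1; 4; -3; 0; 2; 0; 0; 3; 0; -1; 0; -2; -1; -1; -1; -2; 1; 0; 0; 3]; [:: -39; 17; 92;
      -57; 62; 90; -26; 5; 32; 30; -3; -3; -31; 0; 0; 0; 0; 31; 31; 31; 112]]
    [:: [:: 0; -3; 1; 2; 3; 3; 3; 6; 9; 6; 3; 3; 0; 0; 0; 0; 0; 0; 0; 0; 0]; [:: -3; 0; -1; -2; -3;
      -3; -3; -6; -6; -6; -3; -3; 0; 0; 0; 0; 0; 0; 0; 0; 0]; [:: 3; 0; 1; 2; 0; 3; 6; 6; 6; 6; 3;
      3; 0; 0; 0; 0; 0; 0; 0; 0; 0]; [:: 0; 0; -1; 1; 0; -3; -6; -6; -6; -3; 0; -3; 0; 0; 0; 0; 0;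
      0; 0; 0; 0]; [:: 0; 0; 2; 1; 0; -3; -6; -6; -6; -3; -3; -3; 0; 0; 0; 0; 0; 0; 0; 0; 0]; [:: 6;
      -3; 1; 2; 6; 12; 18; 24; 27; 18; 9; 15; 0; 0; 0; 0; 0; 0; 0; 0; 3]; [:: 0; 3; -1; -2; -3; -3;
      -6; -9; -9; -6; -3; -6; 0; 0; 0; 0; 0; 0; 0; 0; 0]; [:: -3; 0; 1; -1; -3; -6; -9; -12; -18;
      -12; -6; -9; 0; 0; 0; 0; 0; 0; 0; 0; 0]; [:: 0; 0; 1; 2; -3; -6; -9; -12; -15; -12; -6; -9; 0;
      0; 0; 0; 0; 0; 0; 0; 0]; [:: 0; 0; -2; -1; 3; 3; 3; 3; 3; 3; 0; 0; 0; 0; 0; 0; 0; 0; 0; 0; 0];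
      [:: -12; 9; -4; -8; -9; -18; -24; -30; -36; -24; -12; -18; 0; 3; 3; 0; 0; 0; 0; 0; -6]; [:: 6;
      -6; 2; 4; 6; 9; 15; 21; 27; 18; 9; 12; 0; -3; -3; 0; 0; 0; 0; 0; 3]; [:: 3; -3; 3; 3; 3; 6; 9;
      9; 12; 6; 3; 6; 3; 0; 0; 0; 0; 0; 0; 0; 0]; [:: 3; -3; 1; 2; 0; 0; 0; 0; 0; 0; 0; 0; 0; 0; -3;
      0; 0; 0; 0; 0; 3]; [:: -6; 6; -2; -4; -6; -12; -15; -21; -24; -15; -9; -12; 0; 3; 3; 3; 0; 0;
      0; 0; -3]; [:: 6; -6; 2; 4; 6; 12; 18; 21; 24; 18; 9; 12; 3; 3; 3; 3; 6; 6; 3; 3; 3]; [:: -12;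
      12; -4; -8; -12; -24; -33; -42; -51; -36; -18; -24; -3; 0; 3; 3; 3; 0; 0; 0; -6]; [:: -12; 12;
      -4; -8; -12; -24; -33; -42; -54; -36; -18; -27; 3; 9; 12; 12; 12; 6; 3; 6; -6]; [:: -9; 9; -2;
      -4; -9; -18; -27; -33; -39; -27; -15; -18; 0; 3; 6; 6; 6; 3; 3; 3; -6]; [:: 24; -21; 7; 14;
      21; 42; 57; 75; 90; 60; 30; 45; 0; -12; -18; -18; -18; -9; -6; -9; 12]; [:: 3; 0; 1; 2; 0; 3;
      6; 9; 9; 6; 3; 6; 0; 0; 0; 0; 0; 0; 0; 0; 0]]
    [:: [:: 2; 9; -11; 15; 8; 1; 11; 13; -5; 16; 1; 1; 9; 0; 0; 0; 0; -9; -9; -9; 34]; [:: -2; -9;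
      12; -16; -9; -1; -12; -14; 5; -17; -1; -1; -10; 0; 0; 0; 0; 10; 10; 10; -35]; [:: 0; -1; 0;
      -1; 0; 0; 0; 0; 0; -1; 0; 0; 0; 0; 0; 0; 0; 0; 0; 0; -1]; [:: -2; -8; 11; -14; -8; -1; -11;
      -13; 5; -15; -1; -1; -9; 0; 0; 0; 0; 9; 9; 9; -32]; [:: 0; -1; 0; 0; 0; 0; -1; -1; 1; -1; 0;
      0; -1; 0; 0; 0; 0; 1; 1; 1; -2]; [:: -1; -1; 1; -2; -2; 0; -1; -2; 0; -1; 0; 0; -1; 0; 0; 0;
      0; 1; 1; 1; -4]; [:: 1; -1; 0; -1; 1; -1; -1; 0; 0; -1; -1; -1; 0; 0; 0; 0; 0; 0; 0; 0; -1];
      [:: -1; 0; 2; 0; -2; 1; 0; 0; 1; -1; 1; 1; 0; 0; 0; 0; 0; 0; 0; 0; -2]; [:: 0; 0; -1; -2; 1;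
      0; -1; -1; 0; 0; 0; 0; -2; 0; 0; 0; 0; 2; 2; 2; -1]; [:: 1; 0; 2; 1; 0; -1; -1; -1; -1; -1;
      -1; -1; 1; 0; 0; 0; 0; -1; -1; -1; -2]; [:: -1; 0; -1; -1; -1; 1; 1; 1; 1; 0; 1; 1; -1; 0; 0;
      0; 0; 1; 1; 1; 0]; [:: 0; 0; -1; 2; 0; 0; 2; 1; 0; 1; 0; 0; 2; 0; 0; 0; 0; -2; -2; -2; 4]; [::
      -1; -3; 6; -8; -3; 0; -5; -7; 2; -8; 0; 0; -4; 0; 0; -1; 0; 5; 4; 4; -16]; [:: 1; 1; -3; 4; 1;
      1; 3; 3; 0; 3; 1; -1; 2; 0; 0; 1; 0; -2; -2; -2; 6]; [:: 0; 3; -3; 4; 2; 0; 2; 4; -2; 5; -1;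
      1; 3; 0; 0; 0; 0; -2; -2; -2; 11]; [:: 0; -1; 1; 0; 0; -1; 1; 0; 0; -1; 1; 0; -1; 0; 0; -1; 0;
      -1; 0; 0; -2]; [:: 1; 1; -1; 1; 1; 2; -1; 0; 0; 2; -1; 1; 1; 0; 0; 1; 0; 1; 0; 0; 2]; [:: -1;
      -3; 3; -5; -2; -2; -2; -4; 1; -5; 0; -1; -2; 0; 0; -1; 0; 1; 1; 2; -9]; [:: 0; 1; -1; 2; 0; 2;
      1; 2; 0; 1; 1; 0; 0; 0; 0; 1; 0; 0; 1; -1; 3]; [:: -1; 0; 0; -1; -1; -2; 0; 0; 0; -1; 0; -1;
      -1; 0; 0; 0; 0; 0; 0; 0; -1]; [:: -3; -10; 12; -17; -9; 0; -13; -14; 5; -17; -1; -1; -11; 0;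
      0; 0; 0; 11; 11; 11; -38]]
    [:: [:: -1; -1; -1; 1; 1; 0; 1; 0; 1; 1; 0; 0; 1; 0; 0; 0; 0; -1; -1; -1; 0]; [:: 0; -1; -1; 0;
      1; 0; 1; 1; 0; 0; 0; 0; 1; 0; 0; 0; 0; -1; -1; -1; -1]; [:: 0; 1; 0; 1; 0; 0; 0; 0; 0; 1; 0;
      0; 0; 0; 0; 0; 0; 0; 0; 0; 1]; [:: 0; 0; 0; 0; 0; 0; 0; 0; 0; 0; 0; 0; 0; 0; 0; 0; 0; 0; 0; 0;
      0]; [:: 0; 1; 1; -1; 0; 0; 1; 1; -1; 0; 0; 0; 1; 0; 0; 0; 0; -1; -1; -1; 1]; [:: 1; 1; 1; 0;
      1; 0; 1; 1; 0; -1; 0; 0; 0; 0; 0; 0; 0; 0; 0; 0; 1]; [:: -1; 1; 1; 0; -1; 1; 1; -1; 0; 0; 1;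
      1; -1; 0; 0; 0; 0; 1; 1; 1; -1]; [:: 1; -1; -1; -1; 1; -1; 0; -1; -1; 0; -1; -1; -1; 0; 0; 0;
      0; 1; 1; 1; -1]; [:: 0; -1; 1; 1; -1; 0; 1; 1; 0; 0; 0; 0; 1; 0; 0; 0; 0; -1; -1; -1; -1]; [::
      -1; -1; -1; -1; 0; 1; 1; 1; 1; 1; 1; 1; -1; 0; 0; 0; 0; 1; 1; 1; 1]; [:: 1; -1; 1; 1; 1; -1;
      -1; -1; -1; 0; -1; -1; 1; 0; 0; 0; 0; -1; -1; -1; 0]; [:: 0; 1; 0; 0; 1; 0; -1; 1; -1; 1; 0;
      0; -1; 0; 0; 0; 0; 1; 1; 1; -1]; [:: 0; -1; 0; 1; -1; -1; -1; 1; 0; 1; -1; 0; -1; 0; 0; 1; 0;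
      -1; 1; 1; 0]; [:: 0; 1; 1; -1; 1; -1; -1; 0; -1; 1; -1; 1; -1; 0; 0; -1; 0; -1; 0; 0; 1]; [::
      1; 1; 0; 0; 1; 1; 1; 0; 1; 0; 1; -1; -1; -1; 0; 0; 0; -1; -1; -1; -1]; [:: 0; 1; -1; -1; -1;
      1; -1; 0; 1; 0; -1; -1; 0; -1; 0; 1; 0; 1; 0; 0; 1]; [:: -1; 0; 1; 0; -1; -1; 1; 1; 1; -1; 1;
      -1; -1; -1; -1; -1; 0; -1; 0; 0; 0]; [:: 0; 0; -1; 1; -1; 0; -1; 1; 1; 1; -1; 1; -1; -1; 0; 1;
      0; 1; 1; 1; 1]; [:: 1; 0; 1; 0; 0; -1; 0; 0; 0; 1; -1; 1; 1; 0; 0; -1; 0; -1; -1; 1; -1]; [::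
      -1; -1; 0; 0; 1; 1; -1; -1; 1; 0; 0; 1; 0; -1; -1; -1; -1; 0; 0; 0; 0]; [:: 1; 1; 1; 1; 0; -1;
      1; -1; 1; -1; 0; 0; 1; 0; 0; 0; 0; -1; -1; -1; 1]]).


(** * Evaluation of the certificates and the table *)

Lemma chiral_row0_0 : chiral (Lrow0 0).
Proof. by apply: (chiral_row (K := dual_row0) represents_row0 (D := vinberg0_0)); vm_compute. Qed.

Lemma chiral_row0_1 : chiral (Lrow0 1).
Proof. by apply: (chiral_row (K := dual_row0) represents_row0 (D := vinberg0_1)); vm_compute. Qed.

Lemma achiral_row0 t : (2 <= t <= 9)%N -> achiral (Lrow0 t).
Proof.
by apply: (achiral_row (K := dual_row0) represents_row0 (S := symmetry0)); vm_compute.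
Qed.

Lemma chiral_row1_0 : chiral (Lrow1 0).
Proof. by apply: (chiral_row (K := dual_row1) represents_row1 (D := vinberg1_0)); vm_compute. Qed.

Lemma chiral_row1_1 : chiral (Lrow1 1).
Proof. by apply: (chiral_row (K := dual_row1) represents_row1 (D := vinberg1_1)); vm_compute. Qed.

Lemma chiral_row1_2 : chiral (Lrow1 2).
Proof. by apply: (chiral_row (K := dual_row1) represents_row1 (D := vinberg1_2)); vm_compute. Qed.

Lemma chiral_row1_3 : chiral (Lrow1 3).
Proof. by apply: (chiral_row (K := dual_row1) represents_row1 (D := vinberg1_3)); vm_compute. Qed.

Lemma chiral_row1_4 : chiral (Lrow1 4).
Proof. by apply: (chiral_row (K := dual_row1) represents_row1 (D := vinberg1_4)); vm_compute. Qed.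

Lemma achiral_row1 t : (5 <= t <= 9)%N -> achiral (Lrow1 t).
Proof.
by apply: (achiral_row (K := dual_row1) represents_row1 (S := symmetry1)); vm_compute.
Qed.

Lemma chiral_row2_1 : chiral (Lrow2 1).
Proof. by apply: (chiral_row (K := dual_row2) represents_row2 (D := vinberg2_1)); vm_compute. Qed.

Lemma chiral_row2_2 : chiral (Lrow2 2).
Proof. by apply: (chiral_row (K := dual_row2) represents_row2 (D := vinberg2_2)); vm_compute. Qed.

Lemma chiral_row2_3 : chiral (Lrow2 3).
Proof. by apply: (chiral_row (K := dual_row2) represents_row2 (D := vinberg2_3)); vm_compute. Qed.

Lemma chiral_row2_4 : chiral (Lrow2 4).
Proof. by apply: (chiral_row (K := dual_row2) represents_row2 (D := vinberg2_4)); vm_compute. Qed.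

Lemma achiral_row2 t : (5 <= t <= 9)%N -> achiral (Lrow2 t).
Proof.
by apply: (achiral_row (K := dual_row2) represents_row2 (S := symmetry2)); vm_compute.
Qed.

Lemma chiral_row3_1 : chiral (Lrow3 1).
Proof. by apply: (chiral_row (K := dual_row3) represents_row3 (D := vinberg3_1)); vm_compute. Qed.

Lemma achiral_row3 t : (2 <= t <= 6)%N -> achiral (Lrow3 t).
Proof.
by apply: (achiral_row (K := dual_row3) represents_row3 (S := symmetry3)); vm_compute.
Qed.

Lemma chiral_row4_0 : chiral (Lrow4 0).
Proof. by apply: (chiral_row (K := dual_row4) represents_row4 (D := vinberg4_0)); vm_compute. Qed.

Lemma achiral_row4 t : (1 <= t <= 5)%N -> achiral (Lrow4 t).
Proof.
by apply: (achiral_row (K := dual_row4) represents_row4 (S := symmetry4)); vm_compute.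
Qed.

Lemma chiral_row5_0 : chiral (Lrow5 0).
Proof. by apply: (chiral_row (K := dual_row5) represents_row5 (D := vinberg5_0)); vm_compute. Qed.

Lemma achiral_row5 t : (1 <= t <= 5)%N -> achiral (Lrow5 t).
Proof.
by apply: (achiral_row (K := dual_row5) represents_row5 (S := symmetry5)); vm_compute.
Qed.

Lemma achiral_row6 t : (1 <= t <= 5)%N -> achiral (Lrow6 t).
Proof.
by apply: (achiral_row (K := dual_row6) represents_row6 (S := symmetry6)); vm_compute.
Qed.

Lemma achiral_row7 t : (1 <= t <= 2)%N -> achiral (Lrow7 t).
Proof.
by apply: (achiral_row (K := dual_row7) represents_row7 (S := symmetry7)); vm_compute.
Qed.

Lemma achiral_row8 t : (0 <= t <= 1)%N -> achiral (Lrow8 t).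
Proof.
by apply: (achiral_row (K := dual_row8) represents_row8 (S := symmetry8)); vm_compute.
Qed.

Lemma achiral_row9 t : (0 <= t <= 1)%N -> achiral (Lrow9 t).
Proof.
by apply: (achiral_row (K := dual_row9) represents_row9 (S := symmetry9)); vm_compute.
Qed.

Lemma achiral_row10 t : (1 <= t <= 1)%N -> achiral (Lrow10 t).
Proof.
by apply: (achiral_row (K := dual_row10) represents_row10 (S := symmetry10)); vm_compute.
Qed.

Local Close Scope Z_scope.
Local Open Scope nat_scope.

(* rho = ldim (row t); d = the 2-discriminant rank given in the table *)
Theorem theorem4p2 :
  (forall t : nat, (t <= 9)%N -> (achiral (Lrow0 t) <-> (2 <= t)%N)) /\
  (forall t : nat, (t <= 9)%N ->
     (achiral (Lrow1 t) <-> (14 <= ldim (Lrow1 t) + (t + 1))%N)) /\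
  (forall t : nat, (1 <= t <= 9)%N ->
     (achiral (Lrow2 t) <-> (14 <= ldim (Lrow2 t) + t)%N)) /\
  (forall t : nat, (1 <= t <= 6)%N ->
     (achiral (Lrow3 t) <-> (14 <= ldim (Lrow3 t) + (t + 2))%N)) /\
  (forall t : nat, (t <= 5)%N ->
     (achiral (Lrow4 t) <-> (14 <= ldim (Lrow4 t) + (t + 2))%N)) /\
  (forall t : nat, (t <= 5)%N ->
     (achiral (Lrow5 t) <-> (14 <= ldim (Lrow5 t) + (t + 1))%N)) /\
  (forall t : nat, (1 <= t <= 5)%N ->
     (achiral (Lrow6 t) <-> (14 <= ldim (Lrow6 t) + t)%N)) /\
  (forall t : nat, (1 <= t <= 2)%N -> achiral (Lrow7 t)) /\
  (forall t : nat, (t <= 1)%N -> achiral (Lrow8 t)) /\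
  (forall t : nat, (t <= 1)%N -> achiral (Lrow9 t)) /\
  achiral (Lrow10 1).
Proof.
split; [|split; [|split; [|split; [|split; [|split; [|split; [|split; [|split; [|split]]]]]]]]].
- move=> t tm; split=> [a|le]; last by apply: achiral_row0; move: le; rewrite /=; lia.
  have [le|lt] := leqP 2 t; first by rewrite /=; lia.
  have tE : t = 0%N \/ t = 1%N by lia.
  exfalso; move: a; move: tE.
  case=> [->|]; first exact: chiral_row0_0.
  by move=> ->; exact: chiral_row0_1.
- move=> t tm; split=> [a|le]; last by apply: achiral_row1; move: le; rewrite /=; lia.
  have [le|lt] := leqP 5 t; first by rewrite /=; lia.
  have tE : t = 0%N \/ t = 1%N \/ t = 2%N \/ t = 3%N \/ t = 4%N by lia.
  exfalso; move: a; move: tE.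
  case=> [->|]; first exact: chiral_row1_0.
  case=> [->|]; first exact: chiral_row1_1.
  case=> [->|]; first exact: chiral_row1_2.
  case=> [->|]; first exact: chiral_row1_3.
  by move=> ->; exact: chiral_row1_4.
- move=> t tm; split=> [a|le]; last by apply: achiral_row2; move: le; rewrite /=; lia.
  have [le|lt] := leqP 5 t; first by rewrite /=; lia.
  have tE : t = 1%N \/ t = 2%N \/ t = 3%N \/ t = 4%N by lia.
  exfalso; move: a; move: tE.
  case=> [->|]; first exact: chiral_row2_1.
  case=> [->|]; first exact: chiral_row2_2.
  case=> [->|]; first exact: chiral_row2_3.
  by move=> ->; exact: chiral_row2_4.
- move=> t tm; split=> [a|le]; last by apply: achiral_row3; move: le; rewrite /=; lia.
  have [le|lt] := leqP 2 t; first by rewrite /=; lia.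
  have tE : t = 1%N by lia.
  by case: chiral_row3_1; rewrite -tE.
- move=> t tm; split=> [a|le]; last by apply: achiral_row4; move: le; rewrite /=; lia.
  have [le|lt] := leqP 1 t; first by rewrite /=; lia.
  have tE : t = 0%N by lia.
  by case: chiral_row4_0; rewrite -tE.
- move=> t tm; split=> [a|le]; last by apply: achiral_row5; move: le; rewrite /=; lia.
  have [le|lt] := leqP 1 t; first by rewrite /=; lia.
  have tE : t = 0%N by lia.
  by case: chiral_row5_0; rewrite -tE.
- move=> t tm; split=> [a|le]; last by apply: achiral_row6; move: le; rewrite /=; lia.
  (* In this row t = 1 already gives rho + d = 13 + 1 = 14, so there is no chiral case. *)
  by rewrite /=; lia.
- by move=> t tm; apply: achiral_row7.
- by move=> t tm; apply: achiral_row8.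
- by move=> t tm; apply: achiral_row9.
- exact: achiral_row10.
Qed.
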